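(* Let $L$ be a differential graded Lie algebra over $\mathbb{Q}$ with homology $H=H(L)$, let $k\ge 3$, and consider the brackets $\{\ell_j\}$ on $H$ transferred through a homotopy retract of $L$. Suppose that $\ell_i=0$ for all $i\le k-2$. Let $x_1,\dots,x_k\in H$ be homogeneous classes with $[x_1,\dots,x_k]_W\neq\emptyset$. Then, up to a sign, $\ell_k(x_1,\dots,x_k)\in[x_1,\dots,x_k]_W$; precisely, $$\epsilon\,\ell_k(x_1,\dots,x_k)\in[x_1,\dots,x_k]_W,\qquad \epsilon=(-1)^{\sum_{i=1}^{k-1}(k-i)|x_i|}.$$
   Context: All vector spaces are $\mathbb{Z}$-graded over $\mathbb{Q}$; $|x|$ denotes degree. A DGL $(L,\partial)$ is a graded Lie algebra with a derivation $\partial$ of degree $-1$, $\partial^2=0$ (no boundedness is assumed). $\mathbb{L}(V)$ is the free graded Lie algebra on $V$. **Whitehead brackets.** Let $x_1,\dots,x_k\in H(L)$ be homogeneous, $n_j=|x_j|+1$. Let $U$ be the graded vector space with basis $u_{i_1\dots i_s}$, $1\le i_1<\dots<i_s\le k$, $1\le s<k$, $|u_{i_1\dots i_s}|=n_{i_1}+\dots+n_{i_s}-1$. $(\mathbb{L}(U),\partial)$ is the DGL with $\partial u_i=0$ and $$\partial u_{i_1\dots i_s}=\sum_{p=1}^{s-1}\sum_{\sigma\in\widetilde S(p,s-p)}\varepsilon(\sigma)\,[u_{i_{\sigma(1)}\dots i_{\sigma(p)}},u_{i_{\sigma(p+1)}\dots i_{\sigma(s)}}],$$ where $\widetilde S(p,s-p)$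 is the set of $(p,s-p)$-shuffles with $\sigma(1)=1$, and $\varepsilon(\sigma)=(-1)^{|u_{i_{\sigma(1)}\dots i_{\sigma(p)}}|}\kappa$, with $\kappa$ the Koszul sign of permuting symbols of degrees $n_{i_1},\dots,n_{i_s}$ by $\sigma$. Let $\omega\in\mathbb{L}(U)$ be the cycle given by the right-hand side for $s=k$, $i_j=j$. The $k$th order Whitehead bracket set $[x_1,\dots,x_k]_W\subset H(L)$ is the (possibly empty) set of homology classes $\overline{\phi(\omega)}$, where $\phi\colon(\mathbb{L}(U),\partial)\to L$ runs over DGL morphisms such that $\phi(u_j)$ is a cycle representing $x_j$ for $j=1,\dots,k$. **Homotopy retracts.** A homotopy retract $(L,i,q,K)$ of $L$ consists of chain maps $i\colon(H,0)\to(L,\partial)$, a quasi-isomorphism inducing the identity on $H=H(L)$, and $q\colon(L,\partial)\to(H,0)$ with $qi=\mathrm{id}_H$, and a degree $1$ linear map $K\colon L\to L$ with $\mathrm{id}_L-iq=\partial K+K\partial$. **Transferred brackets.** A homotopy retract induces a minimal $L_\infty$ structure $\{\ell_j\}_{j\ge1}$ on $H$ ($\ell_1=0$) given for $k\ge2$ by $\ell_k=\sum_{T\in\mathscr{T}_k}\frac{1}{|\mathrm{Aut}(T)|}\,q\circ\widetilde\ell_T\circ\mathcal{S}_k$. Here $\mathscr{T}_k$ is the set of isomorphism classes of binary rooted trees with $k$ leaves, each drawn in the plane (trees differing by exchanging the two branches at a vertex are isomorphic), and $\mathrm{Aut}(T)$ is the automorphism group of the rooted tree. $\mathcal{S}_k(v_1\otimes\dots\otimes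 v_k)=\sum_{\sigma\in S_k}\varepsilon_\sigma\varepsilon\,v_{\sigma(1)}\otimes\dots\otimes v_{\sigma(k)}$, with $\varepsilon_\sigma$ the signature and $\varepsilon$ the Koszul sign. $\widetilde\ell_T\colon H^{\otimes k}\to L$ is obtained by composing down from the leaves to the root, labelling leaves by $i$, internal edges by $K$, and each internal vertex by $(-1)^{p-1}[\,,]$, with $p$ the number of leaves above its left input; tensor products of maps are evaluated by $(f\otimes g)(a\otimes b)=(-1)^{|g||a|}f(a)\otimes g(b)$. *)

(* Defs.v *)
From HB Require Import structures.
From mathcomp Require Import all_boot all_order all_algebra all_fingroup.
From mathcomp Require Import generic_quotient.
From mathcomp Require Import boolp classical_sets.

Set Implicit Arguments.
Unset Strict Implicit.
Unset Printing Implicit Defensive.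

Import Order.TTheory GRing.Theory Num.Theory.
Local Open Scope ring_scope.
Local Open Scope quotient_scope.

(** A Z-graded vector space is the direct sum of its homogeneous parts
   [homog n]; the zero vector is homogeneous of every degree.  Signs
   [(-1) ^ n] have an integer exponent and live in [rat]. *)

Record gradedSpace := GradedSpace {
  gs_sort :> lmodType rat;
  homog : int -> gs_sort -> Prop;
  homog0 : forall n, homog n 0;
  homog_lin : forall n a x y, homog n x -> homog n y -> homog n (a *: x + y);
  homog_span : forall x, exists (s : seq int) (w : int -> gs_sort),
    [/\ uniq s, forall n, homog n (w n) & x = \sum_(n <- s) w n];
  homog_direct : forall (s : seq int) (w : int -> gs_sort),
    uniq s -> (forall n, homog n (w n)) -> \sum_(n <- s) w n = 0 ->
    forall n, n \in s -> w n = 0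
}.
Arguments homog {_} n x.

Definition has_degree (V W : gradedSpace) (m : int) (f : V -> W) : Prop :=
  forall n x, homog n x -> homog (n + m) (f x).

Record gradedLie := GradedLie {
  gl_space :> gradedSpace;
  bracket : gl_space -> gl_space -> gl_space;
  bracket_linl : forall y, linear (bracket^~ y);
  bracket_linr : forall x, linear (bracket x);
  bracket_homog : forall p q x y,
    homog p x -> homog q y -> homog (p + q) (bracket x y);
  bracket_anti : forall p q x y, homog p x -> homog q y ->
    bracket x y = - ((-1) ^ (p * q)) *: bracket y x;
  bracket_jacobi : forall p q r x y z, homog p x -> homog q y -> homog r z ->
    bracket x (bracket y z)
    = bracket (bracket x y) z + (-1) ^ (p * q) *: bracket y (bracket x z)
}.
Arguments bracket {_} x y.

Definition derivation (L : gradedLie) (m : int) (D : L -> L) : Prop :=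
  [/\ linear D, has_degree m D &
      forall p x y, homog p x ->
        D (bracket x y) = bracket (D x) y + (-1) ^ (m * p) *: bracket x (D y)].

(** No [diff \o diff = 0] here: morphisms out of the free algebra on the
   generators of the Whitehead bracket only involve this weaker structure. *)
Record dLie := DLie {
  dl_lie :> gradedLie;
  diff : dl_lie -> dl_lie;
  diff_der : derivation (-1) diff
}.
Arguments diff {_} x.

Record DGL := MkDGL {
  dgl_dlie :> dLie;
  diffK : forall x : dgl_dlie, diff (diff x) = 0
}.

Definition Lie_morphism (F L : gradedLie) (phi : F -> L) : Prop :=
  [/\ linear phi, has_degree 0 phi &
      forall x y, phi (bracket x y) = bracket (phi x) (phi y)].

Definition dLie_morphism (F L : dLie) (phi : F -> L) : Prop :=
  Lie_morphism phi /\ forall x, phi (diff x) = diff (phi x).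

Section GradedTheory.

Section Linear.
Variables (U V : lmodType rat) (f : U -> V).
Hypothesis hf : linear f.
Lemma lin_add x y : f (x + y) = f x + f y.
Proof. by have := hf 1 x y; rewrite !scale1r. Qed.
Lemma lin_zero : f 0 = 0.
Proof. by apply: (@addrI _ (f 0)); rewrite -lin_add !addr0. Qed.
Lemma lin_scale a x : f (a *: x) = a *: f x.
Proof. by have := hf a x 0; rewrite lin_zero !addr0. Qed.
Lemma lin_sum I (r : seq I) (P : pred I) (F : I -> U) :
  f (\sum_(i <- r | P i) F i) = \sum_(i <- r | P i) f (F i).
Proof. exact: (big_morph f lin_add lin_zero). Qed.
End Linear.

Lemma homogD (V : gradedSpace) n (x y : V) :
  homog n x -> homog n y -> homog n (x + y).
Proof. by move=> hx hy; rewrite -[x]scale1r; apply: homog_lin. Qed.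

Lemma homogZ (V : gradedSpace) n a (x : V) : homog n x -> homog n (a *: x).
Proof. by move=> hx; rewrite -[_ *: _]addr0; apply: homog_lin (homog0 _ _). Qed.

Lemma homogN (V : gradedSpace) n (x : V) : homog n x -> homog n (- x).
Proof. by rewrite -scaleN1r; apply: homogZ. Qed.

Lemma homog_sum (V : gradedSpace) n I (r : seq I) (P : pred I) (F : I -> V) :
  (forall i, P i -> homog n (F i)) -> homog n (\sum_(i <- r | P i) F i).
Proof.
by move=> h; apply: (big_ind (homog n)) => //; [exact: homog0 | exact: homogD].
Qed.

Section Bracket.
Variable L : gradedLie.
Implicit Types x y z : L.

Lemma bracketDl x y z : bracket (x + y) z = bracket x z + bracket y z.
Proof. exact: (lin_add (bracket_linl z)). Qed.
Lemma bracketDr x y z : bracket x (y + z) = bracket x y + bracket x z.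
Proof. exact: (lin_add (bracket_linr x)). Qed.
Lemma bracket0l z : bracket 0 z = 0.
Proof. exact: (lin_zero (bracket_linl z)). Qed.
Lemma bracket0r x : bracket x 0 = 0.
Proof. exact: (lin_zero (bracket_linr x)). Qed.
Lemma bracketZl a x z : bracket (a *: x) z = a *: bracket x z.
Proof. exact: (lin_scale (bracket_linl z)). Qed.
Lemma bracketZr a x z : bracket x (a *: z) = a *: bracket x z.
Proof. exact: (lin_scale (bracket_linr x)). Qed.
End Bracket.

Section Diff.
Variable L : dLie.
Implicit Types x y : L.
Lemma diff_linear : linear (diff : L -> L).
Proof. by case: (diff_der L). Qed.
Lemma diffD x y : diff (x + y) = diff x + diff y.
Proof. exact: (lin_add diff_linear). Qed.
Lemma diff0 : diff (0 : L) = 0.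
Proof. exact: lin_zero diff_linear. Qed.
Lemma diffZ a x : diff (a *: x) = a *: diff x.
Proof. exact: (lin_scale diff_linear). Qed.
Lemma diffN x : diff (- x) = - diff x.
Proof. by rewrite -scaleN1r diffZ scaleN1r. Qed.
Lemma diffB x y : diff (x - y) = diff x - diff y.
Proof. by rewrite diffD diffN. Qed.
Lemma diff_sum I (r : seq I) (P : pred I) (F : I -> L) :
  diff (\sum_(i <- r | P i) F i) = \sum_(i <- r | P i) diff (F i).
Proof. exact: (lin_sum diff_linear). Qed.
Lemma diff_homog n x : homog n x -> homog (n - 1) (diff x).
Proof. by case: (diff_der L) => _ h _; apply: h. Qed.
End Diff.

End GradedTheory.

(** The homology is graded by the degrees of the representing cycles. *)

Section Homology.
Variable L : DGL.

Definition is_cycle : {pred L} := fun x => diff x == 0.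

Lemma is_cycle_submod : submod_closed is_cycle.
Proof.
split=> [|a x y]; rewrite !unfold_in ?diff0 //.
by move=> /eqP hx /eqP hy; rewrite diffD diffZ hx hy scaler0 addr0.
Qed.
HB.instance Definition _ :=
  GRing.isSubmodClosed.Build rat L is_cycle is_cycle_submod.

Record cycles := Cycle { cycle_val :> L; cycleP : cycle_val \in is_cycle }.
HB.instance Definition _ := [isSub for cycle_val].
HB.instance Definition _ := [Choice of cycles by <:].
HB.instance Definition _ := [SubChoice_isSubLmodule of cycles by <:].

Definition homologous (x y : cycles) : bool :=
  `[< exists w : L, diff w = cycle_val x - cycle_val y >].

Lemma homologous_equiv : equiv_class_of homologous.
Proof.
split.
- by move=> x; apply/asboolP; exists 0; rewrite diff0 subrr.
- move=> x y; apply/asboolP/asboolP=> -[w e]; exists (- w);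
    by rewrite diffN e opprB.
- move=> y x z /asboolP[w e] /asboolP[w' e']; apply/asboolP; exists (w + w').
  by rewrite diffD e e' addrA subrK.
Qed.
Canonical homologous_equiv_rel := EquivRelPack homologous_equiv.

Definition homology_type := {eq_quot homologous_equiv_rel}.
HB.instance Definition _ := EqQuotient.on homology_type.
HB.instance Definition _ := Choice.on homology_type.

Definition hclass (z : cycles) : homology_type := \pi z.

Lemma hclassW (P : homology_type -> Prop) :
  (forall z, P (hclass z)) -> forall h, P h.
Proof. by move=> h; elim/quotW. Qed.

Lemma homology_eqP (x y : cycles) :
  (exists w : L, diff w = cycle_val x - cycle_val y)
  <-> hclass x = hclass y.
Proof.
split=> [h|]; first by apply/eqmodP/asboolP.
by move=> /eqmodP/asboolP.
Qed.

Let hzero : homology_type := hclass 0.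
Let hadd (x y : homology_type) : homology_type := hclass (repr x + repr y).
Let hopp (x : homology_type) : homology_type := hclass (- repr x).
Let hscale (a : rat) (x : homology_type) : homology_type := hclass (a *: repr x).

Let repr_pi (x : cycles) :
  exists w : L, diff w = cycle_val (repr (hclass x)) - cycle_val x.
Proof. by apply/homology_eqP; rewrite /hclass reprK. Qed.

Let haddE x y : hadd (hclass x) (hclass y) = hclass (x + y).
Proof.
apply/homology_eqP; have [w e] := repr_pi x; have [w' e'] := repr_pi y.
by exists (w + w'); rewrite diffD e e' [in RHS]/= opprD addrACA.
Qed.
Let hoppE x : hopp (hclass x) = hclass (- x).
Proof.
apply/homology_eqP; have [w e] := repr_pi x.
by exists (- w); rewrite diffN e [in RHS]/= opprD.
Qed.
Let hscaleE a x : hscale a (hclass x) = hclass (a *: x).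
Proof.
apply/homology_eqP; have [w e] := repr_pi x.
by exists (a *: w); rewrite diffZ e [in RHS]/= scalerBr.
Qed.

Let haddA : associative hadd.
Proof. by elim/hclassW=> x; elim/hclassW=> y; elim/hclassW=> z; rewrite !haddE addrA. Qed.
Let haddC : commutative hadd.
Proof. by elim/hclassW=> x; elim/hclassW=> y; rewrite !haddE addrC. Qed.
Let hadd0 : left_id hzero hadd.
Proof. by elim/hclassW=> x; rewrite !haddE add0r. Qed.
Let haddN : left_inverse hzero hopp hadd.
Proof. by elim/hclassW=> x; rewrite hoppE haddE addNr. Qed.
HB.instance Definition _ :=
  GRing.isZmodule.Build homology_type haddA haddC hadd0 haddN.

Let hscaleA a b v : hscale a (hscale b v) = hscale (a * b) v.
Proof. by elim/hclassW: v => x; rewrite !hscaleE scalerA. Qed.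
Let hscale1 : left_id 1 hscale.
Proof. by elim/hclassW=> x; rewrite hscaleE scale1r. Qed.
Let hscaleDr : right_distributive hscale +%R.
Proof.
move=> a; elim/hclassW=> x; elim/hclassW=> y.
by rewrite [_ + _]haddE !hscaleE [RHS]haddE scalerDr.
Qed.
Let hscaleDl v : {morph hscale^~ v : a b / a + b}.
Proof.
by move=> a b; elim/hclassW: v => x; rewrite !hscaleE [RHS]haddE scalerDl.
Qed.
HB.instance Definition _ := GRing.Zmodule_isLmodule.Build rat homology_type
  hscaleA hscale1 hscaleDr hscaleDl.

Lemma hclassP a x y : hclass (a *: x + y) = a *: hclass x + hclass y.
Proof. by rewrite -haddE -hscaleE. Qed.
Lemma hclass0 : hclass 0 = 0. Proof. by []. Qed.
Lemma hclassD x y : hclass (x + y) = hclass x + hclass y.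
Proof. by rewrite -[x]scale1r hclassP !scale1r. Qed.
Lemma hclass_sum I (r : seq I) (F : I -> cycles) :
  hclass (\sum_(i <- r) F i) = \sum_(i <- r) hclass (F i).
Proof. exact: (big_morph hclass hclassD hclass0). Qed.
Lemma hclass_eq0 (x : cycles) :
  hclass x = 0 <-> exists w : L, diff w = cycle_val x.
Proof.
rewrite -hclass0 -homology_eqP.
by split=> -[w e]; exists w; move: e; rewrite /= subr0.
Qed.

Definition homology_homog (n : int) (h : homology_type) : Prop :=
  exists z : cycles, homog n (cycle_val z) /\ h = hclass z.

Lemma homology_homog0 n : homology_homog n 0.
Proof. by exists 0; split; [exact: homog0 | rewrite hclass0]. Qed.

Lemma homology_homog_lin n a x y :
  homology_homog n x -> homology_homog n y -> homology_homog n (a *: x + y).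
Proof.
move=> [z [hz ->]] [t [ht ->]]; exists (a *: z + t); split; last by rewrite hclassP.
exact: homog_lin.
Qed.

Lemma homology_homog_span x :
  exists (s : seq int) (w : int -> homology_type),
    [/\ uniq s, forall n, homology_homog n (w n) & x = \sum_(n <- s) w n].
Proof.
elim/hclassW: x => z.
have [s [w [us hw e]]] := homog_span (cycle_val z).
have dw n : n \in s -> diff (w n) = 0.
  move=> ns; pose w' m : L := diff (w (m + 1)).
  have hw' m : homog m (w' m).
    by rewrite -[m](addrK 1); apply: diff_homog; rewrite addrK.
  have us' : uniq [seq m - 1 | m <- s] by rewrite map_inj_uniq //; exact: addIr.
  have sum0 : \sum_(m <- [seq m - 1 | m <- s]) w' m = 0.
    rewrite big_map; under eq_bigr do rewrite /w' subrK.
    by rewrite -diff_sum -e; apply/eqP/(cycleP z).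
  have := homog_direct us' hw' sum0 (map_f _ ns).
  by rewrite /w' subrK.
have dc n : (if n \in s then w n else 0) \in is_cycle.
  by rewrite unfold_in; case: ifP => [/dw->|_]; rewrite ?diff0.
exists s, (fun n => hclass (Cycle (dc n))); split=> //.
  move=> n; exists (Cycle (dc n)); split=> //=.
  by case: ifP => // _; exact: homog0.
rewrite -hclass_sum; congr hclass; apply: val_inj.
rewrite raddf_sum /= e big_seq [RHS]big_seq; apply: eq_bigr => n ns /=.
by rewrite ns.
Qed.

Lemma homology_homog_direct (s : seq int) (w : int -> homology_type) :
  uniq s -> (forall n, homology_homog n (w n)) -> \sum_(n <- s) w n = 0 ->
  forall n, n \in s -> w n = 0.
Proof.
move=> us hw sum0 n ns.
pose z n := sval (cid (hw n)).
have [hz wz] : (forall n, homog n (cycle_val (z n)))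
    /\ forall n, w n = hclass (z n).
  by split=> m; case: (svalP (cid (hw m))).
move: sum0; under eq_bigr do rewrite wz.
rewrite -hclass_sum => /hclass_eq0[b eb].
have [t [v [ut hv e]]] := homog_span b.
pose V m : L := if m \in t then v m else 0.
pose Z m : L := if m \in s then cycle_val (z m) else 0.
have hV m : homog m (V m) by rewrite /V; case: ifP => // _; exact: homog0.
have hZ m : homog m (Z m) by rewrite /Z; case: ifP => // _; exact: homog0.
pose r := undup (s ++ [seq m - 1 | m <- t]).
have extend (F : int -> L) (q : seq int) : uniq q -> {subset q <= r} ->
    (forall m, m \notin q -> F m = 0) ->
    \sum_(m <- r) F m = \sum_(m <- q) F m.
  move=> uq qr F0; rewrite (bigID (mem q)) /= [X in _ + X]big1 ?addr0 //.
  rewrite -big_filter; apply: perm_big; apply: uniq_perm => //.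
    by rewrite filter_uniq ?undup_uniq.
  by move=> m; rewrite mem_filter andb_idr // => /qr.
have ZD m : homog m (Z m - diff (V (m + 1))).
  apply: homogD => //; apply: homogN.
  by rewrite -[X in homog X _](addrK 1); exact: diff_homog.
have nr : n \in r by rewrite mem_undup mem_cat ns.
have sum0 : \sum_(m <- r) (Z m - diff (V (m + 1))) = 0.
  rewrite sumrB (extend Z s) //; first last.
  - by move=> m /negbTE ms; rewrite /Z ms.
  - by move=> m ms; rewrite mem_undup mem_cat ms.
  rewrite (extend _ [seq m - 1 | m <- t]); first last.
  - move=> m mt; rewrite /V ifF ?diff0 //; apply: contraNF mt => mt.
    by apply/mapP; exists (m + 1); rewrite ?addrK.
  - by move=> m ms; rewrite mem_undup mem_cat ms orbT.
  - by rewrite map_inj_uniq //; exact: addIr.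
  rewrite big_map; under [X in _ - X]eq_bigr do rewrite subrK.
  rewrite -diff_sum.
  have -> : \sum_(m <- t) V m = b.
    by rewrite e big_seq [RHS]big_seq; apply: eq_bigr => m mt; rewrite /V mt.
  rewrite eb -[cycle_val _]/(val _) raddf_sum /= big_seq [X in _ - X]big_seq.
  by apply/eqP; rewrite subr_eq0; apply/eqP/eq_bigr => m ms; rewrite /Z ms.
have /eqP := homog_direct (undup_uniq _) ZD sum0 nr.
rewrite subr_eq0 {1}/Z ns => /eqP en.
by rewrite wz; apply/hclass_eq0; exists (V (n + 1)).
Qed.

Definition homology : gradedSpace :=
  GradedSpace homology_homog0 homology_homog_lin homology_homog_span
              homology_homog_direct.

Definition represents (z : L) (h : homology) : Prop :=
  exists c : cycles, z = cycle_val c /\ h = hclass c.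

End Homology.

(** The free graded Lie algebra on generators [g : G] of degree [deg g]:
   formal Lie expressions in the generators, modulo the congruence generated
   by the axioms of a rational vector space, the bilinearity of the bracket,
   and graded antisymmetry and the graded Jacobi identity for homogeneous
   expressions. *)

Section FreeLie.
Variables (G : Type) (deg : G -> int).

Inductive lterm : Type :=
| TGen of G
| TZero
| TAdd of lterm & lterm
| TScale of rat & lterm
| TBr of lterm & lterm.

Inductive thomog : int -> lterm -> Prop :=
| thomog_gen g : thomog (deg g) (TGen g)
| thomog_zero n : thomog n TZero
| thomog_add n x y : thomog n x -> thomog n y -> thomog n (TAdd x y)
| thomog_scale n a x : thomog n x -> thomog n (TScale a x)
| thomog_br p q x y : thomog p x -> thomog q y -> thomog (p + q) (TBr x y).

Inductive teq : lterm -> lterm -> Prop :=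
| teq_refl x : teq x x
| teq_sym x y : teq x y -> teq y x
| teq_trans x y z : teq x y -> teq y z -> teq x z
| teq_add x x' y y' : teq x x' -> teq y y' -> teq (TAdd x y) (TAdd x' y')
| teq_scale a x x' : teq x x' -> teq (TScale a x) (TScale a x')
| teq_br x x' y y' : teq x x' -> teq y y' -> teq (TBr x y) (TBr x' y')
| teq_addA x y z : teq (TAdd x (TAdd y z)) (TAdd (TAdd x y) z)
| teq_addC x y : teq (TAdd x y) (TAdd y x)
| teq_add0 x : teq (TAdd TZero x) x
| teq_addN x : teq (TAdd (TScale (-1) x) x) TZero
| teq_scaleA a b x : teq (TScale a (TScale b x)) (TScale (a * b) x)
| teq_scale1 x : teq (TScale 1 x) x
| teq_scaleDr a x y : teq (TScale a (TAdd x y)) (TAdd (TScale a x) (TScale a y))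
| teq_scaleDl a b x : teq (TScale (a + b) x) (TAdd (TScale a x) (TScale b x))
| teq_brDl x y z : teq (TBr (TAdd x y) z) (TAdd (TBr x z) (TBr y z))
| teq_brDr x y z : teq (TBr x (TAdd y z)) (TAdd (TBr x y) (TBr x z))
| teq_brZl a x y : teq (TBr (TScale a x) y) (TScale a (TBr x y))
| teq_brZr a x y : teq (TBr x (TScale a y)) (TScale a (TBr x y))
| teq_anti p q x y : thomog p x -> thomog q y ->
    teq (TBr x y) (TScale (- (-1) ^ (p * q)) (TBr y x))
| teq_jacobi p q r x y z : thomog p x -> thomog q y -> thomog r z ->
    teq (TBr x (TBr y z))
        (TAdd (TBr (TBr x y) z) (TScale ((-1) ^ (p * q)) (TBr y (TBr x z)))).

HB.instance Definition _ := gen_eqMixin lterm.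
HB.instance Definition _ := gen_choiceMixin lterm.

Lemma teq_equiv : equiv_class_of (fun x y => `[< teq x y >]).
Proof.
split.
- by move=> x; apply/asboolP; apply: teq_refl.
- by move=> x y; apply/asboolP/asboolP; apply: teq_sym.
- by move=> y x z /asboolP h /asboolP h'; apply/asboolP; apply: teq_trans h h'.
Qed.
Canonical teq_equiv_rel := EquivRelPack teq_equiv.

Definition free_type := {eq_quot teq_equiv_rel}.
HB.instance Definition _ := EqQuotient.on free_type.
HB.instance Definition _ := Choice.on free_type.

Definition fclass (t : lterm) : free_type := \pi t.

Lemma fclassW (P : free_type -> Prop) : (forall t, P (fclass t)) -> forall x, P x.
Proof. by move=> h; elim/quotW. Qed.

Lemma fclassP x y : teq x y <-> fclass x = fclass y.
Proof.
split=> [h|]; first by apply/eqmodP/asboolP.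
by move=> /eqmodP/asboolP.
Qed.

Let fzero : free_type := fclass TZero.
Let fadd (x y : free_type) : free_type := fclass (TAdd (repr x) (repr y)).
Let fscale (a : rat) (x : free_type) : free_type := fclass (TScale a (repr x)).
Let fopp (x : free_type) : free_type := fscale (-1) x.
Definition fbracket (x y : free_type) : free_type :=
  fclass (TBr (repr x) (repr y)).

Let repr_fclass x : teq (repr (fclass x)) x.
Proof. by apply/fclassP; rewrite /fclass reprK. Qed.

Let faddE x y : fadd (fclass x) (fclass y) = fclass (TAdd x y).
Proof. by apply/fclassP; apply: teq_add. Qed.
Let fscaleE a x : fscale a (fclass x) = fclass (TScale a x).
Proof. by apply/fclassP; apply: teq_scale. Qed.
Lemma fbracketE x y : fbracket (fclass x) (fclass y) = fclass (TBr x y).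
Proof. by apply/fclassP; apply: teq_br. Qed.

Let faddA : associative fadd.
Proof.
elim/fclassW=> x; elim/fclassW=> y; elim/fclassW=> z; rewrite !faddE.
by apply/fclassP/teq_addA.
Qed.
Let faddC : commutative fadd.
Proof.
by elim/fclassW=> x; elim/fclassW=> y; rewrite !faddE; apply/fclassP/teq_addC.
Qed.
Let fadd0 : left_id fzero fadd.
Proof. by elim/fclassW=> x; rewrite !faddE; apply/fclassP/teq_add0. Qed.
Let faddN : left_inverse fzero fopp fadd.
Proof.
by elim/fclassW=> x; rewrite /fopp fscaleE faddE; apply/fclassP/teq_addN.
Qed.
HB.instance Definition _ :=
  GRing.isZmodule.Build free_type faddA faddC fadd0 faddN.

Let fscaleA a b v : fscale a (fscale b v) = fscale (a * b) v.
Proof. by elim/fclassW: v => x; rewrite !fscaleE; apply/fclassP/teq_scaleA. Qed.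
Let fscale1 : left_id 1 fscale.
Proof. by elim/fclassW=> x; rewrite fscaleE; apply/fclassP/teq_scale1. Qed.
Let fscaleDr : right_distributive fscale +%R.
Proof.
move=> a; elim/fclassW=> x; elim/fclassW=> y.
by rewrite [_ + _]faddE !fscaleE [RHS]faddE; apply/fclassP/teq_scaleDr.
Qed.
Let fscaleDl v : {morph fscale^~ v : a b / a + b}.
Proof.
move=> a b; elim/fclassW: v => x; rewrite !fscaleE [RHS]faddE.
exact/fclassP/teq_scaleDl.
Qed.
HB.instance Definition _ := GRing.Zmodule_isLmodule.Build rat free_type
  fscaleA fscale1 fscaleDr fscaleDl.

Lemma fclass0 : fclass TZero = 0. Proof. by []. Qed.
Lemma fclassD x y : fclass (TAdd x y) = fclass x + fclass y.
Proof. by rewrite -faddE. Qed.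
Lemma fclassZ a x : fclass (TScale a x) = a *: fclass x.
Proof. by rewrite -fscaleE. Qed.

Lemma fbracket_linl y : linear (fbracket^~ y).
Proof.
move=> a; elim/fclassW: y => z; elim/fclassW=> x; elim/fclassW=> y /=.
rewrite -fclassZ -fclassD !fbracketE -fclassZ -fclassD; apply/fclassP.
apply: teq_trans (teq_brDl _ _ _) _; apply: teq_add (teq_refl _).
exact: teq_brZl.
Qed.
Lemma fbracket_linr x : linear (fbracket x).
Proof.
move=> a; elim/fclassW: x => x; elim/fclassW=> y; elim/fclassW=> z.
rewrite -fclassZ -fclassD !fbracketE -fclassZ -fclassD; apply/fclassP.
apply: teq_trans (teq_brDr _ _ _) _; apply: teq_add (teq_refl _).
exact: teq_brZr.
Qed.

Definition fhomog (n : int) (x : free_type) : Prop :=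
  exists t, thomog n t /\ x = fclass t.

Lemma fhomog0 n : fhomog n 0.
Proof. by exists TZero; split=> //; apply: thomog_zero. Qed.

Lemma fhomog_lin n a x y : fhomog n x -> fhomog n y -> fhomog n (a *: x + y).
Proof.
move=> [s [hs ->]] [t [ht ->]]; exists (TAdd (TScale a s) t).
split; last by rewrite fclassD fclassZ.
by apply: thomog_add => //; apply: thomog_scale.
Qed.

Lemma fbracket_homog p q x y :
  fhomog p x -> fhomog q y -> fhomog (p + q) (fbracket x y).
Proof.
move=> [s [hs ->]] [t [ht ->]]; exists (TBr s t).
by split; [apply: thomog_br | rewrite fbracketE].
Qed.

Lemma fbracket_anti p q x y : fhomog p x -> fhomog q y ->
  fbracket x y = - ((-1) ^ (p * q)) *: fbracket y x.
Proof.
move=> [s [hs ->]] [t [ht ->]]; rewrite !fbracketE -fclassZ.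
exact/fclassP/teq_anti.
Qed.

Lemma fbracket_jacobi p q r x y z : fhomog p x -> fhomog q y -> fhomog r z ->
  fbracket x (fbracket y z)
  = fbracket (fbracket x y) z + (-1) ^ (p * q) *: fbracket y (fbracket x z).
Proof.
move=> [s [hs ->]] [t [ht ->]] [u [hu ->]].
by rewrite !fbracketE -fclassZ -fclassD; apply/fclassP/(teq_jacobi hs ht hu).
Qed.

(* [tdil c] multiplies a homogeneous expression of degree [n] by [c ^ n].
   With c = 2 it separates the degrees; with c = -1 it supplies the signs of
   a derivation of odd degree. *)
Fixpoint tdil (c : rat) (t : lterm) : lterm :=
  match t with
  | TGen g => TScale (c ^ deg g) (TGen g)
  | TZero => TZero
  | TAdd x y => TAdd (tdil c x) (tdil c y)
  | TScale a x => TScale a (tdil c x)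
  | TBr x y => TBr (tdil c x) (tdil c y)
  end.

Lemma thomog_tdil c n t : thomog n t -> thomog n (tdil c t).
Proof.
elim=> {n t} /=; try by move=> *; constructor.
by move=> g; apply: thomog_scale; constructor.
Qed.

Lemma teq_tdil c x y : teq x y -> teq (tdil c x) (tdil c y).
Proof.
elim=> {x y} /=; try by move=> *; constructor.
- by move=> x y z _ h _; apply: teq_trans.
- by move=> p q x y hx hy; apply: teq_anti; apply: thomog_tdil.
- by move=> p q r x y z hx hy hz; apply: teq_jacobi; apply: thomog_tdil; eassumption.
Qed.

Definition fdil (c : rat) (x : free_type) : free_type := fclass (tdil c (repr x)).

Lemma fdilE c t : fdil c (fclass t) = fclass (tdil c t).
Proof. by apply/fclassP/teq_tdil. Qed.

Lemma fdil_lin c : linear (fdil c).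
Proof.
move=> a; elim/fclassW=> x; elim/fclassW=> y.
by rewrite -fclassZ -fclassD !fdilE /= fclassD fclassZ.
Qed.

Lemma fdil_homog c n x : c != 0 -> fhomog n x -> fdil c x = c ^ n *: x.
Proof.
move=> c0 [t [ht ->]]; rewrite fdilE.
elim: ht => {n t x} /= [g|n|n x y _ ex _ ey|n a x _ ex|p q x y _ ex _ ey].
- by rewrite fclassZ.
- by rewrite fclass0 scaler0.
- by rewrite !fclassD ex ey scalerDr.
- by rewrite !fclassZ ex !scalerA mulrC.
- rewrite -!fbracketE ex ey.
  rewrite (lin_scale (fbracket_linl _)) (lin_scale (fbracket_linr _)).
  by rewrite scalerA expfzDr.
Qed.

Lemma fhomog_direct (s : seq int) (w : int -> free_type) :
  uniq s -> (forall n, fhomog n (w n)) -> \sum_(n <- s) w n = 0 ->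
  forall n, n \in s -> w n = 0.
Proof.
move=> us hw; elim: s us w hw => //= m s IH /andP[ms us] w hw.
rewrite big_cons => sum0.
have dils : \sum_(n <- s) (2 ^ n *: w n) = fdil 2 (\sum_(n <- s) w n).
  rewrite (lin_sum (fdil_lin 2)); apply: eq_bigr => n _.
  by rewrite (fdil_homog (n := n)).
have sumE : \sum_(n <- s) w n = - w m by apply/eqP; rewrite -addr_eq0 addrC sum0.
have ws n : n \in s -> w n = 0.
  move=> ns; pose v i := (2 ^ i - 2 ^ m) *: w i.
  have hv i : fhomog i (v i).
    by rewrite /v -[_ *: _]addr0; apply: fhomog_lin (hw i) (fhomog0 _).
  have hwm : fhomog m (- w m).
    by rewrite -scaleN1r -[_ *: _]addr0; apply: fhomog_lin (hw m) (fhomog0 _).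
  have sumv : \sum_(i <- s) v i = 0.
    under eq_bigr do rewrite /v scalerBl.
    by rewrite sumrB dils -scaler_sumr sumE (fdil_homog _ hwm) // subrr.
  have /eqP := IH us v hv sumv n ns.
  rewrite scaler_eq0 subr_eq0 => /orP[/eqP e|/eqP//].
  have nm : n = m.
    case: (ltgtP n m) => // lt_nm; move: e => /eqP.
      by rewrite lt_eqF // ltr_eXz2l.
    by rewrite gt_eqF // ltr_eXz2l.
  by rewrite -nm ns in ms.
move=> n; rewrite inE => /orP[/eqP->|/ws//].
by move: sum0; rewrite big_seq big1 ?addr0 // => i /ws.
Qed.

Lemma fhomog_span x : exists (s : seq int) (w : int -> free_type),
  [/\ uniq s, forall n, fhomog n (w n) & x = \sum_(n <- s) w n].
Proof.
pose dec x := exists (s : seq int) (w : int -> free_type),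
  [/\ uniq s, forall n, fhomog n (w n) & x = \sum_(n <- s) w n].
have decH n y : fhomog n y -> dec y.
  move=> hy; exists [:: n], (fun m => if m == n then y else 0); split=> // [m|].
    by case: eqP => [->//|_]; exact: fhomog0.
  by rewrite big_seq1 eqxx.
have dec0 : dec 0 by exact: decH (fhomog0 0).
have decD y z : dec y -> dec z -> dec (y + z).
  move=> [s [v [us hv ->]]] [t [w [ut hw ->]]].
  pose r := undup (s ++ t).
  have extend (F : int -> free_type) (q : seq int) : uniq q -> {subset q <= r} ->
      \sum_(m <- q) F m = \sum_(m <- r) (if m \in q then F m else 0).
    move=> uq qr; rewrite -big_mkcond /= -[RHS]big_filter.
    apply: perm_big; apply: uniq_perm; rewrite ?filter_uniq ?undup_uniq //.
    by move=> m; rewrite mem_filter andb_idr // => /qr.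
  exists r, (fun n => 1 *: (if n \in s then v n else 0)
                      + (if n \in t then w n else 0)); split.
  - exact: undup_uniq.
  - by move=> n; apply: fhomog_lin; case: ifP => // _; exact: fhomog0.
  - under [RHS]eq_bigr do rewrite scale1r.
    rewrite big_split /= -!extend // => m ms; by rewrite mem_undup mem_cat ms ?orbT.
have dec_sum (r : seq int) (F : int -> free_type) :
    (forall i, dec (F i)) -> dec (\sum_(i <- r) F i).
  by move=> h; apply: (big_ind dec).
rewrite -/(dec x); elim/fclassW: x; elim.
- by move=> g; apply: (decH (deg g)); exists (TGen g); split=> //; constructor.
- by [].
- by move=> y hy z hz; rewrite fclassD; apply: decD.
- move=> a y [s [w [us hw e]]]; rewrite fclassZ e scaler_sumr.
  apply: dec_sum => n; apply: (decH n); rewrite -[_ *: _]addr0.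
  exact: fhomog_lin (hw n) (fhomog0 _).
- move=> y [s [v [us hv ey]]] z [t [w [ut hw ez]]].
  rewrite -fbracketE ey ez (lin_sum (fbracket_linl _)); apply: (dec_sum _) => i.
  rewrite (lin_sum (fbracket_linr _)); apply: (dec_sum _) => j.
  by apply: (decH (i + j)); exact: fbracket_homog.
Qed.

Definition freeLie : gradedLie :=
  @GradedLie (GradedSpace fhomog0 fhomog_lin fhomog_span fhomog_direct)
    fbracket fbracket_linl fbracket_linr fbracket_homog fbracket_anti
    fbracket_jacobi.

Definition free_gen (g : G) : freeLie := fclass (TGen g).

Lemma free_gen_homog g : homog (deg g) (free_gen g).
Proof. by exists (TGen g); split=> //; apply: thomog_gen. Qed.

(** Universal property: a degree-preserving map on the generators extends
   uniquely to a morphism of graded Lie algebras. *)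
Section FreeUniversal.
Variables (M : gradedLie) (f : G -> M).
Hypothesis f_homog : forall g, homog (deg g) (f g).

Fixpoint teval (t : lterm) : M :=
  match t with
  | TGen g => f g
  | TZero => 0
  | TAdd x y => teval x + teval y
  | TScale a x => a *: teval x
  | TBr x y => bracket (teval x) (teval y)
  end.

Definition free_lift (x : freeLie) : M := teval (repr (x : free_type)).

Lemma teval_homog n t : thomog n t -> homog n (teval t).
Proof.
elim=> {n t} /=.
- exact: f_homog.
- by move=> n; exact: homog0.
- by move=> n x y _ hx _ hy; exact: homogD.
- by move=> n a x _ hx; exact: homogZ.
- by move=> p q x y _ hx _ hy; exact: bracket_homog.
Qed.

Lemma teval_teq x y : teq x y -> teval x = teval y.
Proof.
move=> h; elim: h => {x y} //=.
- by move=> x y z _ -> _ ->.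
- by move=> x x' y y' _ -> _ ->.
- by move=> a x x' _ ->.
- by move=> x x' y y' _ -> _ ->.
- by move=> x y z; rewrite addrA.
- by move=> x y; rewrite addrC.
- by move=> x; rewrite add0r.
- by move=> x; rewrite scaleN1r addNr.
- by move=> a b x; rewrite scalerA.
- by move=> x; rewrite scale1r.
- by move=> a x y; rewrite scalerDr.
- by move=> a b x; rewrite scalerDl.
- by move=> x y z; rewrite bracketDl.
- by move=> x y z; rewrite bracketDr.
- by move=> a x y; rewrite bracketZl.
- by move=> a x y; rewrite bracketZr.
- by move=> p q x y hx hy; apply: bracket_anti; exact: teval_homog.
- by move=> p q r x y z hx hy hz; apply: bracket_jacobi (teval_homog hz);
     exact: teval_homog.
Qed.

Lemma free_liftE t : free_lift (fclass t) = teval t.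
Proof. by apply/teval_teq/fclassP; rewrite /fclass reprK. Qed.

Lemma free_lift_gen g : free_lift (free_gen g) = f g.
Proof. exact: (free_liftE (TGen g)). Qed.

Lemma free_lift_morphism : Lie_morphism free_lift.
Proof.
split.
- move=> a; elim/fclassW=> x; elim/fclassW=> y.
  have := free_liftE (TAdd (TScale a x) y).
  by rewrite fclassD fclassZ /= -!free_liftE.
- by move=> n x [t [ht ->]]; rewrite free_liftE addr0; exact: teval_homog.
- elim/fclassW=> x; elim/fclassW=> y; have := free_liftE (TBr x y).
  by rewrite -fbracketE /= -!free_liftE.
Qed.

Lemma free_lift_unique (phi : freeLie -> M) :
  Lie_morphism phi -> (forall g, phi (free_gen g) = f g) -> phi =1 free_lift.
Proof.
case=> phil _ phib phig; elim/fclassW=> t; rewrite free_liftE.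
elim: t => [g||x ex y ey|a x ex|x ex y ey].
- exact: phig.
- exact: (lin_zero phil).
- by rewrite fclassD [LHS](lin_add phil) ex ey.
- by rewrite fclassZ [LHS](lin_scale phil) ex.
- by rewrite -fbracketE [LHS]phib ex ey.
Qed.

End FreeUniversal.

(** The derivation of degree -1 with prescribed values on the generators. *)
Section FreeDerivation.
Variable w : G -> freeLie.
Hypothesis w_homog : forall g, homog (deg g - 1) (w g).

Let cls (t : lterm) : freeLie := fclass t.
Let sg (x : freeLie) : freeLie := fdil (-1) x.

Fixpoint tder (t : lterm) : freeLie :=
  match t with
  | TGen g => w g
  | TZero => 0
  | TAdd x y => tder x + tder y
  | TScale a x => a *: tder x
  | TBr x y => bracket (tder x) (cls y) + bracket (sg (cls x)) (tder y)
  end.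

Definition free_der (x : freeLie) : freeLie := tder (repr (x : free_type)).

Let tderD x y : tder (TAdd x y) = tder x + tder y. Proof. by []. Qed.
Let tderZ a x : tder (TScale a x) = a *: tder x. Proof. by []. Qed.
Let tderB x y :
  tder (TBr x y) = bracket (tder x) (cls y) + bracket (sg (cls x)) (tder y).
Proof. by []. Qed.
Let tder0 : tder TZero = 0. Proof. by []. Qed.
Let clsD x y : cls (TAdd x y) = cls x + cls y. Proof. exact: fclassD. Qed.
Let clsZ a x : cls (TScale a x) = a *: cls x. Proof. exact: fclassZ. Qed.
Let clsB x y : cls (TBr x y) = bracket (cls x) (cls y).
Proof. exact: (esym (fbracketE x y)). Qed.
Let cls_homog n x : thomog n x -> homog n (cls x).
Proof. by exists x. Qed.
Let tderE := (tderD, tderZ, tderB, tder0, clsD, clsZ, clsB).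
Let sgD x y : sg (x + y) = sg x + sg y.
Proof. exact: (lin_add (fdil_lin (-1))). Qed.
Let sgZ a x : sg (a *: x) = a *: sg x.
Proof. exact: (lin_scale (fdil_lin (-1))). Qed.
Let sg_homog n x : homog n x -> sg x = (-1) ^ n *: x.
Proof. exact: fdil_homog. Qed.

Let sgnB (p q : int) : (-1 : rat) ^ (p - q) = (-1) ^ p * (-1) ^ q.
Proof. by rewrite expfzDr //; congr (_ * _); rewrite -exprz_inv invrN1. Qed.
Let sgnD (p q : int) : (-1 : rat) ^ (p + q) = (-1) ^ p * (-1) ^ q.
Proof. by rewrite expfzDr. Qed.
Let sgnK (p : int) : (-1 : rat) ^ p * (-1) ^ p = 1.
Proof. by rewrite -sgnB subrr. Qed.

Lemma tder_homog n t : thomog n t -> homog (n - 1) (tder t).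
Proof.
elim=> {n t}.
- exact: w_homog.
- by move=> n; rewrite tder0; exact: homog0.
- by move=> n x y _ hx _ hy; exact: (homogD hx hy).
- by move=> n a x _ hx; exact: (homogZ a hx).
- move=> p q x y hx dx hy dy.
  have h1 := bracket_homog dx (cls_homog hy); rewrite addrAC in h1.
  have := homogZ ((-1) ^ p) (bracket_homog (cls_homog hx) dy).
  by rewrite addrA -bracketZl -sg_homog; [exact: homogD h1 | exact: cls_homog].
Qed.

Lemma tder_teq x y : teq x y -> tder x = tder y.
Proof.
move=> h; elim: h => {x y}.
- by [].
- by [].
- by move=> x y z _ -> _ ->.
- by move=> x x' y y' _ ex _ ey; rewrite !tderE ex ey.
- by move=> a x x' _ ex; rewrite !tderE ex.
- move=> x x' y y' /fclassP ex dx /fclassP ey dy.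
  by rewrite !tderE dx dy /cls ex ey.
- by move=> x y z; rewrite !tderE addrA.
- by move=> x y; rewrite !tderE addrC.
- by move=> x; rewrite !tderE add0r.
- by move=> x; rewrite !tderE scaleN1r addNr.
- by move=> a b x; rewrite !tderE scalerA.
- by move=> x; rewrite !tderE scale1r.
- by move=> a x y; rewrite !tderE scalerDr.
- by move=> a b x; rewrite !tderE scalerDl.
- by move=> x y z; rewrite !tderE sgD !bracketDl addrACA.
- by move=> x y z; rewrite !tderE !bracketDr addrACA.
- by move=> a x y; rewrite !tderE sgZ !bracketZl scalerDr.
- by move=> a x y; rewrite !tderE !bracketZr scalerDr.
- move=> p q x y hx hy.
  have [hX hY] := (cls_homog hx, cls_homog hy).
  rewrite !tderE !(sg_homog hX, sg_homog hY) !bracketZl.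
  rewrite (bracket_anti (tder_homog hx) hY) (bracket_anti hX (tder_homog hy)).
  rewrite mulrBl mulrBr mul1r mulr1 !sgnB scalerDr !scalerA addrC.
  congr (_ *: _ + _ *: _); last by rewrite mulNr.
  by rewrite mulrN mulrCA sgnK mulr1.
- move=> p q r x y z hx hy hz.
  have [hX hY hZ] := And3 (cls_homog hx) (cls_homog hy) (cls_homog hz).
  have hXY := bracket_homog hX hY.
  rewrite !tderE !(sg_homog hX, sg_homog hY, sg_homog hXY).
  rewrite !(bracketDl, bracketDr, bracketZl, bracketZr).
  rewrite (bracket_jacobi (tder_homog hx) hY hZ).
  rewrite (bracket_jacobi hX (tder_homog hy) hZ).
  rewrite (bracket_jacobi hX hY (tder_homog hz)).
  rewrite mulrBl mulrBr mul1r mulr1 !sgnB sgnD !scalerDr !scalerA.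
  set A := bracket (bracket (tder x) _) _.
  set B := bracket (cls y) (bracket (tder x) _).
  set C := bracket (bracket _ (tder y)) _.
  set D := bracket (tder y) (bracket _ _).
  set E := bracket (bracket _ _) (tder z).
  set F := bracket (cls y) (bracket _ (tder z)).
  have -> : (-1) ^ p * ((-1) ^ (p * q) * (-1) ^ p) = (-1) ^ (p * q) :> rat.
    by rewrite mulrCA sgnK mulr1.
  have -> : (-1) ^ p * (-1) ^ q * (-1) ^ (p * q)
            = (-1) ^ (p * q) * ((-1) ^ q * (-1) ^ p) :> rat.
    by rewrite mulrC [in RHS](mulrC ((-1) ^ q)).
  by rewrite [LHS](AC (2*(2*2)) (1*3*5*(4*(2*6)))).
Qed.

Lemma free_derE t : free_der (cls t) = tder t.
Proof. by apply/tder_teq/fclassP; rewrite /fclass reprK. Qed.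

Lemma free_der_gen g : free_der (free_gen g) = w g.
Proof. by rewrite -[free_gen g]/(cls (TGen g)) free_derE. Qed.

Lemma free_der_derivation : derivation (-1) free_der.
Proof.
split.
- move=> a; elim/fclassW=> x; elim/fclassW=> y.
  by rewrite -!/(cls _) -clsZ -clsD !free_derE.
- by move=> n x [t [ht ->]]; rewrite free_derE; exact: tder_homog.
- move=> p x y hx; rewrite mulN1r -exprz_inv invrN1.
  rewrite -bracketZl -(sg_homog hx).
  elim/fclassW: x {hx} => x; elim/fclassW: y => y.
  by rewrite -!/(cls _) -clsB !free_derE.
Qed.

Definition free_dLie : dLie := DLie free_der_derivation.

End FreeDerivation.
End FreeLie.

Record homotopy_retract (L : DGL) := HomotopyRetract {
  hr_i : homology L -> L;
  hr_q : L -> homology L;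
  hr_K : L -> L;
  hr_i_linear : linear hr_i;
  hr_q_linear : linear hr_q;
  hr_K_linear : linear hr_K;
  hr_i_degree : has_degree 0 hr_i;
  hr_q_degree : has_degree 0 hr_q;
  hr_K_degree : has_degree 1 hr_K;
  hr_i_chain : forall h, diff (hr_i h) = 0;
  hr_q_chain : forall x, hr_q (diff x) = 0;
  hr_i_id : forall h, represents (hr_i h) h;
  hr_qi : forall h, hr_q (hr_i h) = h;
  hr_homotopy : forall x, x - hr_i (hr_q x) = diff (hr_K x) + hr_K (diff x)
}.

Inductive btree : Type := Leaf | Node of btree & btree.
HB.instance Definition _ := gen_eqMixin btree.
HB.instance Definition _ := gen_choiceMixin btree.

Fixpoint leaves (t : btree) : nat :=
  if t is Node a b then (leaves a + leaves b)%N else 1%N.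

Fixpoint nodes (t : btree) : nat :=
  if t is Node a b then (nodes a + nodes b).+1 else 0%N.

Inductive tree_iso : btree -> btree -> Prop :=
| iso_leaf : tree_iso Leaf Leaf
| iso_node a a' b b' :
    tree_iso a a' -> tree_iso b b' -> tree_iso (Node a b) (Node a' b')
| iso_swap a a' b b' :
    tree_iso a a' -> tree_iso b b' -> tree_iso (Node a b) (Node b' a').

(** [r] consists of one planar drawing of each isomorphism class of trees
   with [k] leaves. *)
Definition planar_reps (k : nat) (r : seq btree) : Prop :=
  [/\ uniq r, forall t, t \in r -> leaves t = k &
      forall t, leaves t = k -> exists! t', t' \in r /\ tree_iso t t'].

(** A vertex of a tree is the list of turns (left = [false]) leading to it
   from the root [[::]]. *)
Fixpoint vertices (t : btree) : seq (seq bool) :=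
  if t is Node a b then
    [::] :: map (cons false) (vertices a) ++ map (cons true) (vertices b)
  else [:: [::]].

Definition child (v w : seq bool) : bool := [exists b, w == rcons v b].

Definition tree_aut (t : btree) : {set {perm seq_sub (vertices t)}} :=
  [set s : {perm seq_sub (vertices t)} |
    [forall v, (val v == [::]) ==> (val (s v) == [::])] &&
    [forall v, forall w,
      child (val (s v)) (val (s w)) == child (val v) (val w)]].

(** The Koszul sign of v_1 .. v_n |-> v_(s 1) .. v_(s n), [d j] being the
   degree of v_j. *)
Definition koszul (n : nat) (d : 'I_n -> int) (s : 'S_n) : rat :=
  \prod_(i < n) \prod_(j < n | (i < j)%N && (s j < s i)%N)
    (-1) ^ (d (s i) * d (s j)).

Section Transfer.
Variables (L : DGL) (R : homotopy_retract L).

(** [tree_op t] is the map labelled by [t], applied to a list of pairs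
   (degree, element), one per leaf.  A branch [b] of [t] contributes
   [branch b] to the tensor product of maps at the vertex below it: the
   label [hr_i] of the leaf if [b] is a leaf, and otherwise [tree_op b]
   followed by the label [hr_K] of the edge below it.  There are [nodes b]
   labels [hr_K] in [branch b], whence its degree. *)
Fixpoint tree_op (t : btree) (v : seq (int * homology L)) : L :=
  match t with
  | Leaf => hr_i R (head (0, 0) v).2
  | Node a b =>
      let branch c u :=
        if c is Leaf then tree_op c u else hr_K R (tree_op c u) in
      let p := leaves a in
      let va := take p v in
      let vb := drop p v in
      ((-1) ^+ p.-1 * (-1) ^ ((nodes b)%:Z * \sum_(x <- va) x.1))
        *: bracket (branch a va) (branch b vb)
  end.

(** The value of l_k on homogeneous elements [v j] of degrees [d j], computed
   with the planar drawings listed in [T k] (see [planar_reps]).  The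
   structure is minimal: l_1 = 0. *)
Definition transferred (T : nat -> seq btree) (k : nat)
    (d : 'I_k -> int) (v : 'I_k -> homology L) : homology L :=
  if (k <= 1)%N then 0 else
  \sum_(t <- T k) (#|tree_aut t|%:R)^-1 *:
    hr_q R (\sum_(s : 'S_k) ((-1) ^+ s * koszul d s) *:
              tree_op t [seq (d (s j), v (s j)) | j <- enum 'I_k]).

End Transfer.

Definition is_shuffle (n p : nat) (s : 'S_n) : bool :=
  [forall i : 'I_n, forall j : 'I_n,
     ((i < j)%N && ((j < p)%N || (p <= i)%N)) ==> (s i < s j)%N].

Definition fixes_first (n : nat) (s : 'S_n) : bool :=
  [forall i : 'I_n, (i == 0%N :> nat) ==> (s i == 0%N :> nat)].

Section Whitehead.
Variables (k : nat) (n : 'I_k -> int).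

(** The generators u_(i_1 .. i_s), 1 <= s < k, are indexed by the sets
   {i_1 < .. < i_s}; then i_j is [enum_val j]. *)
Definition u_index := {I : {set 'I_k} | (0 < #|I| < k)%N}.
Definition u_degree (I : {set 'I_k}) : int := \sum_(i in I) n i - 1.
Definition LU_Lie : gradedLie := freeLie (fun I : u_index => u_degree (val I)).

(** Only meaningful if [0 < #|I| < k]. *)
Definition u (I : {set 'I_k}) : LU_Lie :=
  if insub I is Some g then free_gen _ (g : u_index) else 0.

Definition left_set (I : {set 'I_k}) (p : nat) (s : 'S_#|I|) : {set 'I_k} :=
  [set enum_val (s j) | j : 'I_#|I| & (j < p)%N].
Definition right_set (I : {set 'I_k}) (p : nat) (s : 'S_#|I|) : {set 'I_k} :=
  [set enum_val (s j) | j : 'I_#|I| & (p <= j)%N].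

Definition u_boundary (I : {set 'I_k}) : LU_Lie :=
  \sum_(1 <= p < #|I|)
    \sum_(s : 'S_#|I| | is_shuffle p s && fixes_first s)
      ((-1) ^ u_degree (left_set p s) * koszul (fun j => n (enum_val j)) s)
        *: bracket (u (left_set p s)) (u (right_set p s)).

Lemma u_homog I : homog (u_degree I) (u I).
Proof.
rewrite /u; case: insubP => [g _ <-|_]; last exact: homog0.
exact: (free_gen_homog (fun I : u_index => u_degree (val I)) g).
Qed.

Lemma u_boundary_homog I : homog (u_degree I - 1) (u_boundary I).
Proof.
apply: homog_sum => p _; apply: homog_sum => s _; apply: homogZ.
have -> : u_degree I - 1 = u_degree (left_set p s) + u_degree (right_set p s).
  have inj : injective (fun j => enum_val (s j)).
    by move=> i j /enum_val_inj /perm_inj.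
  rewrite /u_degree !big_imset /=; try by move=> i j _ _; exact: inj.
  rewrite addrACA -opprD [RHS]addrC -addrA -opprD [RHS]addrC; congr (_ - _).
  rewrite [in LHS]big_enum_val [LHS](reindex_inj (@perm_inj _ s)) /=.
  rewrite (bigID (fun j : 'I_#|I| => (j < p)%N)) /=; congr (_ + _).
  - by apply: eq_bigl => j; rewrite inE.
  - by apply: eq_bigl => j; rewrite inE -leqNgt.
exact: bracket_homog (u_homog _) (u_homog _).
Qed.

(** This derivation squares to zero, so that [omega] is a cycle; neither fact
   is needed to define the bracket set, where [represents] includes that
   [phi omega] is a cycle. *)
Definition LU : dLie :=
  free_dLie (w := fun I : u_index => u_boundary (val I))
            (fun I => u_boundary_homog (val I)).

Definition omega : LU := u_boundary [set: 'I_k]%SET.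

End Whitehead.

(** [d j] is the degree of [x j]; it matters only if [x j = 0], which is
   homogeneous of every degree. *)
Definition whitehead (L : DGL) (k : nat) (d : 'I_k -> int)
    (x : 'I_k -> homology L) : set (homology L) :=
  [set h : homology L | exists phi : LU (fun j => d j + 1) -> L,
    [/\ dLie_morphism phi,
        forall j, represents (phi (u _ [set j]%SET)) (x j) &
        represents (phi (omega _)) h]]%classic.

Section PlanarReps.

Lemma tree_iso_refl t : tree_iso t t.
Proof. by elim: t => [|a ha b hb]; constructor. Qed.

Lemma tree_iso_sym t t' : tree_iso t t' -> tree_iso t' t.
Proof. by elim=> {t t'} *; constructor. Qed.

Lemma tree_iso_trans t t' t'' : tree_iso t t' -> tree_iso t' t'' -> tree_iso t t''.
Proof.
move=> h; elim: h t'' => {t t'} [t''|a a' b b' _ ha _ hb t''|a a' b b' _ ha _ hb t''] //.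
- by move=> h; inversion h; subst; constructor; [exact: ha|exact: hb|exact: ha|exact: hb].
- by move=> h; inversion h; subst; constructor; [exact: ha|exact: hb|exact: ha|exact: hb].
Qed.

Lemma tree_iso_leaves t t' : tree_iso t t' -> leaves t = leaves t'.
Proof. by elim=> {t t'} //= a a' b b' _ -> _ ->; rewrite // addnC. Qed.

Lemma leaves_gt0 t : (0 < leaves t)%N.
Proof. by elim: t => //= a ha b _; rewrite addn_gt0 ha. Qed.

Lemma planar_trees_finite k : exists r : seq btree, forall t, leaves t = k -> t \in r.
Proof.
suff [r hr] : exists r : seq btree, forall t, (leaves t <= k)%N -> t \in r.
  by exists r => t tk; apply: hr; rewrite tk.
elim: k => [|k [r hr]].
  by exists [::] => t; rewrite leqNgt leaves_gt0.
exists (Leaf :: [seq Node a b | a <- r, b <- r]) => -[|a b] /= h.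
  by rewrite inE eqxx.
rewrite inE; apply/orP; right; apply/allpairsP; exists (a, b).
have [ga gb] := (leaves_gt0 a, leaves_gt0 b).
split=> //=; apply: hr; rewrite -ltnS; apply: leq_trans h.
- by rewrite -[X in (X < _)%N]addn0 ltn_add2l.
- by rewrite -[X in (X < _)%N]add0n ltn_add2r.
Qed.

Lemma planar_reps_exist k : exists r, planar_reps k r.
Proof.
pose rep t := choose (fun t' => `[< tree_iso t t' >]) t.
have repP t : tree_iso t (rep t).
  have h : `[< tree_iso t t >] by apply/asboolP; exact: tree_iso_refl.
  exact/asboolP/(@chooseP _ (fun t' => `[< tree_iso t t' >]) _ h).
have rep_eq t t' : tree_iso t t' -> rep t = rep t'.
  move=> h; rewrite /rep.
  have e : (fun x => `[< tree_iso t x >]) =1 (fun x => `[< tree_iso t' x >]).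
    move=> x; apply/asboolP/asboolP; last exact: tree_iso_trans.
    exact: tree_iso_trans (tree_iso_sym h).
  rewrite (eq_choose e); apply: choose_id; apply/asboolP.
  - exact: tree_iso_sym.
  - exact: tree_iso_refl.
have [r hr] := planar_trees_finite k.
exists (undup [seq rep t | t <- r & leaves t == k]); split.
- exact: undup_uniq.
- move=> t; rewrite mem_undup => /mapP[t' + ->].
  by rewrite mem_filter => /andP[/eqP <- _]; rewrite -(tree_iso_leaves (repP t')).
- move=> t tk; exists (rep t); split.
    split=> //; rewrite mem_undup; apply/mapP; exists t => //.
    by rewrite mem_filter tk eqxx hr.
  move=> t' [+ tt']; rewrite mem_undup => /mapP[t'' _ e].
  by rewrite (rep_eq _ _ tt') e; apply: rep_eq; exact: tree_iso_sym.
Qed.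

End PlanarReps.

(* Main.v *)
Require Import Defs.
From mathcomp Require Import all_boot all_order all_algebra all_fingroup.
From mathcomp Require Import boolp classical_sets fintype finset.
From mathcomp Require Import ring.

(** The proof replaces morphisms by families.  Let [n_j = d_j + 1], and let
   [Lambda] be the graded commutative algebra on square-zero generators [e_j]
   of degree [- n_j].  A family [y_S] of elements of [L] indexed by the subsets
   [S] of the [k] indices, with [y_S] of degree [n_S - 1], is the element
   [sum_S y_S e_S] of degree [-1] of the DGL [L (x) Lambda]; up to a sign,
   [conv] is the bracket of that DGL, and [quad y] is half of [conv y y].
   The values [phi (u_S)] of a morphism form a family, and the formula for the
   differential of [u_S] says that this family satisfies the Maurer-Cartan
   equation [diff (y S) = quad y S] for all [S] with fewer than
   [k] elements; conversely, such a family defines a morphism, and [omega] is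
   sent to [quad y] at the full set ([sum_shuffles_quad], [morphism_MC],
   [family_dLie_morphism]).

   For given classes [xi_S] in the homology, the equation [z = i xi + K (quad z)]
   is solved by induction on the size of [S].  Picard iteration writes its
   solution as a sum over planar binary trees [t], with weight
   [2 ^- nodes t], of the operation of [t] applied to [xi] ([picardS],
   [picard_unique]).  The value of a tree on [S] is a signed sum over the
   words of disjoint subsets with union [S] ([tree_family_words]); the sum over
   the orders of a word symmetrizes the tree operation ([tree_family_sym]), and
   an isomorphism class of trees with [j] leaves has [2 ^ (j - 1) / #|Aut|]
   planar drawings ([sum_planar_reps]).  Hence [q (quad z)] is a combination of
   the transferred brackets of the [xi_S].  In particular, if [xi] is [x]
   on singletons and zero elsewhere, its value at the full set is
   [l_k (x_1, .., x_k)] with exactly the sign of the theorem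
   ([tree_family_setT], [transferred_trees], [word_sign_singletons]).

   It remains to see that this particular [z] satisfies the Maurer-Cartan
   equation below the full set, i.e. that [q (quad z S) = 0] for [#|S| < k]
   ([picard_MC]).  If [#|S| <= k - 2] this is the vanishing of the lower
   brackets.  If [#|S| = k - 1] the nonemptiness of the bracket set is needed.
   It provides some Maurer-Cartan family [y]; gauge transformations, performed
   at one set at a time in the order of increasing size, change it into a
   solution of [y = i (q y) + K (quad y)] without changing the classes
   [q (y_j)] at singletons ([gauge_fix]).  For the new [y] the obstruction
   [q (quad y S) = q (diff (y S))] is zero.  But [y] is the Picard solution for
   the classes [q (y_S)], and the lower brackets vanish, so that its obstruction
   at [S] is the contribution of the trees with exactly [k - 1] leaves, which
   only sees the classes [x_j] at singletons ([q_quad_top],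
   [tree_family_top]).  So the obstruction of [z] is the same, namely zero
   ([q_quad_singletons]). *)

Set Implicit Arguments.
Unset Strict Implicit.
Unset Printing Implicit Defensive.

Import Order.TTheory GRing.Theory Num.Theory.
Local Open Scope ring_scope.

(** * Planar drawings and automorphisms of binary trees *)

(** The isomorphisms from [t] to [t'] as tables of values along [vertices t]:
   an isomorphism either keeps or exchanges the two branches at the root. *)
Fixpoint iso_tables (t t' : btree) : seq (seq (seq bool)) :=
  match t, t' with
  | Leaf, Leaf => [:: [:: [::]]]
  | Node a b, Node c d =>
      [seq [::] :: map (cons false) x ++ map (cons true) y
         | x <- iso_tables a c, y <- iso_tables b d]
      ++ [seq [::] :: map (cons true) x ++ map (cons false) y
         | x <- iso_tables a d, y <- iso_tables b c]
  | _, _ => [::]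
  end.

Definition vertex_iso (t t' : btree) (phi : seq bool -> seq bool) : Prop :=
  [/\ {in vertices t, forall v, phi v \in vertices t'},
      {in vertices t &, injective phi},
      forall w, w \in vertices t' -> exists2 v, v \in vertices t & phi v = w,
      phi [::] = [::] &
      {in vertices t &, forall v w, child (phi v) (phi w) = child v w}].

Lemma childP v w : reflect (exists b, w = rcons v b) (child v w).
Proof.
apply: (iffP existsP) => -[b]; first by move/eqP; exists b.
by move=> ->; exists b.
Qed.

Lemma child_cons e v w : child (e :: v) (e :: w) = child v w.
Proof.
apply/childP/childP => -[b]; rewrite ?rcons_cons; first by case; exists b.
by move=> ->; exists b.
Qed.

Lemma child_cons_neq e e' v w : e != e' -> child (e :: v) (e' :: w) = false.
Proof. by move=> ne; apply/childP => -[b] /= [h _]; rewrite h eqxx in ne. Qed.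

Lemma child_root e v : child [::] (e :: v) = (v == [::]).
Proof.
apply/childP/eqP => [[b] /= [_ ->] //|->]; by exists e.
Qed.

Lemma child_nil v : child v [::] = false.
Proof. by apply/childP => -[b]; case: v. Qed.

Lemma root_vertex t : [::] \in vertices t.
Proof. by case: t => *; rewrite /= !inE eqxx. Qed.

Lemma mem_map_cons e e' (v : seq bool) (s : seq (seq bool)) :
  (e' :: v \in map (cons e) s) = (e' == e) && (v \in s).
Proof.
apply/mapP/andP => [[x xs [-> ->]]|[/eqP -> vs]]; first by rewrite eqxx.
by exists v.
Qed.

Lemma vertices_node a b e v :
  (e :: v \in vertices (Node a b)) = (v \in vertices (if e then b else a)).
Proof.
rewrite [vertices _]/= in_cons mem_cat !mem_map_cons.
by case: e; rewrite /= ?orbF.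
Qed.

Lemma vertices_rcons t v b : rcons v b \in vertices t -> v \in vertices t.
Proof.
elim: t v => [|a ha c hc] [|e v] //; rewrite ?root_vertex //.
by rewrite rcons_cons !vertices_node; case: e => [/hc|/ha].
Qed.

Definition join_iso e (f g : seq bool -> seq bool) (v : seq bool) : seq bool :=
  match v with
  | [::] => [::]
  | false :: w => e :: f w
  | true :: w => ~~ e :: g w
  end.

Lemma vertex_iso_join e a b c d f g :
  vertex_iso a (if e then d else c) f -> vertex_iso b (if e then c else d) g ->
  vertex_iso (Node a b) (Node c d) (join_iso e f g).
Proof.
move=> [fm fi fs f0 fc] [gm gi gs g0 gc]; split=> //.
- move=> [|[] v] vV; first exact: root_vertex.
  + by move: vV; rewrite vertices_node => /gm; rewrite vertices_node; case: (e).
  + by move: vV; rewrite vertices_node => /fm; rewrite vertices_node; case: (e).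
- move=> [|[] v] [|[] w] //; rewrite !vertices_node => hv hw [] //.
  + by move=> /gi ->.
  + by case: (e).
  + by case: (e).
  + by move=> /fi ->.
- move=> [|e' w]; first by exists [::] => //; exact: root_vertex.
  rewrite vertices_node; case: (eqVneq e' e) => [->|ne] hw.
  + have [v hv <-] := fs w hw.
    by exists (false :: v); rewrite ?vertices_node.
  + have -> : e' = ~~ e by move: ne; case: (e'); case: (e).
    have [|v hv <-] := gs w; first by move: hw ne; case: (e'); case: (e).
    by exists (true :: v); rewrite ?vertices_node.
- have nil_r (t t' : btree) h : vertex_iso t t' h ->
      {in vertices t, forall v, (h v == [::]) = (v == [::])}.
    move=> [_ hi _ h0 _] v hv; apply/eqP/eqP => [hv0|-> //].
    by apply: hi => //; rewrite ?root_vertex ?hv0.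
  have Hf : vertex_iso a (if e then d else c) f by split.
  have Hg : vertex_iso b (if e then c else d) g by split.
  move=> [|e1 v] [|e2 w] hv hw; rewrite ?child_nil //.
  + move: hw; rewrite vertices_node child_root; case: e2 => hw; rewrite child_root.
      exact: nil_r Hg _ hw.
    exact: nil_r Hf _ hw.
  + move: hv hw; rewrite !vertices_node; case: e1; case: e2 => hv hw.
    * by rewrite !child_cons gc.
    * by rewrite !child_cons_neq //; case: (e).
    * by rewrite !child_cons_neq //; case: (e).
    * by rewrite !child_cons fc.
Qed.

(** The image of the left child of the root decides whether the branches are
   exchanged; a vertex below it goes below its image because the child
   relation is preserved. *)
Lemma vertex_iso_split a b c d phi : vertex_iso (Node a b) (Node c d) phi ->
  exists e f g, [/\ vertex_iso a (if e then d else c) f,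
    vertex_iso b (if e then c else d) g &
    {in vertices (Node a b), phi =1 join_iso e f g}].
Proof.
move=> [pm pi ps p0 pc].
have top b0 : exists e, phi [:: b0] = [:: e].
  have hb : [:: b0] \in vertices (Node a b) by rewrite vertices_node root_vertex.
  have := pc [::] [:: b0] (root_vertex _) hb.
  by rewrite p0 child_root => /childP[e ->]; exists e.
have [e pe] := top false; have [e' pe'] := top true.
have {e' pe'} pe' : phi [:: true] = [:: ~~ e].
  rewrite pe'; congr [:: _]; case: (eqVneq e' e) => [ee|]; last by case: (e'); case: (e).
  have : [:: true] = [:: false].
    by apply: pi; rewrite ?vertices_node ?root_vertex // pe pe' ee.
  by [].
pose E b0 := if b0 then ~~ e else e.
have below b0 v : b0 :: v \in vertices (Node a b) ->
    phi (b0 :: v) = E b0 :: behead (phi (b0 :: v)).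
  elim/last_ind: v => [|v x IH]; first by case: b0; rewrite ?pe ?pe'.
  rewrite -rcons_cons => hv; have hv' := vertices_rcons hv.
  have := pc _ _ hv' hv; have -> : child (b0 :: v) (rcons (b0 :: v) x).
    by apply/childP; exists x.
  by case/childP => y ->; rewrite (IH hv').
have sub b0 : vertex_iso (if b0 then b else a) (if E b0 then d else c)
    (fun v => behead (phi (b0 :: v))).
  split.
  - move=> v hv; have hv' : b0 :: v \in vertices (Node a b) by rewrite vertices_node.
    by have := pm _ hv'; rewrite (below _ _ hv') vertices_node.
  - move=> v w hv hw h.
    have hv' : b0 :: v \in vertices (Node a b) by rewrite vertices_node.
    have hw' : b0 :: w \in vertices (Node a b) by rewrite vertices_node.
    suff: b0 :: v = b0 :: w by case.
    by apply: pi => //; rewrite (below _ _ hv') (below _ _ hw') h.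
  - move=> w hw; have [|v hv pv] := ps (E b0 :: w); first by rewrite vertices_node.
    case: v hv pv => [|b1 v] hv; first by rewrite p0.
    rewrite (below _ _ hv) => -[eE <-].
    have eb : b1 = b0 by move: eE; rewrite /E; case: (b1); case: (b0); case: (e).
    by exists v; rewrite -eb // -(vertices_node a b).
  - by case: (b0); rewrite ?pe ?pe'.
  - move=> v w hv hw.
    have hv' : b0 :: v \in vertices (Node a b) by rewrite vertices_node.
    have hw' : b0 :: w \in vertices (Node a b) by rewrite vertices_node.
    have := pc _ _ hv' hw'.
    by rewrite (below _ _ hv') (below _ _ hw') !child_cons.
exists e, (fun v => behead (phi (false :: v))), (fun v => behead (phi (true :: v))).
split; first exact: (sub false).
  by have := sub true; rewrite /E; case: (e).
by move=> [|[] v] hv; rewrite ?p0 // [LHS]below.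
Qed.

Lemma iso_tablesP t t' x :
  reflect (exists2 phi, vertex_iso t t' phi & x = map phi (vertices t))
          (x \in iso_tables t t').
Proof.
have map_node a b e f g : map (join_iso e f g) (vertices (Node a b)) =
    [::] :: map (cons e) (map f (vertices a))
         ++ map (cons (~~ e)) (map g (vertices b)).
  by rewrite /= map_cat -!map_comp.
apply: (iffP idP).
- elim: t t' x => [|a ha b hb] [|c d] x //=.
    rewrite inE => /eqP ->; exists id => //; split=> //.
    by move=> w hw; exists w.
  rewrite mem_cat => /orP[] /allpairsP[[y z] /= [hy hz ->]].
  + have [f hf ->] := ha _ _ hy; have [g hg ->] := hb _ _ hz.
    exists (join_iso false f g); first exact: vertex_iso_join.
    exact: esym (map_node _ _ false _ _).
  + have [f hf ->] := ha _ _ hy; have [g hg ->] := hb _ _ hz.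
    exists (join_iso true f g); first exact: vertex_iso_join.
    exact: esym (map_node _ _ true _ _).
- elim: t t' x => [|a ha b hb] [|c d] x [phi hphi ->].
  + by case: hphi => _ _ _ p0 _; rewrite /= p0 inE.
  + case: hphi => _ _ ps p0 _.
    have /ps[v] : [:: false] \in vertices (Node c d).
      by rewrite vertices_node root_vertex.
    by rewrite inE => /eqP ->; rewrite p0.
  + case: hphi => pm pi _ p0 _.
    have h : [:: false] \in vertices (Node a b).
      by rewrite vertices_node root_vertex.
    have := pm _ h; rewrite inE => /eqP e.
    by have := pi _ _ h (root_vertex _) (etrans e (esym p0)).
  + have [e [f [g [hf hg]]]] := vertex_iso_split hphi.
    move/eq_in_map=> ->; rewrite map_node [iso_tables _ _]/= mem_cat.
    case: e hf hg => hf hg.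
    * by apply/orP; right; apply: allpairs_f; [apply: ha; exists f|apply: hb; exists g].
    * by apply/orP; left; apply: allpairs_f; [apply: ha; exists f|apply: hb; exists g].
Qed.

Lemma iso_tables_uniq t t' : uniq (iso_tables t t').
Proof.
have size_table a c x : x \in iso_tables a c -> size x = size (vertices a).
  by case/iso_tablesP => phi _ ->; rewrite size_map.
have hd a c x : x \in iso_tables a c -> exists y, x = [::] :: y.
  case/iso_tablesP => phi [_ _ _ p0 _] ->.
  by case: a => [|a b] /=; rewrite p0; eexists.
have inj_cons (e : bool) : injective (cons e) by move=> ? ? [].
have pairs_uniq a b c d (e : bool) : uniq (iso_tables a c) ->
    uniq (iso_tables b d) ->
    uniq [seq [::] :: map (cons e) x ++ map (cons (~~ e)) y
         | x <- iso_tables a c, y <- iso_tables b d].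
  move=> ua ub; apply: allpairs_uniq => // -[x y] [x' y'].
  case/allpairsP => -[p q] /= [hp hq [-> ->]].
  case/allpairsP => -[p' q'] /= [hp' hq' [-> ->]] [] /eqP.
  rewrite eqseq_cat ?size_map ?(size_table _ _ _ hp) ?(size_table _ _ _ hp') //.
  by case/andP => /eqP /(inj_map (inj_cons e)) -> /eqP /(inj_map (inj_cons _)) ->.
elim: t t' => [|a ha b hb] [|c d] //.
rewrite [iso_tables _ _]/= cat_uniq (pairs_uniq _ _ _ _ false) //.
rewrite (pairs_uniq _ _ _ _ true) // andbT.
apply/hasPn => z /allpairsP[[x y] /= [hx hy ->]].
apply/allpairsP => -[[x' y'] /= [hx' hy']].
by have [? ->] := hd _ _ _ hx; have [? ->] := hd _ _ _ hx'.
Qed.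

Definition niso (t t' : btree) : nat := size (iso_tables t t').

(** A permutation of the vertices is determined by its table of values, and
   the tables of automorphisms are those enumerated by [iso_tables]. *)
Lemma card_tree_aut t : #|tree_aut t| = niso t t.
Proof.
pose V := seq_sub (vertices t).
have sub_val v (hv : v \in vertices t) : val (SeqSub hv : V) = v by [].
pose table (s : {perm V}) := [seq (if insub v is Some w then val (s w) else [::])
                              | v <- vertices t].
have tableE (s : {perm V}) (w : V) :
    (if insub (val w) is Some w then val (s w) else [::]) = val (s w).
  by rewrite valK.
rewrite cardE -(size_map table); apply/perm_size/uniq_perm.
- rewrite map_inj_in_uniq ?enum_uniq // => s s' _ _ /eq_in_map h.
  apply/permP => w; apply: val_inj.
  by have := h _ (valP w); rewrite /= !tableE.
- exact: iso_tables_uniq.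
move=> x; apply/mapP/iso_tablesP.
- case=> s; rewrite mem_enum inE => /andP[/forallP h0 /forallP hc] ->.
  exists (fun v => if insub v is Some w then val (s w : V) else [::]) => //.
  have E v (hv : v \in vertices t) :
      (if insub v is Some w then val (s w : V) else [::]) = val (s (SeqSub hv : V)).
    by rewrite -(tableE s).
  split.
  + by move=> v hv; rewrite E; exact: valP.
  + by move=> v w hv hw; rewrite !E => /val_inj /perm_inj [].
  + move=> w hw; exists (val ((s^-1)%g (SeqSub hw : V))); first exact: valP.
    by rewrite tableE permKV.
  + by rewrite (E _ (root_vertex t)); apply/eqP; apply: (implyP (h0 _)).
  + move=> v w hv hw; rewrite !E.
    by have /forallP/(_ (SeqSub hw))/eqP -> := hc (SeqSub hv).
- case=> phi [pm pi ps p0 pc] ->.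
  pose f (w : V) : V := SeqSub (pm _ (valP w)).
  have fi : injective f.
    by move=> v w [] /pi h; apply: val_inj; apply: h; exact: valP.
  exists (perm fi).
    rewrite mem_enum inE; apply/andP; split.
      by apply/forallP => v; apply/implyP => /eqP v0; rewrite permE /= v0 p0.
    apply/forallP => v; apply/forallP => w; rewrite !permE /= pc //; exact: valP.
  by apply/eq_in_map => v hv; rewrite (tableE _ (SeqSub hv : V)) permE.
Qed.

Lemma niso_node a b c d :
  niso (Node a b) (Node c d) = (niso a c * niso b d + niso a d * niso b c)%N.
Proof. by rewrite /niso /= size_cat !size_allpairs. Qed.

Lemma niso_refl_gt0 t : (0 < niso t t)%N.
Proof.
by elim: t => // a ha b hb; rewrite niso_node addn_gt0 muln_gt0 ha hb.
Qed.

Lemma tree_iso_niso t t' t'' : tree_iso t' t'' -> niso t t' = niso t t''.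
Proof.
move=> h; elim: h t => {t' t''} // a a' b b' _ ha _ hb [|c d] //;
  rewrite !niso_node !ha !hb //.
by rewrite addnC.
Qed.

Lemma niso_gt0 t t' : (0 < niso t t')%N -> tree_iso t t'.
Proof.
elim: t t' => [|a ha b hb] [|c d] //; first by move=> _; constructor.
rewrite niso_node addn_gt0 !muln_gt0 => /orP[] /andP[h1 h2].
- by constructor; [apply: ha|apply: hb].
- by apply: iso_swap; [apply: ha|apply: hb].
Qed.

(** The planar trees of height less than [m].  Bounding the height rather than
   the number of leaves makes the recursion that of the Picard iteration
   below. *)
Fixpoint trees (m : nat) : seq btree :=
  if m is m'.+1 then Leaf :: [seq Node a b | a <- trees m', b <- trees m']
  else [::].

Lemma mem_trees m t : (leaves t <= m)%N -> t \in trees m.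
Proof.
elim: m t => [|m IH] [|a b] //.
- by rewrite leqNgt leaves_gt0.
- by rewrite inE eqxx.
move=> /= h; rewrite inE; apply/orP; right; apply/allpairsP; exists (a, b).
split=> //=; apply: IH.
- rewrite -ltnS; apply: leq_trans h.
  by rewrite -[X in (X < _)%N]addn0 ltn_add2l leaves_gt0.
- rewrite -ltnS; apply: leq_trans h.
  by rewrite -[X in (X < _)%N]add0n ltn_add2r leaves_gt0.
Qed.

(** An isomorphism out of [t] amounts to the choice, at each of the internal
   vertices of [t], of whether to exchange the two branches. *)
Lemma sum_niso m t : t \in trees m -> (\sum_(t' <- trees m) niso t t' = 2 ^ nodes t)%N.
Proof.
elim: m t => // m IH [|a b] /=.
  move=> _; rewrite big_cons big1_seq // => t' /andP[_ h].
  by have [[c d] [_ _ ->]] := elimT allpairsP h.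
rewrite inE => /orP[/eqP //|h]; have {h} [[c d] /= [hc hd [-> ->]]] := elimT allpairsP h.
rewrite big_cons add0n big_allpairs_dep /=.
have E : (\sum_(i <- trees m) \sum_(j <- trees m) niso c i * niso d j
    = 2 ^ (nodes c + nodes d))%N.
  under eq_bigr => i _ do rewrite -big_distrr /= IH //.
  by rewrite -big_distrl /= IH // expnD.
under eq_bigr => i _ do under eq_bigr => j _ do rewrite niso_node.
under eq_bigr => i _ do rewrite big_split.
by rewrite big_split /= E exchange_big /= E addnn expnS mul2n.
Qed.

Lemma nodes_leaves t : leaves t = (nodes t).+1.
Proof. by elim: t => //= a -> b ->; rewrite addSn addnS. Qed.

(** Summing over one drawing per isomorphism class with weight [1 / #|Aut|] is,
   up to the factor [2 ^- (j - 1)], summing over all drawings: for [t'] isomorphic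
   to [t] the number [niso t t'] is [#|Aut t|], and these numbers add up to
   [2 ^ (j - 1)]. *)
Lemma sum_planar_reps (V : lmodType rat) (r : seq btree) j m (f : btree -> V) :
  planar_reps j r -> (j <= m)%N ->
  (forall t t', tree_iso t t' -> f t = f t') ->
  \sum_(t <- r) (#|tree_aut t|%:R)^-1 *: f t
  = (2 ^- j.-1) *: \sum_(t <- trees m | leaves t == j) f t.
Proof.
move=> [ur hr rex] jm finv.
have one t' : leaves t' = j ->
    f t' = \sum_(t <- r) ((niso t t')%:R / (niso t t)%:R) *: f t.
  move=> lt'; have [t [[tr tt'] tu]] := rex _ lt'.
  rewrite (bigD1_seq t) //= big1_seq ?addr0 => [|t0 /andP[t0t t0r]].
    rewrite -(tree_iso_niso t (tree_iso_sym tt')) divff ?scale1r.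
      exact: finv.
    by rewrite pnatr_eq0 -lt0n niso_refl_gt0.
  case: (posnP (niso t0 t')) => [->|/niso_gt0 h]; first by rewrite mul0r scale0r.
  by rewrite (tu t0) ?eqxx // in t0t; split => //; exact: tree_iso_sym.
rewrite scaler_sumr.
transitivity (\sum_(t' <- trees m | leaves t' == j) 2 ^- j.-1 *:
    \sum_(t <- r) ((niso t t')%:R / (niso t t)%:R) *: f t); last first.
  by apply: eq_bigr => t' /eqP /one <-.
rewrite -scaler_sumr exchange_big /= scaler_sumr big_seq [RHS]big_seq.
apply: eq_bigr => t tr; have lt := hr t tr.
rewrite -scaler_suml -mulr_suml scalerA card_tree_aut mulrA; congr (_ *: _).
have -> : \sum_(t' <- trees m | leaves t' == j) (niso t t')%:R = 2 ^+ j.-1 :> rat.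
  rewrite -natrX -lt nodes_leaves /= -(@sum_niso m) ?natr_sum; last first.
    by apply: mem_trees; rewrite lt.
  rewrite big_mkcond /=; apply: eq_bigr => t' _; case: eqP => // ne.
  case: (posnP (niso t t')) => [->//|/niso_gt0 /tree_iso_leaves h].
  by case: ne; rewrite -h nodes_leaves.
by rewrite mulVf ?mul1r // expf_neq0.
Qed.

(** * Signs and inversions *)

(** Sign identities are decided by running through the parities of the
   degrees. *)
Definition oddz (z : int) : bool := odd `|z|%N.

Lemma oddzD a b : oddz (a + b) = oddz a (+) oddz b.
Proof.
have oddN m n : oddz (m%:Z - n%:Z) = odd m (+) odd n.
  rewrite /oddz; case: (leqP n m) => h.
    by rewrite subzn // absz_nat oddB.
  by rewrite -opprB abszN subzn 1?ltnW // absz_nat oddB 1?ltnW // addbC.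
case: a b => a [] b; rewrite ?NegzE.
- by rewrite -PoszD /oddz !absz_nat oddD.
- by rewrite oddN /oddz abszN.
- by rewrite addrC oddN /oddz abszN addbC.
- by rewrite -opprD -PoszD /oddz !abszN !absz_nat oddD.
Qed.

Lemma oddzM a b : oddz (a * b) = oddz a && oddz b.
Proof. by rewrite /oddz abszM oddM. Qed.

Lemma oddzN a : oddz (- a) = oddz a.
Proof. by rewrite /oddz abszN. Qed.

Lemma oddz1 : oddz 1 = true. Proof. by []. Qed.
Lemma oddz0 : oddz 0 = false. Proof. by []. Qed.

Lemma sgnE (z : int) : (-1 : rat) ^ z = if oddz z then -1 else 1.
Proof.
rewrite /oddz; case: z => n.
  by rewrite -exprnP -signr_odd absz_nat; case: (odd n).
rewrite NegzE -exprz_inv invrN1 -exprnP -signr_odd abszN absz_nat.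
by case: (odd n.+1).
Qed.

Definition parity := (oddzD, oddzM, oddzN, oddz1, oddz0).

Ltac sign_cases := rewrite ?sgnE ?parity;
  repeat match goal with |- context[oddz ?z] => case: (oddz z) end;
  rewrite /=; try ring.

Lemma sgnD (p q : int) : (-1 : rat) ^ (p + q) = (-1) ^ p * (-1) ^ q.
Proof. by rewrite expfzDr. Qed.

Lemma sgnK (p : int) : (-1 : rat) ^ p * (-1) ^ p = 1.
Proof. sign_cases. Qed.

Lemma sgn_sum I (r : seq I) (P : pred I) (F : I -> int) :
  (-1 : rat) ^ (\sum_(i <- r | P i) F i) = \prod_(i <- r | P i) (-1) ^ F i.
Proof. exact: (big_morph (fun z => (-1 : rat) ^ z) sgnD (expr0z _)). Qed.

Section Inversions.
Variable m : nat.

(** Reordering a product over the pairs [i < j] by [s] costs one factor [c] for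
   each inversion of [s]. *)
Lemma prod_lt_perm (g : 'I_m -> 'I_m -> rat) (c : 'I_m -> 'I_m -> rat) (s : 'S_m) :
  (forall a b, g a b = c a b * g b a) ->
  \prod_(i < m) \prod_(j < m | (i < j)%N) g (s i) (s j) =
  (\prod_(i < m) \prod_(j < m | (i < j)%N && (s j < s i)%N) c (s i) (s j))
   * \prod_(i < m) \prod_(j < m | (i < j)%N) g i j.
Proof.
move=> gc.
(* [h] is the symmetric function with the values of [g] on increasing pairs:
   its product over pairs is invariant under relabelling. *)
pose h (a b : 'I_m) := if (a < b)%N then g a b else g b a.
transitivity (\prod_(i < m) \prod_(j < m | (i < j)%N)
    ((if (s j < s i)%N then c (s i) (s j) else 1) * h (s i) (s j))).
  apply: eq_bigr => i _; apply: eq_bigr => j ij; rewrite /h.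
  case: (ltngtP (s i) (s j)) => [lt|lt|/val_inj/perm_inj e].
  - by rewrite mul1r.
  - exact: gc.
  - by rewrite e ltnn in ij.
under eq_bigr => i _ do rewrite big_split /= -big_mkcondr /=.
rewrite big_split /=; congr (_ * _).
have hC a b : a != b -> h a b = h b a.
  by rewrite /h => ne; case: ltngtP => // /val_inj e; rewrite e eqxx in ne.
rewrite !pair_big_dep /=.
pose S (p : 'I_m * 'I_m) := if (p.1 < p.2)%N then p else (p.2, p.1).
pose f (u : 'S_m) (p : 'I_m * 'I_m) := S (u p.1, u p.2).
have fK (u : 'S_m) (p : 'I_m * 'I_m) : (p.1 < p.2)%N -> f u^-1%g (f u p) = p.
  case: p => a b /= ab; rewrite /f /S /=.
  by case: (ltnP (u a) (u b)) => _ /=; rewrite !permK ?ab //= ltnNge ltnW.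
have flt (u : 'S_m) (p : 'I_m * 'I_m) : (p.1 < p.2)%N -> ((f u p).1 < (f u p).2)%N.
  case: p => a b /= ab; rewrite /f /S /=.
  case: (ltngtP (u a) (u b)) => //= e.
  by rewrite (perm_inj (val_inj e)) ltnn in ab.
rewrite [RHS](reindex_onto (f s) (f s^-1%g)) /=; last first.
  by move=> p hp; have := fK s^-1%g p hp; rewrite invgK.
apply: eq_big => [p|[a b] /= ab].
  apply/idP/andP => [hp|[h1 /eqP <-]]; first by rewrite flt //= fK.
  exact: flt.
rewrite /f /S /=; case: (ltngtP (s a) (s b)) => [lt|lt|e] /=.
- by rewrite /h lt.
- by rewrite /h ltnNge ltnW.
- by rewrite (perm_inj (val_inj e)) ltnn in ab.
Qed.

(** Compare the two evaluations of a Vandermonde determinant with permuted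
   columns: by the signature, and by the product formula, where each inversion
   changes one sign. *)
Lemma perm_sign_inversions (s : 'S_m) :
  \prod_(i < m) \prod_(j < m | (i < j)%N && (s j < s i)%N) (-1) = (-1) ^+ s :> rat.
Proof.
pose a : 'rV[rat]_m := \row_j (j%:R).
pose b : 'rV[rat]_m := \row_j ((s j)%:R).
have d0 : \det (Vandermonde m a) != 0.
  rewrite det_Vandermonde; apply/prodf_neq0 => i _; apply/prodf_neq0 => j ij.
  by rewrite !mxE subr_eq0 eqr_nat gtn_eqF.
apply: (mulIf d0); rewrite -[X in X * _ = _]mul1r.
have <- : \det (Vandermonde m b) = (-1) ^+ s * \det (Vandermonde m a).
  have -> : Vandermonde m b = col_perm s (Vandermonde m a).
    by apply/matrixP => i j; rewrite !mxE.
  by rewrite col_permE det_mulmx det_perm odd_permV mulrC.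
rewrite !det_Vandermonde mul1r.
have /= := @prod_lt_perm (fun x y => y%:R - x%:R) (fun _ _ => -1) s.
have E (F : 'I_m -> rat) (c : 'rV[rat]_m) : (forall j, c 0 j = F j) ->
    \prod_(i < m) \prod_(j < m | (i < j)%N) (c 0 j - c 0 i)
    = \prod_(i < m) \prod_(j < m | (i < j)%N) (F j - F i).
  by move=> cF; apply: eq_bigr => i _; apply: eq_bigr => j _; rewrite !cF.
rewrite (E (fun j => j%:R) a) => [|j]; last by rewrite mxE.
rewrite (E (fun j => (s j)%:R) b) => [|j]; last by rewrite mxE.
by move=> <- // x y; rewrite mulN1r opprB.
Qed.

End Inversions.

(** * The signs of disjoint unions *)

Lemma big_disjointU (V : Type) (idx : V) (op : Monoid.com_law idx) (I : finType)
    (A B : {set I}) (F : I -> V) : [disjoint A & B] ->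
  \big[op/idx]_(i in A :|: B) F i
  = op (\big[op/idx]_(i in A) F i) (\big[op/idx]_(i in B) F i).
Proof.
move=> dAB; rewrite (big_setID A) setUK setDUl setDv set0U.
rewrite disjoint_sym in dAB.
by move/setDidPl: dAB => ->.
Qed.

Section ShuffleSigns.
Variables (k : nat) (n : 'I_k -> int).
Implicit Types A B C S : {set 'I_k}.

(** The Koszul sign of moving [A] before [B] in the ordered union of [A] and
   [B], extended by zero to pairs of sets that meet, for which the product of
   the monomials [e_A] and [e_B] in [Lambda] vanishes; sums over pairs of sets
   then need no disjointness condition. *)
Definition shuffle_sign A B : rat :=
  if [disjoint A & B]
  then \prod_(a in A) \prod_(b in B | (b < a)%N) (-1) ^ (n a * n b) else 0.

(** The coefficient of [[u_A, u_B]] in the differential of [u_(A :|: B)]. *)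
Definition bracket_sign A B : rat := (-1) ^ u_degree n A * shuffle_sign A B.

Lemma u_degreeU A B : [disjoint A & B] ->
  u_degree n (A :|: B) = u_degree n A + u_degree n B + 1.
Proof.
move=> dAB; rewrite /u_degree; rewrite big_disjointU //=; ring.
Qed.

Lemma shuffle_signC A B :
  shuffle_sign A B
  = (-1) ^ ((u_degree n A + 1) * (u_degree n B + 1)) * shuffle_sign B A.
Proof.
rewrite /shuffle_sign [[disjoint B & A]]disjoint_sym.
case: ifP => dAB; last by rewrite mulr0.
rewrite /u_degree !subrK mulr_suml sgn_sum.
under [X in _ = X * _]eq_bigr => a _ do rewrite mulr_sumr sgn_sum.
rewrite [X in _ = _ * X](exchange_big_dep (mem A)) /=; last by move=> b a _ /andP[].
rewrite -big_split /=; apply: eq_bigr => a aA.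
rewrite big_mkcondr [X in _ = _ * X]big_mkcondr /= -big_split /=.
apply: eq_bigr => b bB; rewrite aA /=.
case: (ltngtP b a) => [lt|lt|/val_inj e]; rewrite ?mulr1 //.
- by rewrite [n b * n a]mulrC sgnK.
- by move/disjoint_setI0: dAB => /setP/(_ a); rewrite !inE aA -e bB.
Qed.

Lemma shuffle_signUl A A' B : [disjoint A & A'] ->
  shuffle_sign (A :|: A') B = shuffle_sign A B * shuffle_sign A' B.
Proof.
move=> dA; rewrite /shuffle_sign.
have -> : [disjoint A :|: A' & B] = [disjoint A & B] && [disjoint A' & B].
  by rewrite -!setI_eq0 setIUl setU_eq0.
case: [disjoint A & B]; case: [disjoint A' & B]; rewrite ?mulr0 ?mul0r //=.
by rewrite big_disjointU.
Qed.

Lemma shuffle_signUr A B B' : [disjoint B & B'] ->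
  shuffle_sign A (B :|: B') = shuffle_sign A B * shuffle_sign A B'.
Proof.
move=> dB; rewrite !(shuffle_signC A) shuffle_signUl // u_degreeU //.
set x := shuffle_sign B A; set y := shuffle_sign B' A; sign_cases.
Qed.

Lemma shuffle_sign_disj A B : ~~ [disjoint A & B] -> shuffle_sign A B = 0.
Proof. by rewrite /shuffle_sign => /negbTE ->. Qed.

Lemma bracket_sign_disj A B : ~~ [disjoint A & B] -> bracket_sign A B = 0.
Proof. by move=> h; rewrite /bracket_sign shuffle_sign_disj // mulr0. Qed.

(** The sign of the swap is that of the bracket of elements of degrees
   [u_degree A] and [u_degree B]; this makes [conv] symmetric, and makes
   reordering a word of sets cost the same as permuting the arguments of
   [transferred]. *)
Lemma bracket_signC A B :
  bracket_sign A B = - (-1) ^ (u_degree n A * u_degree n B) * bracket_sign B A.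
Proof.
rewrite /bracket_sign shuffle_signC; set x := shuffle_sign B A; sign_cases.
Qed.

Definition shuffle_sign3 A B C :=
  shuffle_sign A B * (shuffle_sign A C * shuffle_sign B C).

Lemma shuffle_sign3l A B C :
  shuffle_sign A B * shuffle_sign (A :|: B) C = shuffle_sign3 A B C.
Proof.
rewrite /shuffle_sign3; case: (boolP [disjoint A & B]) => [d|/shuffle_sign_disj ->].
  by rewrite shuffle_signUl.
by rewrite !mul0r.
Qed.

Lemma shuffle_sign3r A B C :
  shuffle_sign B C * shuffle_sign A (B :|: C) = shuffle_sign3 A B C.
Proof.
rewrite /shuffle_sign3; case: (boolP [disjoint B & C]) => [d|/shuffle_sign_disj ->].
  by rewrite shuffle_signUr //; ring.
by rewrite mul0r !mulr0.
Qed.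

Lemma bracket_sign3 A B C :
  bracket_sign A B * bracket_sign (A :|: B) C
  = - (-1) ^ (u_degree n B) * shuffle_sign3 A B C.
Proof.
rewrite -shuffle_sign3l /bracket_sign.
case: (boolP [disjoint A & B]) => [d|/shuffle_sign_disj ->].
  rewrite u_degreeU //.
  set x := shuffle_sign A B; set y := shuffle_sign _ C; sign_cases.
by rewrite !(mul0r, mulr0).
Qed.

End ShuffleSigns.

(** * Families indexed by subsets, the Maurer-Cartan equation and gauge transformations *)

Section Convolution.
Variables (k : nat) (n : 'I_k -> int) (L : DGL).
Implicit Types (A B C S : {set 'I_k}) (f g h y : {set 'I_k} -> L).

Local Notation du := (u_degree n).

(** The bracket of [L (x) Lambda], up to a sign that makes the Maurer-Cartan
   equation read [diff (y S) = quad y S]. *)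
Definition conv f g S : L :=
  \sum_A \sum_(B | A :|: B == S) bracket_sign n A B *: bracket (f A) (g B).

Definition quad f S : L := 2^-1 *: conv f f S.

(** Degree of a family relative to the generators [u_S]: elements of
   [L (x) Lambda] of degree [-1] are the families of relative degree 0. *)
Definition graded (p : int) f : Prop := forall A, homog (du A + p) (f A).

Lemma eq_conv f f' g g' S : f =1 f' -> g =1 g' -> conv f g S = conv f' g' S.
Proof. by move=> ef eg; apply: eq_bigr => A _; apply: eq_bigr => B _; rewrite ef eg. Qed.

Lemma convDl f f' g S : conv (fun A => f A + f' A) g S = conv f g S + conv f' g S.
Proof.
rewrite /conv -big_split; apply: eq_bigr => A _; rewrite -big_split.
by apply: eq_bigr => B _; rewrite bracketDl scalerDr.
Qed.

Lemma convDr f g g' S : conv f (fun A => g A + g' A) S = conv f g S + conv f g' S.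
Proof.
rewrite /conv -big_split; apply: eq_bigr => A _; rewrite -big_split.
by apply: eq_bigr => B _; rewrite bracketDr scalerDr.
Qed.

Lemma convZl a f g S : conv (fun A => a *: f A) g S = a *: conv f g S.
Proof.
rewrite /conv scaler_sumr; apply: eq_bigr => A _; rewrite scaler_sumr.
by apply: eq_bigr => B _; rewrite bracketZl !scalerA mulrC.
Qed.

Lemma convZr a f g S : conv f (fun A => a *: g A) S = a *: conv f g S.
Proof.
rewrite /conv scaler_sumr; apply: eq_bigr => A _; rewrite scaler_sumr.
by apply: eq_bigr => B _; rewrite bracketZr !scalerA mulrC.
Qed.

Lemma conv0l g S : conv (fun=> 0) g S = 0.
Proof. by rewrite /conv big1 // => A _; rewrite big1 // => B _; rewrite bracket0l scaler0. Qed.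

Lemma conv0r g S : conv g (fun=> 0) S = 0.
Proof. by rewrite /conv big1 // => A _; rewrite big1 // => B _; rewrite bracket0r scaler0. Qed.

Lemma conv_suml I (r : seq I) (F : I -> {set 'I_k} -> L) g S :
  conv (fun A => \sum_(i <- r) F i A) g S = \sum_(i <- r) conv (F i) g S.
Proof.
elim: r => [|i r IH].
  by rewrite big_nil -[RHS](conv0l g S); apply: eq_conv => // A; rewrite big_nil.
rewrite big_cons -IH -convDl; apply: eq_conv => // A; by rewrite big_cons.
Qed.

Lemma conv_sumr I (r : seq I) (F : I -> {set 'I_k} -> L) g S :
  conv g (fun A => \sum_(i <- r) F i A) S = \sum_(i <- r) conv g (F i) S.
Proof.
elim: r => [|i r IH].
  by rewrite big_nil -[RHS](conv0r g S); apply: eq_conv => // A; rewrite big_nil.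
rewrite big_cons -IH -convDr; apply: eq_conv => // A; by rewrite big_cons.
Qed.

(** Because families vanish on the empty set, only proper subsets contribute;
   all the inductions on the size of [S] rest on this. *)
Lemma conv_local f f' g g' S :
  f set0 = 0 -> f' set0 = 0 -> g set0 = 0 -> g' set0 = 0 ->
  (forall A, A \proper S -> f A = f' A) -> (forall A, A \proper S -> g A = g' A) ->
  conv f g S = conv f' g' S.
Proof.
move=> f0 f'0 g0 g'0 ef eg; apply: eq_bigr => A _; apply: eq_bigr => B /eqP AB.
case: (boolP [disjoint A & B]) => [dAB|/bracket_sign_disj ->]; last by rewrite !scale0r.
have [A0|An0] := eqVneq A set0; first by rewrite A0 f0 f'0 !bracket0l.
have [B0|Bn0] := eqVneq B set0; first by rewrite B0 g0 g'0 !bracket0r.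
have pA : A \proper S.
  rewrite properE -AB subsetUl subUset subxx /=; apply: contraNN Bn0 => BA.
  by rewrite -(setIidPr BA) setI_eq0.
have pB : B \proper S.
  rewrite properE -AB subsetUr subUset subxx andbT; apply: contraNN An0 => BA.
  by rewrite -(setIidPl BA) setI_eq0.
by rewrite ef // eg.
Qed.

Lemma graded_conv p q f g : graded p f -> graded q g -> graded (p + q - 1) (conv f g).
Proof.
move=> hf hg S; apply: homog_sum => A _; apply: homog_sum => B /eqP <-.
case: (boolP [disjoint A & B]) => [dAB|/bracket_sign_disj ->]; last first.
  by rewrite scale0r; exact: homog0.
apply: homogZ; rewrite u_degreeU //.
have -> : du A + du B + 1 + (p + q - 1) = (du A + p) + (du B + q) by ring.
exact: bracket_homog (hf A) (hg B).
Qed.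

Lemma conv_sym f g S : graded 0 f -> graded 0 g -> conv f g S = conv g f S.
Proof.
move=> hf hg; rewrite /conv.
under eq_bigr => A _ do rewrite big_mkcond.
rewrite exchange_big /=; apply: eq_bigr => B _; rewrite [RHS]big_mkcond.
apply: eq_bigr => A _; rewrite setUC; case: ifP => // _.
rewrite (bracket_anti (hf A) (hg B)) scalerA !addr0 bracket_signC.
by congr (_ *: _); set x := bracket_sign n B A; sign_cases.
Qed.

(** The sign that appears when a map of odd degree passes over [f]. *)
Definition twist f A : L := (-1) ^ du A *: f A.

Lemma diff_conv p f g S : graded p f ->
  diff (conv f g S)
  = conv (fun A => diff (f A)) g S
    + (-1) ^ p *: conv (twist f) (fun A => diff (g A)) S.
Proof.
move=> hf; rewrite /conv diff_sum scaler_sumr -big_split; apply: eq_bigr => A _.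
rewrite diff_sum scaler_sumr -big_split; apply: eq_bigr => B _ /=.
have [_ _ /(_ _ _ (g B) (hf A)) e] := diff_der L.
rewrite diffZ e scalerDr /twist bracketZl !scalerA; congr (_ + _ *: _).
by set x := bracket_sign n A B; sign_cases.
Qed.

Lemma conv_twist f g S : graded 0 f -> graded (- 1) g ->
  conv (twist f) g S = conv g f S.
Proof.
move=> hf hg; rewrite /conv.
under eq_bigr => A _ do rewrite big_mkcond.
rewrite exchange_big /=; apply: eq_bigr => B _; rewrite [RHS]big_mkcond.
apply: eq_bigr => A _; rewrite setUC; case: ifP => // _.
rewrite /twist bracketZl (bracket_anti (hf A) (hg B)) !scalerA bracket_signC.
by congr (_ *: _); set x := bracket_sign n B A; sign_cases.
Qed.

Lemma diff_conv_self f S : graded 0 f ->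
  diff (conv f f S) = 2 *: conv (fun A => diff (f A)) f S.
Proof.
move=> hf; rewrite (diff_conv _ _ hf) conv_twist //.
  by rewrite expr0z scale1r scaler_nat mulr2n.
by move=> A; have := diff_homog (hf A); rewrite addr0.
Qed.

Section Triples.
Variable S : {set 'I_k}.
Definition triple_sum (F : {set 'I_k} -> {set 'I_k} -> {set 'I_k} -> L) : L :=
  \sum_A \sum_B \sum_(C | A :|: B :|: C == S) F A B C.

Lemma eq_triple_sum F F' : (forall A B C, F A B C = F' A B C) ->
  triple_sum F = triple_sum F'.
Proof.
by move=> e; apply: eq_bigr => A _; apply: eq_bigr => B _; apply: eq_bigr => C _.
Qed.

Lemma triple_swap F : triple_sum F = triple_sum (fun A B C => F B A C).
Proof.
rewrite /triple_sum exchange_big /=; apply: eq_bigr => A _; apply: eq_bigr => B _.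
by rewrite [B :|: A]setUC.
Qed.

Lemma triple_swap23 F : triple_sum F = triple_sum (fun A B C => F A C B).
Proof.
apply: eq_bigr => A _.
under eq_bigr => B _ do rewrite big_mkcond.
rewrite exchange_big /=; apply: eq_bigr => B _; rewrite [RHS]big_mkcond.
by apply: eq_bigr => C _; rewrite setUAC.
Qed.

Lemma triple_rot F : triple_sum F = triple_sum (fun A B C => F B C A).
Proof. by rewrite triple_swap23 triple_swap. Qed.

Lemma triple_sumD F F' :
  triple_sum (fun A B C => F A B C + F' A B C) = triple_sum F + triple_sum F'.
Proof.
rewrite /triple_sum -big_split; apply: eq_bigr => A _; rewrite -big_split.
by apply: eq_bigr => B _; rewrite -big_split.
Qed.

Lemma triple_sumN F : triple_sum (fun A B C => - F A B C) = - triple_sum F.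
Proof.
rewrite /triple_sum -sumrN; apply: eq_bigr => A _; rewrite -sumrN.
by apply: eq_bigr => B _; rewrite -sumrN.
Qed.

(** Nested convolutions are sums over triples of sets: the union [D] of two
   of them is not a free variable. *)
Lemma sum_union (V : lmodType rat) (F : {set 'I_k} -> {set 'I_k} -> {set 'I_k} -> V) :
  \sum_A \sum_B F A B (A :|: B) = \sum_D \sum_A \sum_(B | A :|: B == D) F A B D.
Proof.
rewrite [RHS]exchange_big; apply: eq_bigr => A _.
rewrite (partition_big (fun B => A :|: B) predT) //=.
by apply: eq_bigr => D _; apply: eq_bigr => B /eqP ->.
Qed.

Lemma conv_convl f g h : conv (conv f g) h S =
  triple_sum (fun A B C => (- (-1) ^ du B * shuffle_sign3 n A B C)
                            *: bracket (bracket (f A) (g B)) (h C)).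
Proof.
rewrite /triple_sum.
under [RHS]eq_bigr => A _ do under eq_bigr => B _ do
  under eq_bigr => C _ do rewrite -bracket_sign3.
rewrite (sum_union (fun A B D => \sum_(C | D :|: C == S)
   (bracket_sign n A B * bracket_sign n D C) *: bracket (bracket (f A) (g B)) (h C))).
apply: eq_bigr => D _.
under [RHS]eq_bigr => A _ do rewrite exchange_big /=.
rewrite [RHS]exchange_big; apply: eq_bigr => C _ /=.
rewrite /conv (lin_sum (bracket_linl _)) scaler_sumr; apply: eq_bigr => A _.
rewrite (lin_sum (bracket_linl _)) scaler_sumr; apply: eq_bigr => B _.
by rewrite bracketZl scalerA mulrC.
Qed.

Lemma bracket_sign3r A B C :
  bracket_sign n B C * bracket_sign n A (B :|: C)
  = (-1) ^ (du A + du B) * shuffle_sign3 n A B C.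
Proof.
rewrite -shuffle_sign3r /bracket_sign.
by set x := shuffle_sign _ B C; set z := shuffle_sign _ A _; sign_cases.
Qed.

Lemma conv_convr f g h : conv f (conv g h) S =
  triple_sum (fun A B C => ((-1) ^ (du A + du B) * shuffle_sign3 n A B C)
                            *: bracket (f A) (bracket (g B) (h C))).
Proof.
rewrite triple_rot triple_rot /triple_sum.
under [RHS]eq_bigr => B _ do under eq_bigr => C _ do
  under eq_bigr => A _ do rewrite -bracket_sign3r.
rewrite (sum_union (fun B C D => \sum_(A | D :|: A == S)
   (bracket_sign n B C * bracket_sign n A D) *: bracket (f A) (bracket (g B) (h C)))).
rewrite /conv.
under [LHS]eq_bigr => A _ do rewrite big_mkcond.
rewrite exchange_big /=; apply: eq_bigr => D _.
under [RHS]eq_bigr => B _ do rewrite exchange_big /=.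
rewrite [RHS]exchange_big -big_mkcond; apply: eq_big => [A|A _] /=.
  by rewrite setUC.
rewrite (lin_sum (bracket_linr _)) scaler_sumr; apply: eq_bigr => B _.
rewrite (lin_sum (bracket_linr _)) scaler_sumr; apply: eq_bigr => C _.
by rewrite bracketZr scalerA mulrC.
Qed.

Lemma shuffle_sign3_swap A B C :
  shuffle_sign3 n A C B = (-1) ^ ((du B + 1) * (du C + 1)) * shuffle_sign3 n A B C.
Proof.
rewrite /shuffle_sign3 (shuffle_signC n C B) [_ * (du B + 1)]mulrC.
set x := shuffle_sign n A B; set y := shuffle_sign n A C.
by set z := shuffle_sign n B C; set e := (-1) ^ _; ring.
Qed.

(** The Jacobi identity of [L (x) Lambda] when two of the three elements are
   equal: both terms on the right-hand side of the Jacobi identity of [L]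
   contribute [conv (conv h y) y], one of them after exchanging the last two
   sets. *)
Lemma conv_leibniz p h y : graded p h -> graded 0 y ->
  conv (twist h) (conv y y) S = - 2 *: conv (conv h y) y S.
Proof.
move=> hh hy0; have hy A : homog (du A) (y A) by have := hy0 A; rewrite addr0.
pose W A B C := ((-1) ^ du B * shuffle_sign3 n A B C)
                  *: bracket (bracket (h A) (y B)) (y C).
have -> : conv (conv h y) y S = - triple_sum W.
  rewrite conv_convl -triple_sumN; apply: eq_triple_sum => A B C.
  by rewrite mulNr scaleNr.
rewrite scaleNr scalerN opprK scaler_nat mulr2n {2}triple_swap23 -triple_sumD conv_convr.
apply: eq_triple_sum => A B C; rewrite /W /twist bracketZl scalerA.
rewrite (bracket_jacobi (hh A) (hy B) (hy C)).
rewrite (bracket_anti (hy B) (bracket_homog (hh A) (hy C))).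
rewrite shuffle_sign3_swap scalerDr !scalerA.
by congr (_ *: _ + _ *: _); set x := shuffle_sign3 n A B C; sign_cases.
Qed.

End Triples.

(** For [h = y], the left-hand side of [conv_leibniz] is
   [conv (conv y y) y] itself, which is therefore equal to -2 times itself. *)
Lemma conv_jacobi y S : graded 0 y -> conv (conv y y) y S = 0.
Proof.
move=> hy; have e := conv_leibniz S hy hy.
have : (1 + 2) *: conv (conv y y) y S = 0.
  rewrite scalerDl scale1r -[2%:R]opprK scaleNr -e conv_twist ?subrr //.
  by have := graded_conv hy hy.
by move/eqP; rewrite scaler_eq0 => /orP[//|/eqP].
Qed.

Lemma conv_set0 f g : f set0 = 0 -> conv f g set0 = 0.
Proof.
move=> f0; rewrite /conv big1 // => A _; rewrite big1 // => B.
by rewrite setU_eq0 => /andP[/eqP -> _]; rewrite f0 bracket0l scaler0.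
Qed.

Lemma quad_set0 f : f set0 = 0 -> quad f set0 = 0.
Proof. by move=> f0; rewrite /quad conv_set0 ?scaler0. Qed.

Lemma quad_local f g S : f set0 = 0 -> g set0 = 0 ->
  (forall A, A \proper S -> f A = g A) -> quad f S = quad g S.
Proof. by move=> f0 g0 e; congr (_ *: _); exact: conv_local. Qed.

(** The component at [S] of the Maurer-Cartan equation. *)
Definition MC f S : Prop := diff (f S) = quad f S.

(** [d (1/2 [y, y]) = [d y, y] = 1/2 [[y, y], y] = 0], where only the
   Maurer-Cartan equation below [S] is used. *)
Lemma quad_cycle f S : graded 0 f -> f set0 = 0 ->
  (forall A, A \proper S -> MC f A) -> diff (quad f S) = 0.
Proof.
move=> hf f0 mc; rewrite /quad diffZ diff_conv_self // scalerA mulVf // scale1r.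
rewrite (@conv_local _ (quad f) _ f) ?f0 ?diff0 ?quad_set0 //.
by rewrite /quad convZl conv_jacobi ?scaler0.
Qed.

(** Gauge transformation of [y] by [exp (b e_S0)].  As [e_S0] has square zero,
   the exponential series stops after its linear term, and the transformed
   family is [y - d (b e_S0) + [b e_S0, y]]. *)
Section Gauge.
Variables (S0 : {set 'I_k}) (b : L) (y : {set 'I_k} -> L).
Hypotheses (S0n0 : S0 != set0) (hb : homog (du S0 + 1) b).
Hypotheses (hy : graded 0 y) (y0 : y set0 = 0).

Let delta A : L := if A == S0 then b else 0.

Let shift S : L := - diff (delta S) - conv delta y S.

Definition gauge S : L := y S + shift S.

Let hdelta : graded 1 delta.
Proof. by move=> A; rewrite /delta; case: eqP => [->//|_]; exact: homog0. Qed.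

Let hshift : graded 0 shift.
Proof.
move=> A; apply: homogD; apply: homogN.
  by have := diff_homog (hdelta A); rewrite addrK addr0.
exact: (graded_conv hdelta hy A).
Qed.

Lemma graded_gauge : graded 0 gauge.
Proof. by move=> A; apply: homogD; [exact: hy|exact: hshift]. Qed.

Lemma conv_delta_supp S : ~~ (S0 \proper S) -> conv delta y S = 0.
Proof.
move=> nS; rewrite /conv big1 // => A _; rewrite big1 // => B /eqP AB.
rewrite /delta; case: eqP => [A0|_]; last by rewrite bracket0l scaler0.
case: (boolP [disjoint A & B]) => [dAB|/bracket_sign_disj ->]; last by rewrite scale0r.
have [->|Bn0] := eqVneq B set0; first by rewrite y0 bracket0r scaler0.
case/negP: nS; rewrite properE -AB -A0 subsetUl subUset subxx /=.
by apply: contraNN Bn0 => BA; rewrite -(setIidPr BA) setI_eq0.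
Qed.

Let shift_supp S : ~~ (S0 \subset S) -> shift S = 0.
Proof.
move=> nS; rewrite /shift conv_delta_supp; last by apply: contra nS; exact: proper_sub.
rewrite /delta; case: eqP => [e|_].
by rewrite e subxx in nS.
by rewrite diff0 (@oppr0 L) (@addr0 L).
Qed.

Lemma gauge_supp S : ~~ (S0 \subset S) -> gauge S = y S.
Proof. by move=> nS; rewrite /gauge shift_supp ?addr0. Qed.

Lemma gauge_at : gauge S0 = y S0 - diff b.
Proof. by rewrite /gauge /shift conv_delta_supp ?properxx // /delta eqxx subr0. Qed.

(** The linear terms of [quad (y + shift)] agree with [diff shift] by
   [conv_leibniz]; the quadratic term vanishes, because [shift] lives on
   sets containing the nonempty set [S0] and two such sets meet. *)
Lemma gauge_MC S : (forall A, A \subset S -> MC y A) -> MC gauge S.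
Proof.
move=> mc; rewrite /MC.
have shift2 : conv shift shift S = 0.
  rewrite /conv big1 // => A _; rewrite big1 // => B _.
  case: (boolP (S0 \subset A)) => [sA|/shift_supp ->]; last by rewrite bracket0l scaler0.
  case: (boolP (S0 \subset B)) => [sB|/shift_supp ->]; last by rewrite bracket0r scaler0.
  rewrite bracket_sign_disj ?scale0r // -setI_eq0; apply: contraNN S0n0 => /eqP AB.
  by rewrite -subset0 -AB subsetI sA sB.
have q : quad gauge S = quad y S + conv shift y S.
  rewrite /quad /gauge convDl (convDr y y shift) (convDr shift y shift) shift2.
  rewrite addr0 (conv_sym _ hy hshift) -addrA.
  by rewrite scalerDr -mulr2n -scaler_nat scalerA mulVf ?scale1r.
rewrite q /gauge diffD (mc S (subxx _)); congr (_ + _).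
rewrite /shift diffB diffN diffK oppr0 sub0r (diff_conv _ _ hdelta) expr1z scaleN1r.
have -> : conv (twist delta) (fun A => diff (y A)) S = - conv (conv delta y) y S.
  have -> : conv (twist delta) (fun A => diff (y A)) S = conv (twist delta) (quad y) S.
    apply: eq_bigr => A _; apply: eq_bigr => B /eqP AB.
    by rewrite mc // -AB subsetUr.
  rewrite {1}/quad convZr (conv_leibniz _ hdelta hy) scalerA mulrN mulVf //.
  by rewrite scaleN1r.
rewrite opprK opprD -!scaleN1r -!convZl -convDl; apply: eq_conv => // A.
by rewrite !scaleN1r.
Qed.

End Gauge.

End Convolution.

(** * Shuffles as subsets *)

Lemma sorted_enum_ord m (A : {set 'I_m}) : sorted (fun i j : 'I_m => (i < j)%N) (enum A).
Proof.
rewrite /enum_mem; apply: sorted_filter; first by move=> ? ? ?; exact: ltn_trans.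
by have := iota_ltn_sorted 0 m; rewrite -val_enum_ord sorted_map enumT.
Qed.

Section Shuffles.
Variables (k : nat).
Implicit Types (I A B : {set 'I_k}).

(** Comparing positions in [I] is comparing indices, so inversions of a shuffle
   can be counted on the sets themselves. *)
Lemma enum_val_lt I (i j : 'I_#|I|) : (enum_val i < enum_val j)%N = (i < j)%N.
Proof.
have lt (a b : 'I_#|I|) : (a < b)%N -> (enum_val a < enum_val b)%N.
  move=> ab; rewrite (enum_val_nth (enum_val a) a) (enum_val_nth (enum_val a) b).
  have tr : transitive (fun i j : 'I_k => (i < j)%N) by move=> ? ? ?; exact: ltn_trans.
  have := sorted_ltn_nth tr (enum_val a) (sorted_enum_ord I).
  by apply; rewrite ?inE -?cardE.
case: (ltngtP i j) => [/lt //|/lt/ltnW|/val_inj ->]; last by rewrite ltnn.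
by rewrite leqNgt => /negbTE.
Qed.

Section OneSet.
Variables (I : {set 'I_k}) (p : nat).
Local Notation m := #|I|.
Implicit Types s : 'S_#|I|.

Let ev_inj s : injective (fun j => enum_val (s j)).
Proof. by move=> i j /enum_val_inj/perm_inj. Qed.

Lemma mem_left_set s (j : 'I_m) : (enum_val (s j) \in left_set p s) = (j < p)%N.
Proof.
apply/imsetP/idP => [[i]|jp]; last by exists j; rewrite ?inE.
by rewrite inE => ip /ev_inj ->.
Qed.

Lemma mem_right_set s (j : 'I_m) : (enum_val (s j) \in right_set p s) = (p <= j)%N.
Proof.
apply/imsetP/idP => [[i]|jp]; last by exists j; rewrite ?inE.
by rewrite inE => ip /ev_inj ->.
Qed.

Lemma left_set_sub s : left_set p s \subset I.
Proof. by apply/subsetP => x /imsetP[j _ ->]; exact: enum_valP. Qed.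

Lemma right_setE s : right_set p s = I :\: left_set p s.
Proof.
apply/setP => x; rewrite inE.
case: (boolP (x \in I)) => xI; last first.
  rewrite andbF; apply/negP => /imsetP[j _ e]; case/negP: xI.
  by rewrite e; exact: enum_valP.
have -> : x = enum_val (s ((s^-1)%g (enum_rank_in xI x))) by rewrite permKV enum_rankK_in.
by rewrite mem_left_set mem_right_set andbT -leqNgt.
Qed.

Lemma card_left_set s : (p <= m)%N -> #|left_set p s| = p.
Proof.
move=> pm; rewrite card_imset; last exact: ev_inj.
rewrite -sum1_card; under eq_bigl do rewrite inE.
rewrite -(big_mkord (fun j => (j < p)%N) (fun=> 1%N)).
by rewrite -(big_nat_widen _ _ _ predT) // sum_nat_const_nat muln1 subn0.
Qed.

Lemma shuffle_ltP s : reflect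
  (forall i j : 'I_m, (i < j)%N -> (j < p)%N || (p <= i)%N -> (s i < s j)%N)
  (is_shuffle p s).
Proof.
apply: (iffP forallP) => [h i j ij pij|h i].
  by have /forallP/(_ j)/implyP := h i; apply; rewrite ij.
by apply/forallP => j; apply/implyP => /andP[]; exact: h.
Qed.

(** A shuffle has no inversion inside one of its two blocks. *)
Lemma shuffle_koszul n s : is_shuffle p s ->
  koszul (fun j => n (enum_val j)) s = shuffle_sign n (left_set p s) (right_set p s).
Proof.
move/shuffle_ltP => hs.
rewrite /shuffle_sign; have -> : [disjoint left_set p s & right_set p s].
  rewrite right_setE -setI_eq0; apply/eqP/setP => x.
  by rewrite !inE; case: (x \in left_set p s).
rewrite big_imset /=; last by move=> i j _ _; exact: ev_inj.
rewrite /koszul [RHS]big_mkcond; apply: eq_bigr => i _; rewrite inE.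
under [in RHS]eq_bigl => b do rewrite andbC.
rewrite [X in if _ then X else _]big_mkcondl.
rewrite big_imset /=; last by move=> a b _ _; exact: ev_inj.
rewrite -big_mkcondr /=.
case: (ltnP i p) => ip.
  apply: eq_bigl => j; rewrite inE enum_val_lt.
  case: (leqP p j) => pj; first by rewrite (leq_trans ip pj).
  case: (ltnP i j) => //= ij; apply/negbTE; rewrite -leqNgt ltnW //.
  by apply: hs; rewrite ?pj.
rewrite big_pred0 // => j; case: (ltnP i j) => //= ij.
by apply/negbTE; rewrite -leqNgt ltnW // hs // ip orbT.
Qed.

(** On each block the shuffle is the increasing enumeration of its image. *)
Lemma shuffle_inj s s' : is_shuffle p s -> is_shuffle p s' ->
  left_set p s = left_set p s' -> s = s'.
Proof.
move=> /shuffle_ltP hs /shuffle_ltP hs' eL.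
have irr : irreflexive (fun i j : 'I_m => (i < j)%N) by move=> i; exact: ltnn.
have tr : transitive (fun i j : 'I_m => (i < j)%N) by move=> ? ? ?; exact: ltn_trans.
have agree (P : nat -> bool) :
    (forall i j : 'I_m, P i -> P j -> (i < j)%N -> (s i < s j)%N /\ (s' i < s' j)%N) ->
    (forall x, P ((s^-1)%g x) = P ((s'^-1)%g x)) -> forall j : 'I_m, P j -> s j = s' j.
  move=> mono eP; pose D := [set j : 'I_m | P j]%SET.
  have inD (j : 'I_m) : (j \in D) = P j by rewrite in_set.
  suff /eq_in_map e : map s (enum D) = map s' (enum D).
    by move=> j jD; apply: e; rewrite mem_enum inD.
  have srt (u : 'S_m) : (forall i j : 'I_m, P i -> P j -> (i < j)%N -> (u i < u j)%N) ->
      sorted (fun i j : 'I_m => (i < j)%N) (map u (enum D)).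
    move=> hu; have aD : all (mem D) (enum D) by apply/allP => i; rewrite mem_enum.
    apply: homo_sorted_in aD (sorted_enum_ord D) => i j.
    by rewrite [i \in _]inD [j \in _]inD; exact: hu.
  have memE (u : 'S_m) x : (x \in map u (enum D)) = P ((u^-1)%g x).
    by rewrite -{1}(permKV u x) (mem_map (@perm_inj _ u)) mem_enum inD.
  apply: (irr_sorted_eq tr irr).
  - by apply: srt => i j iD jD /(mono i j iD jD)[].
  - by apply: srt => i j iD jD /(mono i j iD jD)[].
  - by move=> x; rewrite !memE eP.
have eI x : ((s^-1)%g x < p)%N = ((s'^-1)%g x < p)%N.
  by rewrite -(mem_left_set s) -(mem_left_set s') !permKV eL.
apply/permP => j; case: (ltnP j p) => jp.
  apply: (agree (fun i => i < p)%N) eI j jp => a b ap bp ab.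
  by split; [apply: hs|apply: hs']; rewrite ?bp.
apply: (agree (fun i => p <= i)%N) j jp => [a b ap bp ab|x].
  by split; [apply: hs|apply: hs']; rewrite ?ap ?orbT.
by rewrite leqNgt [in RHS]leqNgt eI.
Qed.

Lemma shuffle_exists A : A \subset I -> #|A| = p ->
  exists2 s : 'S_#|I|, is_shuffle p s & left_set p s = A.
Proof.
move=> sA cA; pose A' := [set j : 'I_m | enum_val j \in A]%SET.
have cA' : #|A'| = p.
  rewrite -cA -(card_imset _ (@enum_val_inj _ (mem I))); apply: eq_card => x.
  apply/imsetP/idP => [[j]|xA]; first by rewrite inE => jA ->.
  have xI := subsetP sA x xA.
  by exists (enum_rank_in xI x); rewrite ?inE enum_rankK_in.
(* The shuffle lists the positions of [A] and then the others, both in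
   increasing order. *)
pose w := enum A' ++ enum (~: A').
have sw : size w = m by rewrite size_cat -!cardE cardsC card_ord.
have uw : uniq w.
  rewrite cat_uniq !enum_uniq andbT; apply/hasPn => x; rewrite !mem_enum.
  by rewrite inE.
pose f (i : 'I_m) := nth i w i.
have fi : injective f.
  move=> i j; rewrite /f (set_nth_default j) ?sw // => /eqP.
  by rewrite nth_uniq ?sw // => /eqP/val_inj.
have tr : transitive (fun i j : 'I_m => (i < j)%N) by move=> ? ? ?; exact: ltn_trans.
have fl (i : 'I_m) : (i < p)%N -> f i = nth i (enum A') i.
  by move=> ip; rewrite /f nth_cat -cardE cA' ip.
have fr (i : 'I_m) : (p <= i)%N -> f i = nth i (enum (~: A')) (i - p)%N.
  by move=> ip; rewrite /f nth_cat -cardE cA' ltnNge ip.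
have sl : size (enum A') = p by rewrite -cardE.
have sr : size (enum (~: A')) = (m - p)%N.
  by rewrite -[RHS]/(_ - p)%N -[X in (X - p)%N]sw size_cat sl addKn.
exists (perm fi).
  apply/shuffle_ltP => i j ij /orP[jp|pi]; rewrite !permE.
    have ip := ltn_trans ij jp.
    rewrite !fl // (set_nth_default j) ?sl //.
    by apply: (sorted_ltn_nth tr); rewrite ?inE ?sl //; exact: sorted_enum_ord.
  have pj := leq_trans pi (ltnW ij).
  have lt (l : 'I_m) : (p <= l)%N -> (l - p < m - p)%N.
    by move=> pl; rewrite ltn_sub2r // (leq_ltn_trans pl).
  rewrite !fr // (set_nth_default j) ?sr ?lt //.
  apply: (sorted_ltn_nth tr); rewrite ?inE ?sr ?lt ?ltn_sub2r //; last exact: leq_ltn_trans ij.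
  exact: sorted_enum_ord.
have pm : (p <= m)%N by rewrite -cA subset_leq_card.
apply/eqP; rewrite eqEcard cA card_left_set // leqnn andbT.
apply/subsetP => x /imsetP[j]; rewrite inE permE => jp ->.
have : f j \in A' by rewrite fl // -mem_enum mem_nth // sl.
by rewrite inE.
Qed.

(** The first element of [I] can only be in the first position of its block. *)
Lemma fixes_firstE s (j0 : 'I_m) : j0 = 0%N :> nat -> (0 < p)%N -> is_shuffle p s ->
  fixes_first s = (enum_val j0 \in left_set p s).
Proof.
move=> j00 p0 /shuffle_ltP hs.
have -> : enum_val j0 = enum_val (s ((s^-1)%g j0)) by rewrite permKV.
rewrite mem_left_set; apply/forallP/idP => [h|lp i].
  have /implyP/(_ (introT eqP j00))/eqP e := h j0.
  have <- : j0 = (s^-1)%g j0.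
    by apply: (@perm_inj _ s); rewrite permKV; apply: val_inj; rewrite /= e j00.
  by rewrite j00.
apply/implyP => /eqP i0; have ij : i = j0 by apply: val_inj; rewrite /= i0 j00.
case: (posnP ((s^-1)%g j0)) => [e|gt0].
  have <- : (s^-1)%g j0 = i by apply: val_inj; rewrite /= e i0.
  by rewrite permKV j00.
have := hs i ((s^-1)%g j0); rewrite i0 permKV gt0 lp j00 ltn0.
by move/(_ isT isT).
Qed.

End OneSet.

Variables (n : 'I_k -> int) (L : DGL) (y : {set 'I_k} -> L).
Hypotheses (hy : graded n 0 y) (y0 : y set0 = 0).

(** The terms of [conv y y I] for which the two sets do not meet. *)
Definition split_term I A : L := bracket_sign n A (I :\: A) *: bracket (y A) (y (I :\: A)).

Lemma conv_split I : conv n y y I = \sum_(A : {set 'I_k} | A \subset I) split_term I A.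
Proof.
rewrite /conv [RHS]big_mkcond; apply: eq_bigr => A _; case: ifP => AI.
  rewrite (bigD1 (I :\: A)) /=; last first.
    by rewrite -{2}(setID I A) (setIidPr AI).
  rewrite big1 ?addr0 // => B /andP[/eqP AB BI].
  rewrite bracket_sign_disj ?scale0r //; apply: contra BI => dAB.
  by rewrite -AB setDUl setDv set0U; apply/eqP/esym/setDidPl; rewrite disjoint_sym.
by rewrite big1 // => B /eqP AB; rewrite -AB subsetUl in AI.
Qed.

Lemma split_termC I A : A \subset I -> split_term I (I :\: A) = split_term I A.
Proof.
move=> AI; have E : I :\: (I :\: A) = A by rewrite setDDr setDv set0U; exact/setIidPr.
have hA := hy A; have hB := hy (I :\: A).
rewrite /split_term E bracket_signC (bracket_anti hB hA) !addr0 !scalerA.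
by congr (_ *: _); set z := bracket_sign _ _ _; sign_cases.
Qed.

Lemma split_term_full I : split_term I I = 0.
Proof. by rewrite /split_term setDv y0 bracket0r scaler0. Qed.

(** Exchanging [A] and [I :\: A] leaves the terms of [conv y y I] unchanged, so
   that the half in [quad] selects one set of each pair, the one that contains
   the first element of [I].  Shuffles fixing the first position list exactly
   these sets, [I] itself being excluded since [1 <= p < #|I|]. *)
Lemma sum_shuffles_quad I :
  \sum_(1 <= p < #|I|) \sum_(s : 'S_#|I| | is_shuffle p s && fixes_first s)
    ((-1) ^ u_degree n (left_set p s) * koszul (fun j => n (enum_val j)) s)
      *: bracket (y (left_set p s)) (y (right_set p s))
  = quad n y I.
Proof.
have [->|In0] := eqVneq I set0.
  by rewrite big_geq ?cards0 // quad_set0.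
have I0 : (0 < #|I|)%N by rewrite card_gt0.
pose j0 : 'I_#|I| := Ordinal I0; pose e0 := enum_val j0.
have e0I : e0 \in I by exact: enum_valP.
have half : quad n y I = \sum_(A : {set 'I_k} | (A \subset I) && (e0 \in A)) split_term I A.
  rewrite /quad conv_split (bigID (fun A : {set 'I_k} => e0 \in A)) /=.
  rewrite [X in _ + X](reindex_onto (fun A => I :\: A) (fun A => I :\: A)) /=; last first.
    by move=> A /andP[AI _]; rewrite setDDr setDv set0U; exact/setIidPr.
  have -> : \sum_(A | (I :\: A \subset I) && (e0 \notin I :\: A) && (I :\: (I :\: A) == A))
      split_term I (I :\: A) = \sum_(A : {set 'I_k} | (A \subset I) && (e0 \in A)) split_term I A.
    apply: eq_big => [A|A].
      rewrite subsetDl inE e0I andbT negbK setDDr setDv set0U.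
      by rewrite andbC; congr (_ && _); apply/eqP/setIidPr.
    move=> /andP[_ /eqP e]; apply: split_termC.
    by rewrite -e subsetDl.
  by rewrite -mulr2n -scaler_nat scalerA mulVf ?scale1r.
have layer p : (0 < p < #|I|)%N ->
    \sum_(s : 'S_#|I| | is_shuffle p s && fixes_first s)
      ((-1) ^ u_degree n (left_set p s) * koszul (fun j => n (enum_val j)) s)
        *: bracket (y (left_set p s)) (y (right_set p s))
    = \sum_(A : {set 'I_k} | [&& A \subset I, e0 \in A & #|A| == p]) split_term I A.
  move=> /andP[p0 pI].
  transitivity (\sum_(s in [set s : 'S_#|I| | is_shuffle p s && fixes_first s]%SET)
                  split_term I (left_set p s)).
    apply: eq_big => [s|s /andP[sh _]]; first by rewrite inE.
    by rewrite (shuffle_koszul n sh) /split_term -right_setE.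
  rewrite -(big_imset (split_term I)) /=; last first.
    move=> s s'; rewrite !inE => /andP[hs _] /andP[hs' _]; exact: shuffle_inj.
  apply: eq_bigl => A; apply/imsetP/and3P => [[s]|[AI eA /eqP cA]].
    rewrite inE => /andP[hs hf] ->; split; first exact: left_set_sub.
      by rewrite -(fixes_firstE (j0 := j0) _ p0 hs).
    by rewrite card_left_set // ltnW.
  have [s hs ls] := shuffle_exists AI cA; exists s => //.
  by rewrite inE hs (fixes_firstE (j0 := j0) _ p0 hs) // ls.
rewrite big_nat (eq_bigr _ layer) -big_nat half.
rewrite [RHS](bigID (fun A => A == I)) /= [X in X + _]big1 ?add0r => [|A /andP[_ /eqP ->]];
  last exact: split_term_full.
rewrite (exchange_big_dep (fun A => (A \subset I) && (e0 \in A))) /=; last first.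
  by move=> p A _ /and3P[-> ->].
rewrite [RHS]big_mkcondr; apply: eq_bigr => A /andP[AI eA].
under eq_bigl => p do rewrite AI eA /=.
have cA : (0 < #|A|)%N by rewrite card_gt0; apply/set0Pn; exists e0.
case: eqP => [->|ne] /=.
  rewrite big_nat_cond big_pred0 // => p.
  by case: eqP => [<-|]; rewrite ?ltnn ?andbF.
have ltA : (#|A| < #|I|)%N.
  by apply: proper_card; rewrite properEneq AI andbT; apply/eqP.
rewrite -big_filter (_ : [seq p <- _ | _] = [:: #|A|]) ?big_seq1 //.
rewrite (eq_filter (a2 := pred1 #|A|)) => [|p]; last by rewrite /= eq_sym.
by rewrite filter_pred1_uniq ?iota_uniq // mem_index_iota cA.
Qed.

End Shuffles.

(** * Trees evaluated on families, and the Picard iteration *)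

Lemma u_degree0 k (n : 'I_k -> int) : u_degree n set0 = - 1.
Proof. by rewrite /u_degree big_set0 add0r. Qed.

Section TreeFamilies.
Variables (k : nat) (n : 'I_k -> int) (L : DGL) (R : homotopy_retract L).
Implicit Types (S A B : {set 'I_k}) (xi : {set 'I_k} -> homology L) (t : btree).

Local Notation du := (u_degree n).

(** The family defined by [t] when its leaves are labelled by the whole
   family [i xi], its edges by [K] and its vertices by [conv]. *)
Fixpoint tree_family xi t S : L :=
  match t with
  | Leaf => hr_i R (xi S)
  | Node a b =>
      let edge c A :=
        if c is Leaf then tree_family xi c A else hr_K R (tree_family xi c A) in
      conv n (edge a) (edge b) S
  end.

Definition edge_family xi t S : L :=
  if t is Leaf then tree_family xi t S else hr_K R (tree_family xi t S).

Lemma tree_familyE xi a b S :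
  tree_family xi (Node a b) S = conv n (edge_family xi a) (edge_family xi b) S.
Proof. by []. Qed.

Lemma hr_i0 : hr_i R 0 = 0. Proof. exact: lin_zero (hr_i_linear R). Qed.
Lemma hr_q0 : hr_q R 0 = 0. Proof. exact: lin_zero (hr_q_linear R). Qed.
Lemma hr_K0 : hr_K R 0 = 0. Proof. exact: lin_zero (hr_K_linear R). Qed.

Definition graded_classes xi : Prop := forall S, homog (du S) (xi S).

Lemma graded_edge xi t : graded_classes xi -> graded n 0 (edge_family xi t).
Proof.
move=> hxi; elim: t => [|a ha b hb] S.
  by exact: (hr_i_degree R (hxi S)).
have := hr_K_degree R (graded_conv ha hb S).
have -> : du S + (0 + 0 - 1) + 1 = du S + 0 by ring.
exact.
Qed.

Lemma tree_family_set0 xi t : xi set0 = 0 -> tree_family xi t set0 = 0.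
Proof.
move=> xi0; suff [] : tree_family xi t set0 = 0 /\ edge_family xi t set0 = 0 by [].
elim: t => [|a [ha ea] b [hb eb]]; first by rewrite /= xi0 hr_i0.
have e : tree_family xi (Node a b) set0 = 0 by rewrite tree_familyE conv_set0.
by split=> //; rewrite /edge_family e hr_K0.
Qed.

Lemma edge_family_set0 xi t : xi set0 = 0 -> edge_family xi t set0 = 0.
Proof.
move=> xi0; rewrite /edge_family tree_family_set0 // hr_K0.
by case: t.
Qed.

Lemma eq_edge_family xi t t' S : tree_iso t t' ->
  tree_family xi t S = tree_family xi t' S ->
  edge_family xi t S = edge_family xi t' S.
Proof. by case=> //= *; congr (hr_K R). Qed.

Lemma tree_family_iso xi t t' : graded_classes xi -> tree_iso t t' ->
  tree_family xi t =1 tree_family xi t'.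
Proof.
move=> hxi; elim=> {t t'} // a a' b b' ha IHa hb IHb S; rewrite !tree_familyE.
- by apply: eq_conv => A; exact: eq_edge_family.
- rewrite conv_sym; try exact: graded_edge.
  by apply: eq_conv => A; exact: eq_edge_family.
Qed.

Lemma tree_family_small xi t S : xi set0 = 0 -> (#|S| < leaves t)%N ->
  tree_family xi t S = 0 /\ edge_family xi t S = 0.
Proof.
move=> xi0; elim: t S => [|a ha b hb] S.
  by rewrite ltnS leqn0 cards_eq0 => /eqP ->; rewrite edge_family_set0 // tree_family_set0.
move=> h; suff e : tree_family xi (Node a b) S = 0.
  by split=> //; rewrite /edge_family e hr_K0.
rewrite tree_familyE /conv big1 // => A _; rewrite big1 // => B /eqP AB.
case: (boolP [disjoint A & B]) => [dAB|/bracket_sign_disj ->]; last by rewrite scale0r.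
have cS : #|S| = (#|A| + #|B|)%N.
  by rewrite -AB cardsU disjoint_setI0 // cards0 subn0.
case: (ltnP #|A| (leaves a)) => [/ha[_ ->]|lA]; first by rewrite bracket0l scaler0.
case: (ltnP #|B| (leaves b)) => [/hb[_ ->]|lB]; first by rewrite bracket0r scaler0.
by move: h; rewrite cS /= ltnNge leq_add.
Qed.

(** A tree with [#|S|] leaves has to give each of them a nonempty set, hence a
   singleton. *)
Lemma tree_family_top xi xi' t S : xi set0 = 0 -> xi' set0 = 0 ->
  (forall i, xi [set i] = xi' [set i]) -> #|S| = leaves t ->
  tree_family xi t S = tree_family xi' t S /\ edge_family xi t S = edge_family xi' t S.
Proof.
move=> xi0 xi'0 exi; elim: t S => [|a ha b hb] S.
  by move/eqP/cards1P => [i ->]; rewrite /edge_family /= exi.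
move=> h; suff e : tree_family xi (Node a b) S = tree_family xi' (Node a b) S.
  by split=> //; rewrite /edge_family e.
rewrite !tree_familyE; apply: eq_bigr => A _; apply: eq_bigr => B /eqP AB.
case: (boolP [disjoint A & B]) => [dAB|/bracket_sign_disj ->]; last by rewrite !scale0r.
have cS : #|S| = (#|A| + #|B|)%N.
  by rewrite -AB cardsU disjoint_setI0 // cards0 subn0.
have small zeta t' (C : {set 'I_k}) : zeta set0 = 0 ->
    (#|C| < leaves t')%N -> edge_family zeta t' C = 0.
  by move=> z0 /(tree_family_small z0)[].
case: (ltngtP #|A| (leaves a)) => lA.
- by rewrite !(small _ a) // !bracket0l.
- have lB : (#|B| < leaves b)%N.
    by rewrite -(ltn_add2l (leaves a)) -[(_ + leaves b)%N]h cS ltn_add2r.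
  by rewrite !(small _ b) // !bracket0r.
- have lB : #|B| = leaves b by apply/eqP; rewrite -(eqn_add2l #|A|) -cS h lA.
  by case: (ha A lA) => _ ->; case: (hb B lB) => _ ->.
Qed.

(** The [m]-th iterate of [z |-> i xi + K (quad z)] starting from zero, see
   [picardS]. *)
Definition picard xi m S : L :=
  \sum_(t <- trees m) 2 ^- nodes t *: edge_family xi t S.

Lemma quad_picard xi m S : quad n (picard xi m) S =
  \sum_(t <- [seq Node a b | a <- trees m, b <- trees m])
     2 ^- nodes t *: tree_family xi t S.
Proof.
rewrite /quad /picard conv_suml scaler_sumr big_allpairs_dep /=.
apply: eq_bigr => a _; rewrite conv_sumr scaler_sumr; apply: eq_bigr => b _.
by rewrite convZl convZr !scalerA exprS exprD !invfM.
Qed.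

Lemma picardS xi m S :
  picard xi m.+1 S = hr_i R (xi S) + hr_K R (quad n (picard xi m) S).
Proof.
rewrite quad_picard /picard big_cons expr0 invr1 scale1r; congr (_ + _).
rewrite (lin_sum (hr_K_linear R)) !big_allpairs_dep /=.
apply: eq_bigr => a _; apply: eq_bigr => b _.
by rewrite (lin_scale (hr_K_linear R)).
Qed.

Lemma picard_set0 xi m : xi set0 = 0 -> picard xi m set0 = 0.
Proof. by move=> xi0; rewrite /picard big1 // => t _; rewrite edge_family_set0 ?scaler0. Qed.

Lemma graded_picard xi m : graded_classes xi -> graded n 0 (picard xi m).
Proof. by move=> hxi S; apply: homog_sum => t _; apply: homogZ; exact: graded_edge. Qed.

(** Any solution of the fixed-point equation in sizes at most [m] is the
   Picard solution there, since [quad y S] only involves proper subsets of [S]. *)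
Lemma picard_unique xi y m j S : xi set0 = 0 -> y set0 = 0 ->
  (forall A, (0 < #|A| <= m)%N -> y A = hr_i R (xi A) + hr_K R (quad n y A)) ->
  (#|S| <= m)%N -> (#|S| <= j)%N -> y S = picard xi j S.
Proof.
move=> xi0 y0 fix_y; elim: j S => [|j IH] S Sm Sj.
  by move: Sj; rewrite leqn0 cards_eq0 => /eqP ->; rewrite picard_set0.
have [->|Sn0] := eqVneq S set0; first by rewrite picard_set0.
rewrite picardS fix_y ?card_gt0 ?Sn0 //; congr (_ + hr_K R _).
apply: quad_local => // [|A /proper_card lA]; first exact: picard_set0.
apply: IH; first exact: leq_trans (ltnW lA) Sm.
by rewrite -ltnS; exact: leq_trans lA Sj.
Qed.

End TreeFamilies.

(** * Expansion of a tree family over words of subsets *)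

Lemma enum_ordD p q :
  enum 'I_(p + q) = map (@lshift p q) (enum 'I_p) ++ map (@rshift p q) (enum 'I_q).
Proof.
apply: (inj_map val_inj); rewrite map_cat.
have E m : [seq nat_of_ord i | i <- enum 'I_m] = iota 0 m by exact: val_enum_ord.
rewrite [LHS]E iotaD; congr (_ ++ _).
  by rewrite -map_comp -[LHS]E; exact: eq_map.
rewrite add0n -[p in iota p]addn0 iotaDl -E -[in LHS]map_comp -[in RHS]map_comp.
exact: eq_map.
Qed.

Section Join.
Variables (X : finType) (p q : nat).
Implicit Types (F : {ffun 'I_p -> X}) (G : {ffun 'I_q -> X}).

(** Concatenation of words: the leaves of [Node a b] are those of [a] followed
   by those of [b]. *)
Definition cat_ffun F G : {ffun 'I_(p + q) -> X} :=
  [ffun i => match split i with inl x => F x | inr y => G y end].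

Lemma cat_ffun_lshift F G i : cat_ffun F G (lshift q i) = F i.
Proof. by rewrite ffunE -[lshift q i]/(unsplit (inl i)) unsplitK. Qed.

Lemma cat_ffun_rshift F G i : cat_ffun F G (rshift p i) = G i.
Proof. by rewrite ffunE -[rshift p i]/(unsplit (inr i)) unsplitK. Qed.

Lemma sum_cat_ffun (V : nmodType) (P : pred {ffun 'I_(p + q) -> X})
    (Phi : {ffun 'I_(p + q) -> X} -> V) :
  \sum_(H | P H) Phi H = \sum_F \sum_(G | P (cat_ffun F G)) Phi (cat_ffun F G).
Proof.
rewrite pair_big_dep /= (reindex (fun FG => cat_ffun FG.1 FG.2)) //=.
exists (fun H : {ffun 'I_(p + q) -> X} =>
  ([ffun i => H (lshift q i)], [ffun i => H (rshift p i)])).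
- move=> [F G] _ /=; congr (_, _); apply/ffunP => i.
    by rewrite ffunE cat_ffun_lshift.
  by rewrite ffunE cat_ffun_rshift.
- move=> H _; apply/ffunP => i; rewrite ffunE.
  by case: split_ordP => j ->; rewrite ffunE.
Qed.

End Join.

Section Unfolding.
Variables (k : nat) (n : 'I_k -> int).
Implicit Types (S A B : {set 'I_k}).

Local Notation du := (u_degree n).

Definition cover_by p (F : {ffun 'I_p -> {set 'I_k}}) : {set 'I_k} :=
  \bigcup_(i < p) F i.

(** The sign of a word [F_1, .., F_p] of sets, which is zero unless they are
   pairwise disjoint.  It contains both the Koszul sign of the word and the
   shift of degrees between [u_S] and [e_S]. *)
Definition word_sign p (F : {ffun 'I_p -> {set 'I_k}}) : rat :=
  \prod_(i < p) \prod_(j < p | (i < j)%N) bracket_sign n (F i) (F j).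

Lemma word_sign_disjoint p (F : {ffun 'I_p -> {set 'I_k}}) : word_sign F != 0 ->
  forall i j, i != j -> [disjoint F i & F j].
Proof.
move=> /prodf_neq0 h i j; wlog lt : i j / (i < j)%N.
  move=> IH ne; case: (ltngtP i j) => [lt|lt|/val_inj e]; first exact: IH.
    by rewrite disjoint_sym; apply: IH; rewrite // eq_sym.
  by rewrite e eqxx in ne.
move=> _; have /prodf_neq0/(_ j lt) := h i isT.
by apply: contraNT => /(bracket_sign_disj n) ->.
Qed.

Section Bigcup.
Variables (I : eqType) (F : I -> {set 'I_k}).
Hypothesis dF : forall i j, i != j -> [disjoint F i & F j].

Lemma disjoint_bigcup i r : i \notin r -> [disjoint F i & \bigcup_(j <- r) F j].
Proof.
elim: r => [|j r IH]; first by rewrite big_nil -setI_eq0 setI0.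
rewrite inE negb_or big_cons => /andP[ij ir].
by rewrite -setI_eq0 setIUr setU_eq0 !setI_eq0 dF // IH.
Qed.

Lemma shuffle_sign_bigcupl r B : uniq r ->
  shuffle_sign n (\bigcup_(i <- r) F i) B = \prod_(i <- r) shuffle_sign n (F i) B.
Proof.
elim: r => [_|i r IH /= /andP[ir ur]].
  by rewrite !big_nil /shuffle_sign -setI_eq0 set0I eqxx big_set0.
by rewrite !big_cons shuffle_signUl ?disjoint_bigcup // IH.
Qed.

Lemma shuffle_sign_bigcupr r B : uniq r ->
  shuffle_sign n B (\bigcup_(i <- r) F i) = \prod_(i <- r) shuffle_sign n B (F i).
Proof.
elim: r => [_|i r IH /= /andP[ir ur]].
  rewrite !big_nil /shuffle_sign -setI_eq0 setI0 eqxx big1 // => a _.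
  by rewrite big_pred0 // => b; rewrite inE.
by rewrite !big_cons shuffle_signUr ?disjoint_bigcup // IH.
Qed.

Lemma u_degree_bigcup r : uniq r ->
  du (\bigcup_(i <- r) F i) = \sum_(i <- r) (du (F i) + 1) - 1.
Proof.
elim: r => [_|i r IH /= /andP[ir ur]]; first by rewrite !big_nil u_degree0.
by rewrite !big_cons u_degreeU ?disjoint_bigcup // IH //; ring.
Qed.
End Bigcup.

Lemma word_sign_cat_ffun p q (F : {ffun 'I_p -> {set 'I_k}}) (G : {ffun 'I_q -> {set 'I_k}}) :
  word_sign (cat_ffun F G) = word_sign F * word_sign G *
    \prod_(i < p) \prod_(j < q) bracket_sign n (F i) (G j).
Proof.
rewrite /word_sign big_split_ord /= mulrAC; congr (_ * _).
  rewrite -big_split; apply: eq_bigr => i _; rewrite big_split_ord /=; congr (_ * _).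
    by apply: eq_bigr => j _; rewrite !cat_ffun_lshift.
  apply: eq_big => [j|j _]; last by rewrite cat_ffun_lshift cat_ffun_rshift.
  by rewrite (leq_trans (ltn_ord i)) ?leq_addr.
apply: eq_bigr => i _; rewrite big_split_ord /= big_pred0 ?mul1r => [|j].
  by apply: eq_big => [j|j _]; rewrite ?ltn_add2l ?cat_ffun_rshift.
by apply/negbTE; rewrite -leqNgt ltnW // (leq_trans (ltn_ord j)) ?leq_addr.
Qed.

Lemma cover_cat_ffun p q (F : {ffun 'I_p -> {set 'I_k}}) (G : {ffun 'I_q -> {set 'I_k}}) :
  cover_by (cat_ffun F G) = cover_by F :|: cover_by G.
Proof.
rewrite /cover_by big_split_ord /=.
by congr (_ :|: _); apply: eq_bigr => i _; rewrite ?cat_ffun_lshift ?cat_ffun_rshift.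
Qed.

(** Let [D] be the sum of the degrees of [F].  The degree of the union of [F]
   is [D + p], since a union of [p + 1] sets has [p] more units than its parts,
   and [D] is counted [q + 1] times in the product over the pairs.  The
   discrepancy is the sign of [tree_op] at a vertex with [p + 1] leaves on the
   left and [q] labels [hr_K] on the right. *)
Lemma cross_sign p q (F : {ffun 'I_p.+1 -> {set 'I_k}}) (G : {ffun 'I_q.+1 -> {set 'I_k}}) :
  (forall i j, i != j -> [disjoint F i & F j]) ->
  (forall i j, i != j -> [disjoint G i & G j]) ->
  bracket_sign n (cover_by F) (cover_by G)
  = (\prod_i \prod_j bracket_sign n (F i) (G j))
    * ((-1) ^+ p * (-1) ^ (q%:Z * \sum_i du (F i))).
Proof.
move=> dF dG.
have uo m : uniq (index_enum 'I_m) by exact: index_enum_uniq.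
rewrite /bracket_sign /cover_by (shuffle_sign_bigcupl dF _ (uo _)) (u_degree_bigcup dF (uo _)).
under eq_bigr => i _ do rewrite (shuffle_sign_bigcupr dG _ (uo _)).
under [X in _ = X * _]eq_bigr => i _ do rewrite big_split /= prodr_const card_ord.
rewrite [X in _ = X * _]big_split /= [RHS]mulrAC; congr (_ * _).
have -> : \prod_i ((-1 : rat) ^ du (F i)) ^+ q.+1 = (-1) ^ (q.+1%:Z * \sum_i du (F i)).
  rewrite mulr_sumr sgn_sum; apply: eq_bigr => i _.
  by rewrite mulrC -exprz_exp.
rewrite big_split /= sumr_const card_ord exprnP -!sgnD natz !intS.
by sign_cases.
Qed.

End Unfolding.

Section WordExpansion.
Variables (k : nat) (n : 'I_k -> int) (L : DGL) (R : homotopy_retract L).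
Variable xi : {set 'I_k} -> homology L.
Implicit Types (S A B : {set 'I_k}) (t : btree).

Definition letters p (F : {ffun 'I_p -> {set 'I_k}}) : seq (int * homology L) :=
  [seq (u_degree n (F i), xi (F i)) | i <- enum 'I_p].

Definition branch_op t (v : seq (int * homology L)) : L :=
  if t is Leaf then tree_op R t v else hr_K R (tree_op R t v).

Local Arguments tree_op : simpl never.

Lemma tree_opE a b v : tree_op R (Node a b) v =
  ((-1) ^+ (leaves a).-1
     * (-1) ^ ((nodes b)%:Z * \sum_(x <- take (leaves a) v) x.1))
  *: bracket (branch_op a (take (leaves a) v)) (branch_op b (drop (leaves a) v)).
Proof. by []. Qed.

Lemma letters_cat_ffun p q (F : {ffun 'I_p -> {set 'I_k}}) (G : {ffun 'I_q -> {set 'I_k}}) :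
  letters (cat_ffun F G) = letters F ++ letters G.
Proof.
rewrite /letters enum_ordD map_cat -[in LHS]map_comp -[X in _ ++ X = _]map_comp.
by congr (_ ++ _); apply: eq_map => i /=; rewrite ?cat_ffun_lshift ?cat_ffun_rshift.
Qed.

Lemma size_letters p (F : {ffun 'I_p -> {set 'I_k}}) : size (letters F) = p.
Proof. by rewrite size_map size_enum_ord. Qed.

(** By induction on the tree; [cross_sign] is exactly what turns the signs of
   [conv] into those of [tree_op]. *)
Lemma tree_family_words t S : tree_family n R xi t S =
  \sum_(F : {ffun 'I_(leaves t) -> {set 'I_k}} | cover_by F == S)
    word_sign n F *: tree_op R t (letters F).
Proof.
elim: t S => [|a ha b hb] S.
  rewrite (big_pred1 [ffun=> S]) => [|F] /=.
    rewrite /word_sign big1 => [|i _].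
      by rewrite scale1r /letters enum_ordSl /= !ffunE.
    by rewrite big_pred0 // => j; rewrite !ord1.
  apply/eqP/eqP => [<-|->].
    by apply/ffunP => i; rewrite ffunE /cover_by big_ord_recl big_ord0 setU0 ord1.
  by rewrite /cover_by big_ord_recl big_ord0 setU0 ffunE.
have edge t (ht : forall S, tree_family n R xi t S =
    \sum_(F : {ffun 'I_(leaves t) -> {set 'I_k}} | cover_by F == S)
      word_sign n F *: tree_op R t (letters F)) A :
    edge_family n R xi t A =
    \sum_(F : {ffun 'I_(leaves t) -> {set 'I_k}} | cover_by F == A)
      word_sign n F *: branch_op t (letters F).
  case: t ht => [|c d] ht; first exact: ht.
  rewrite /edge_family ht (lin_sum (hr_K_linear R)).
  by apply: eq_bigr => F _; rewrite (lin_scale (hr_K_linear R)).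
rewrite tree_familyE sum_cat_ffun /conv.
transitivity (\sum_A \sum_B
   \sum_(F : {ffun 'I_(leaves a) -> {set 'I_k}} | cover_by F == A)
   \sum_(G : {ffun 'I_(leaves b) -> {set 'I_k}} | cover_by G == B)
    if cover_by F :|: cover_by G == S then
    (bracket_sign n (cover_by F) (cover_by G) * (word_sign n F * word_sign n G))
      *: bracket (branch_op a (letters F)) (branch_op b (letters G)) else 0).
  apply: eq_bigr => A _; rewrite big_mkcond; apply: eq_bigr => B _.
  case: ifP => AB; last first.
    rewrite big1 // => F /eqP ->; rewrite big1 // => G /eqP ->.
    by rewrite AB.
  rewrite (edge a ha) (edge b hb) (lin_sum (bracket_linl _)) scaler_sumr.
  apply: eq_bigr => F /eqP eA; rewrite (lin_sum (bracket_linr _)) scaler_sumr.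
  apply: eq_bigr => G /eqP eB; rewrite eA eB AB.
  by rewrite bracketZl bracketZr !scalerA.
under eq_bigr => A _ do rewrite exchange_big /=.
rewrite [RHS](partition_big (@cover_by k (leaves a)) predT) //=.
apply: eq_bigr => A _; apply: eq_bigr => F /eqP eA.
rewrite [RHS]big_mkcond [RHS](partition_big (@cover_by k (leaves b)) predT) //=.
apply: eq_bigr => B _; apply: eq_bigr => G _.
rewrite cover_cat_ffun; case: ifP => // _.
rewrite tree_opE letters_cat_ffun take_size_cat ?drop_size_cat ?size_letters //.
rewrite scalerA word_sign_cat_ffun; congr (_ *: _).
have [->|wF] := eqVneq (word_sign n F) 0; first by rewrite !(mul0r, mulr0).
have [->|wG] := eqVneq (word_sign n G) 0; first by rewrite !(mul0r, mulr0).
have dF := word_sign_disjoint wF; have dG := word_sign_disjoint wG.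
have -> : \sum_(x <- letters F) x.1 = \sum_i u_degree n (F i).
  by rewrite big_map big_enum.
rewrite mulrC -!mulrA; congr (_ * (_ * _)).
move: (nodes_leaves a) (nodes_leaves b) F G dF dG {wF wG eA ha hb edge} => -> -> F G dF dG.
exact: cross_sign.
Qed.

End WordExpansion.

(** * Symmetrization, and the transferred brackets *)

Section Symmetrization.
Variables (L : DGL) (R : homotopy_retract L).

Definition sym_tree_op t k (d : 'I_k -> int) (v : 'I_k -> homology L) : L :=
  \sum_(s : 'S_k) ((-1) ^+ s * koszul d s)
    *: tree_op R t [seq (d (s j), v (s j)) | j <- enum 'I_k].

(** Multilinearity; this discards the words in which some set is not a
   singleton, when the classes are concentrated on singletons. *)
Lemma tree_op0 t v : size v = leaves t -> has (fun x => x.2 == 0) v ->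
  tree_op R t v = 0.
Proof.
elim: t v => [|a ha b hb] v sv.
  case: v sv => [|x [|y v]] //= _; rewrite orbF => /eqP ->.
  exact: lin_zero (hr_i_linear R).
rewrite tree_opE -{1}(cat_take_drop (leaves a) v) has_cat => h.
have K0 : hr_K R 0 = 0 by exact: lin_zero (hr_K_linear R).
have st : size (take (leaves a) v) = leaves a.
  by rewrite size_takel // sv leq_addr.
have sd : size (drop (leaves a) v) = leaves b.
  by rewrite size_drop sv addKn.
have branch0 t w : tree_op R t w = 0 -> branch_op R t w = 0.
  by rewrite /branch_op; case: t => // c e ->.
by case/orP: h => h; [rewrite (branch0 a) ?ha // bracket0l|rewrite (branch0 b) ?hb // bracket0r];
  rewrite scaler0.
Qed.

Section Words.
Variables (k : nat) (n : 'I_k -> int) (xi : {set 'I_k} -> homology L).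
Local Notation du := (u_degree n).

Lemma word_sign_perm p (F : {ffun 'I_p -> {set 'I_k}}) (s : 'S_p) :
  word_sign n [ffun i => F (s i)]
  = (-1) ^+ s * koszul (fun i => du (F i)) s * word_sign n F.
Proof.
rewrite /word_sign -perm_sign_inversions /koszul -big_split /=.
under [in RHS]eq_bigr => i _ do rewrite -big_split /=.
rewrite -(@prod_lt_perm p (fun i j => bracket_sign n (F i) (F j))
                          (fun i j => -1 * (-1) ^ (du (F i) * du (F j)))).
  by apply: eq_bigr => i _; apply: eq_bigr => j _; rewrite !ffunE.
by move=> i j; rewrite bracket_signC mulN1r.
Qed.

(** Permuting a word does not change its union, so the sum over words may be
   averaged over the permutations; the change of [word_sign] is the sign in
   the symmetrization. *)
Lemma tree_family_sym t S : (leaves t)`!%:R *: tree_family n R xi t S =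
  \sum_(F : {ffun 'I_(leaves t) -> {set 'I_k}} | cover_by F == S)
    word_sign n F *: sym_tree_op t (fun i => du (F i)) (fun i => xi (F i)).
Proof.
set p := leaves t.
under eq_bigr => F _ do rewrite /sym_tree_op scaler_sumr.
rewrite exchange_big /=.
transitivity (\sum_(s : 'S_p) tree_family n R xi t S).
  by rewrite sumr_const card_Sn scaler_nat.
apply: eq_bigr => s _; rewrite tree_family_words -/p.
pose act (u : 'S_p) (F : {ffun 'I_p -> {set 'I_k}}) := [ffun i => F (u i)].
have actK u : cancel (act u) (act u^-1%g).
  by move=> F; apply/ffunP => i; rewrite !ffunE permKV.
rewrite (reindex_inj (can_inj (actK s))) /=; apply: eq_big => [F|F _].
  rewrite /cover_by [X in _ = (X == _)](reindex_inj (@perm_inj _ s)) /=.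
  by congr (_ == _); apply: eq_bigr => i _; rewrite ffunE.
rewrite word_sign_perm scalerA mulrC /letters; congr (_ *: tree_op R t _).
by apply: eq_map => i; rewrite !ffunE.
Qed.

End Words.

Section Singletons.
Variables (k : nat) (d : 'I_k -> int) (v : 'I_k -> homology L).
Let n i := d i + 1.

Definition singletons : {ffun 'I_k -> {set 'I_k}} := [ffun i => [set i]].

Definition on_singletons (S : {set 'I_k}) : homology L :=
  if [pick i | S == [set i]] is Some i then v i else 0.

Lemma on_singletons1 i : on_singletons [set i] = v i.
Proof.
rewrite /on_singletons; case: pickP => [j /eqP/set1_inj -> //|/(_ i)].
by rewrite eqxx.
Qed.

Lemma on_singletons0 : on_singletons set0 = 0.
Proof.
rewrite /on_singletons; case: pickP => // i /eqP/setP/(_ i).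
by rewrite !inE eqxx.
Qed.

Lemma u_degree1 i : u_degree n [set i] = d i.
Proof. by rewrite /u_degree big_set1 addrK. Qed.

Lemma graded_on_singletons : (forall i, homog (d i) (v i)) ->
  graded_classes n on_singletons.
Proof.
move=> hv S; rewrite /on_singletons; case: pickP => [i /eqP ->|_]; last exact: homog0.
by rewrite u_degree1.
Qed.

(** A word of singletons covering all the indices is a permutation of the
   indices, so that the sum over words is the symmetrization. *)
Lemma tree_family_setT t : leaves t = k ->
  tree_family n R on_singletons t [set: 'I_k]%SET
  = word_sign n singletons *: sym_tree_op t d v.
Proof.
move=> tk; rewrite tree_family_words; move: tk; set p := leaves t => tk.
have lt F : size (letters n on_singletons (F : {ffun 'I_p -> {set 'I_k}})) = leaves t.
  exact: size_letters.
clearbody p; subst p.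
pose ord s : {ffun 'I_k -> {set 'I_k}} := [ffun i => [set (s : 'S_k) i]].
have ord_inj : injective ord.
  by move=> s s' /ffunP e; apply/permP => i; have := e i; rewrite !ffunE => /set1_inj.
transitivity (\sum_(F in [set ord s | s : 'S_k]%SET)
    word_sign n F *: tree_op R t (letters n on_singletons F)).
  rewrite big_mkcond [RHS]big_mkcond; apply: eq_bigr => F _.
  case: ifP => [/eqP cF|ncF]; last first.
    case: imsetP => // -[s _ e]; case/eqP: ncF; rewrite e.
    apply/setP => i; rewrite inE; apply/bigcupP; exists ((s^-1)%g i) => //.
    by rewrite ffunE permKV inE.
  case: ifP => // /negP nF.
  have [->|wF] := eqVneq (word_sign n F) 0; first by rewrite scale0r.
  have dF := word_sign_disjoint wF.
  case: (boolP (has (fun x => x.2 == 0) (letters n on_singletons F))) => [h|].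
    by rewrite tree_op0 ?scaler0 //.
  rewrite -all_predC => /allP h; case: nF.
  have sF i : exists j, F i = [set j].
    have : (u_degree n (F i), on_singletons (F i)) \in letters n on_singletons F.
      by apply: map_f; rewrite mem_enum.
    move/h; rewrite /= /on_singletons; case: pickP => [j /eqP -> _|]; last by rewrite eqxx.
    by exists j.
  pose f i := sval (cid (sF i)).
  have fE i : F i = [set f i] by exact: svalP (cid (sF i)).
  have fi : injective f.
    move=> i j e; apply/eqP; apply: contraT => /dF.
    by rewrite !fE e -setI_eq0 setIid => /eqP/setP/(_ (f j)); rewrite !inE eqxx.
  apply/imsetP; exists (perm fi) => //.
  by apply/ffunP => i; rewrite ffunE permE fE.
rewrite big_imset /=; last by move=> s s' _ _; exact: ord_inj.
rewrite /sym_tree_op scaler_sumr; apply: eq_big => [s|s _]; first by rewrite inE.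
have -> : ord s = [ffun i => singletons (s i)].
  by apply/ffunP => i; rewrite !ffunE.
rewrite word_sign_perm scalerA mulrC; congr ((_ * (_ * _)) *: tree_op R t _).
  rewrite /koszul; apply: eq_bigr => i _; apply: eq_bigr => j _.
  by rewrite !ffunE !u_degree1.
by apply: eq_map => i; rewrite !ffunE u_degree1 on_singletons1.
Qed.

(** Distinct singletons in increasing order have trivial Koszul sign; only the
   degree shifts remain, and [i] comes before [k - i - 1] others. *)
Lemma word_sign_singletons :
  word_sign n singletons = (-1) ^ (\sum_(i < k | (i.+1 < k)%N) (k - i.+1)%:Z * d i).
Proof.
rewrite sgn_sum big_mkcond; apply: eq_bigr => i _.
transitivity (\prod_(j < k | (i < j)%N) (-1 : rat) ^ d i).
  apply: eq_bigr => j ij; rewrite !ffunE /bracket_sign u_degree1 /shuffle_sign.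
  have -> : [disjoint [set i] & [set j]].
    by rewrite disjoints1 inE; apply: contraTneq ij => ->; rewrite ltnn.
  rewrite big_set1 big_pred0 ?mulr1 // => l; rewrite inE.
  by apply/negbTE; apply/negP => /andP[/eqP ->]; rewrite ltnNge ltnW.
rewrite prodr_const; have -> : #|[pred j : 'I_k | (i < j)%N]| = (k - i.+1)%N.
  rewrite -sum1_card -(big_mkord (fun j => (i < j)%N) (fun=> 1%N)) /=.
  rewrite (big_cat_nat _ (n := i.+1)) //= big_nat_cond big_pred0 ?add0n => [|j]; last first.
    by rewrite leq0n ltnS /=; case: (leqP j i).
  rewrite -[RHS]muln1 -sum_nat_const_nat big_nat_cond [RHS]big_nat_cond.
  by apply: eq_bigl => j; rewrite andbT andbAC andbb.
case: ifP => [_|/negbT]; first by rewrite mulrC -exprz_exp.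
by rewrite -leqNgt -subn_eq0 => /eqP ->.
Qed.

Lemma word_sign_singletons_sqr : word_sign n singletons * word_sign n singletons = 1.
Proof. by rewrite word_sign_singletons sgnK. Qed.

(** Up to a sign, the symmetrized operation is the value of the family of [t] at
   the full set, and [conv] is symmetric. *)
Lemma sym_tree_op_iso t t' : (forall i, homog (d i) (v i)) -> tree_iso t t' ->
  leaves t = k -> sym_tree_op t d v = sym_tree_op t' d v.
Proof.
move=> hv tt' tk.
have E t0 : leaves t0 = k -> sym_tree_op t0 d v =
    word_sign n singletons *: tree_family n R on_singletons t0 [set: 'I_k]%SET.
  by move=> e; rewrite tree_family_setT // scalerA word_sign_singletons_sqr scale1r.
rewrite !E // -?(tree_iso_leaves tt') //; congr (_ *: _).
by apply: tree_family_iso => //; exact: graded_on_singletons.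
Qed.

Lemma transferred_trees T m : planar_reps k (T k) -> (1 < k)%N -> (k <= m)%N ->
  (forall i, homog (d i) (v i)) ->
  transferred R T d v
  = 2 ^- k.-1 *: \sum_(t <- trees m | leaves t == k) hr_q R (sym_tree_op t d v).
Proof.
move=> hT k1 km hv; rewrite /transferred leqNgt k1 /=.
pose f t := if leaves t == k then hr_q R (sym_tree_op t d v) else 0.
rewrite big_seq.
transitivity (\sum_(t <- T k) (#|tree_aut t|%:R)^-1 *: f t).
  rewrite [RHS]big_seq; apply: eq_bigr => t tT; rewrite /f ifT //.
  by apply/eqP; case: hT => _ /(_ t tT).
rewrite (sum_planar_reps hT km) => [|t t' tt'].
  by congr (_ *: _); apply: eq_bigr => t; rewrite /f => ->.
rewrite /f -(tree_iso_leaves tt'); case: eqP => // e.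
by rewrite (sym_tree_op_iso hv tt').
Qed.

End Singletons.

(** The sum over the trees with [j] leaves is, word by word, a multiple of the
   transferred bracket of the classes of that word. *)
Lemma sum_tree_family_vanish T j m k (n : 'I_k -> int) xi S :
  planar_reps j (T j) -> (1 < j)%N -> (j <= m)%N -> graded_classes n xi ->
  (forall (d : 'I_j -> int) (v : 'I_j -> homology L),
     (forall i, homog (d i) (v i)) -> transferred R T d v = 0) ->
  \sum_(t <- trees m | leaves t == j) hr_q R (tree_family n R xi t S) = 0.
Proof.
move=> hT j1 jm hxi van.
have j0 : (j`!%:R : rat) != 0 by rewrite pnatr_eq0 -lt0n fact_gt0.
apply: (scalerI j0); rewrite scaler0 scaler_sumr.
transitivity (\sum_(t <- trees m | leaves t == j)
   \sum_(F : {ffun 'I_j -> {set 'I_k}} | cover_by F == S) word_sign n F *: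
     hr_q R (sym_tree_op t (fun i => u_degree n (F i)) (fun i => xi (F i)))).
  apply: eq_bigr => t /eqP tj; rewrite -(lin_scale (hr_q_linear R)).
  subst j; rewrite tree_family_sym (lin_sum (hr_q_linear R)).
  by apply: eq_bigr => F _; rewrite (lin_scale (hr_q_linear R)).
rewrite exchange_big big1 //= => F _; rewrite -scaler_sumr.
have := transferred_trees (T := T) hT j1 jm (fun i => hxi (F i)).
rewrite van => [/eqP|i]; last exact: hxi.
rewrite eq_sym scaler_eq0 => /orP[|/eqP ->]; last by rewrite scaler0.
by rewrite invr_eq0 expf_eq0 /= andbF.
Qed.

End Symmetrization.

(** * Morphisms as Maurer-Cartan families, and gauge fixing *)

Section Morphisms.
Variables (k : nat) (n : 'I_k -> int) (L : DGL).
Implicit Types (S A : {set 'I_k}).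

Lemma u_gen S (h : (0 < #|S| < k)%N) : u n S = free_gen _ (Sub S h : u_index k).
Proof. by rewrite /u insubT. Qed.

Lemma u_out S : ~~ (0 < #|S| < k)%N -> u n S = 0.
Proof. by rewrite /u; case: insubP => // g -> . Qed.

Section FromMorphism.
Variable phi : LU n -> L.
Hypothesis hphi : Lie_morphism phi.

Lemma morphism_set0 : phi (u n set0) = 0.
Proof. by case: hphi => lin _ _; rewrite u_out ?cards0 // (lin_zero lin). Qed.

Lemma graded_morphism : graded n 0 (fun S => phi (u n S)).
Proof. by case: hphi => _ deg _ S; exact: deg (u_homog n S). Qed.

Lemma morphism_boundary S : phi (u_boundary n S) = quad n (fun A => phi (u n A)) S.
Proof.
case: (hphi) => lin _ br.
rewrite -(sum_shuffles_quad graded_morphism morphism_set0) (lin_sum lin).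
apply: eq_bigr => p _; rewrite (lin_sum lin); apply: eq_bigr => s _.
by rewrite (lin_scale lin) br.
Qed.

Lemma morphism_MC S : dLie_morphism phi -> (#|S| < k)%N -> MC n (fun A => phi (u n A)) S.
Proof.
move=> [_ hd] Sk; have [->|Sn0] := eqVneq S set0.
  by rewrite /MC morphism_set0 diff0 quad_set0 // morphism_set0.
have h : (0 < #|S| < k)%N by rewrite card_gt0 Sn0.
rewrite /MC -hd -morphism_boundary; congr (phi _).
rewrite (u_gen h).
exact: (free_der_gen (fun I : u_index k => u_boundary_homog n (val I)) _).
Qed.
End FromMorphism.

Section ToMorphism.
Variable z : {set 'I_k} -> L.
Hypotheses (hz : graded n 0 z) (z0 : z set0 = 0).
Hypothesis zMC : forall S, (#|S| < k)%N -> MC n z S.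

Let f (g : u_index k) : L := z (val g).
Let hf g : homog (u_degree n (val g)) (f g).
Proof. by have := hz (val g); rewrite addr0. Qed.

Definition family_morphism : LU n -> L := free_lift f.

Let lie : Lie_morphism family_morphism.
Proof. exact: free_lift_morphism hf. Qed.

Lemma family_morphism_u S : (0 < #|S| < k)%N -> family_morphism (u n S) = z S.
Proof. by move=> h; rewrite (u_gen h) /family_morphism; exact: (free_lift_gen hf). Qed.

Lemma family_morphism_boundary S : (#|S| <= k)%N ->
  family_morphism (u_boundary n S) = quad n z S.
Proof.
move=> Sk; rewrite (morphism_boundary lie); apply: quad_local => //.
  exact: morphism_set0 lie.
move=> A /proper_card lA; have [->|An0] := eqVneq A set0.
  by rewrite z0 (morphism_set0 lie).
by rewrite family_morphism_u // card_gt0 An0 (leq_trans lA).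
Qed.

(** [phi \o diff] and [diff \o phi] are both derivations along [phi] and agree on
   the generators, by the Maurer-Cartan equation.  The sign of a derivation is
   only meaningful on homogeneous elements, whence the induction on homogeneous
   expressions. *)
Lemma family_dLie_morphism : dLie_morphism family_morphism.
Proof.
split; first exact: lie.
case: (lie) => lin deg br; have [dlin ddeg dder] := diff_der (LU n).
have [elin edeg eder] := diff_der L.
have hom m t : thomog (fun I : u_index k => u_degree n (val I)) m t ->
    family_morphism (diff (fclass _ t : LU n)) = diff (family_morphism (fclass _ t : LU n)).
  elim=> {m t} [g|m|m s t _ es _ et|m a s _ es|p q s t hs es ht et].
  - have e := free_der_gen (fun I : u_index k => u_boundary_homog n (val I)) g.
    rewrite -[fclass _ _]/(free_gen _ g : LU n) [diff _]e family_morphism_boundary.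
      rewrite /family_morphism (free_lift_gen hf) /f zMC //.
      by case/andP: (valP g).
    by case/andP: (valP g) => _ /ltnW.
  - by rewrite fclass0 (lin_zero dlin) (lin_zero lin) (lin_zero elin).
  - rewrite fclassD -[fclass _ s + fclass _ t]/((fclass _ s : LU n) + (fclass _ t : LU n)).
    by rewrite (lin_add dlin) !(lin_add lin) (lin_add elin) es et.
  - rewrite fclassZ -[a *: fclass _ s]/(a *: (fclass _ s : LU n)).
    by rewrite (lin_scale dlin) !(lin_scale lin) (lin_scale elin) es.
  - have hS : homog p (fclass _ s : LU n) by exists s.
    rewrite -fbracketE -[fbracket _ _]/(bracket (fclass _ s : LU n) (fclass _ t)).
    rewrite (dder p _ _ hS) (lin_add lin) (lin_scale lin) !br es et.
    have hS' : homog p (family_morphism (fclass _ s)).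
      by have := deg _ _ hS; rewrite addr0.
    by rewrite (eder p _ _ hS').
move=> x; have [s [w [_ hw ->]]] := homog_span x.
rewrite (lin_sum dlin) !(lin_sum lin) (lin_sum elin); apply: eq_bigr => m _.
by have [t [ht ->]] := hw m; exact: hom ht.
Qed.

End ToMorphism.
End Morphisms.

(** A cycle representing [h] differs from [i h] by a boundary, and [q] kills
   boundaries. *)
Lemma represents_q (L : DGL) (R : homotopy_retract L) z h :
  represents z h -> hr_q R z = h.
Proof.
move=> [c [-> hc]]; have [c' [ec' hc']] := hr_i_id R h.
have [w ew] : exists w : L, diff w = cycle_val c - cycle_val c'.
  by apply/homology_eqP; rewrite -hc -hc'.
have := hr_q_chain R w; rewrite ew -ec' => /eqP.
rewrite -scaleN1r (lin_add (hr_q_linear R)) (lin_scale (hr_q_linear R)) scaleN1r.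
by rewrite subr_eq0 hr_qi => /eqP.
Qed.

Section GaugeFixing.
Variables (k : nat) (n : 'I_k -> int) (L : DGL) (R : homotopy_retract L).
Variable m : nat.
Implicit Types (S A : {set 'I_k}) (y : {set 'I_k} -> L).

(** For a Maurer-Cartan family this is the gauge condition [diff (K (y S)) = 0],
   by the homotopy identity. *)
Definition gauge_fixed y S : Prop :=
  y S = hr_i R (hr_q R (y S)) + hr_K R (quad n y S).

Definition partial_MC y : Prop :=
  [/\ graded n 0 y, y set0 = 0 & forall S, (#|S| < m)%N -> MC n y S].

(** Take [b = K (y S0)]: the homotopy identity gives
   [y S0 - diff b = i (q (y S0)) + K (diff (y S0))].  The gauge transformation only
   changes [y] at sets containing [S0], hence neither at the sets already
   treated nor at their subsets. *)
Lemma gauge_step y (fixed : seq {set 'I_k}) S0 :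
  partial_MC y -> S0 != set0 -> (#|S0| < m)%N ->
  (forall A, A \in fixed -> ~~ (S0 \subset A)) ->
  (forall A, A \in fixed -> gauge_fixed y A) ->
  exists y', [/\ partial_MC y', forall j, hr_q R (y' [set j]) = hr_q R (y [set j]) &
    forall A, A \in rcons fixed S0 -> gauge_fixed y' A].
Proof.
move=> [hy y0 mc] Sn0 Sm nS fix_y.
have hb : homog (u_degree n S0 + 1) (hr_K R (y S0)).
  by have := hr_K_degree R (hy S0); rewrite addr0.
pose y' := gauge n S0 (hr_K R (y S0)) y.
have out A : ~~ (S0 \subset A) -> y' A = y A by exact: gauge_supp.
have at0 : y' S0 = y S0 - diff (hr_K R (y S0)) by exact: gauge_at.
have q0 : hr_q R (y' S0) = hr_q R (y S0).
  rewrite at0 -scaleN1r (lin_add (hr_q_linear R)) (lin_scale (hr_q_linear R)).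
  by rewrite hr_q_chain scaler0 addr0.
have y'0 : y' set0 = 0 by rewrite out // subset0.
exists y'; split.
- split=> // [|S Sm'].
    exact: graded_gauge.
  apply: gauge_MC => // A AS; apply: mc.
  exact: leq_ltn_trans (subset_leq_card AS) Sm'.
- move=> j; have [->|ne] := eqVneq [set j] S0; first exact: q0.
  rewrite out // subset1 negb_or Sn0 andbT; by rewrite eq_sym.
- move=> A; rewrite mem_rcons inE => /orP[/eqP ->|Ar].
    rewrite /gauge_fixed q0 (@quad_local _ _ _ _ y) // => [|B pB]; last first.
      by apply: out; rewrite properE in pB; case/andP: pB.
    rewrite -(mc S0 Sm) at0.
    have e : y S0 = diff (hr_K R (y S0)) + hr_K R (diff (y S0)) + hr_i R (hr_q R (y S0)).
      by rewrite -hr_homotopy subrK.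
    have G (a b c : L) : a + b + c - a = c + b.
      by rewrite -(addrA a) (addrC a) (@addrK L) addrC.
    by rewrite [X in X - _ = _]e G.
  rewrite /gauge_fixed out ?nS // (@quad_local _ _ _ _ y) //; first exact: fix_y.
  move=> B /proper_sub BA; apply: out; apply: contra (nS A Ar) => SB.
  exact: subset_trans SB BA.
Qed.

(** Treat the sets by increasing size: then no set contains one treated later. *)
Lemma gauge_fix y : partial_MC y ->
  exists y', [/\ partial_MC y', forall j, hr_q R (y' [set j]) = hr_q R (y [set j]) &
    forall A, (0 < #|A| < m)%N -> gauge_fixed y' A].
Proof.
move=> hy; pose le := fun A S : {set 'I_k} => (#|A| <= #|S|)%N.
(* The sets to be treated, by increasing size. *)
pose ss := sort le [seq A : {set 'I_k} <- enum {set 'I_k} | (0 < #|A| < m)%N].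
have tr : transitive le by move=> ? ? ?; exact: leq_trans.
have srt : sorted le ss by apply: sort_sorted => A S; exact: leq_total.
have us : uniq ss by rewrite sort_uniq filter_uniq ?enum_uniq.
have mem_ss A : (A \in ss) = (0 < #|A| < m)%N.
  by rewrite mem_sort mem_filter mem_enum andbT.
suff H r r' : ss = r ++ r' ->
    exists y', [/\ partial_MC y', forall j, hr_q R (y' [set j]) = hr_q R (y [set j]) &
      forall A, A \in r -> gauge_fixed y' A].
  have [y' [h1 h2 h3]] := H ss [::] (esym (cats0 ss)).
  by exists y'; split=> // A hA; apply: h3; rewrite mem_ss.
elim/last_ind: r r' => [|r S0 IH] r' e; first by exists y; split.
have e' : ss = r ++ S0 :: r' by rewrite -cat_rcons.
have [y1 [h1 h2 h3]] := IH _ e'.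
have /andP[S0n Sm] : (0 < #|S0| < m)%N by rewrite -mem_ss e' mem_cat inE eqxx orbT.
have Sn0 : S0 != set0 by rewrite -card_gt0.
have nS A : A \in r -> ~~ (S0 \subset A).
  move=> Ar; apply/negP => SA.
  have AS : (#|A| <= #|S0|)%N.
    move: srt; rewrite e' sorted_pairwise // pairwise_cat => /and3P[/allrelP h _ _].
    by apply: h => //; rewrite inE eqxx.
  have /eqP eA : S0 == A by rewrite eqEcard SA.
  by move: us; rewrite e' cat_uniq => /and3P[_ /norP[/= ]]; rewrite eA Ar.
have [y' [g1 g2 g3]] := gauge_step h1 Sn0 Sm nS h3.
by exists y'; split=> // j; rewrite g2.
Qed.

End GaugeFixing.

(** * The obstructions of the canonical family *)

(** If the trees with fewer than [c] leaves cancel out for each number of leaves,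
   and those with more contribute zero, only the trees with [c] leaves remain. *)
Lemma sum_leaves_top (V : nmodType) (s : seq btree) (G : btree -> V) c : (1 < c)%N ->
  (forall j, (1 < j < c)%N -> \sum_(t <- s | leaves t == j) G t = 0) ->
  (forall t, (c < leaves t)%N -> G t = 0) ->
  \sum_(t <- s | (1 < leaves t)%N) G t = \sum_(t <- s | leaves t == c) G t.
Proof.
move=> c1 low high.
have below c' : (c' <= c)%N -> \sum_(t <- s | (1 < leaves t < c')%N) G t = 0.
  elim: c' => [|c' IH] hc'; first by rewrite big_pred0 // => t; rewrite andbF.
  rewrite (bigID (fun t => leaves t == c')) /=.
  rewrite [X in _ + X](eq_bigl (fun t => (1 < leaves t < c')%N)) => [|t]; last first.
    by rewrite ltnS -andbA; congr (_ && _); rewrite [RHS]ltn_neqAle andbC.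
  rewrite IH ?addr0; last exact: ltnW.
  case: (ltnP 1 c') => h1; last first.
    rewrite big_pred0 // => t; case: eqP => [->|]; rewrite ?andbF //.
    by rewrite ltnNge h1.
  rewrite (eq_bigl (fun t => leaves t == c')) ?low ?h1 // => t.
  by case: eqP => [->|]; rewrite ?andbF // h1 ltnSn.
rewrite (bigID (fun t => leaves t == c)) /= [X in _ + X](bigID (fun t => leaves t < c)%N) /=.
rewrite [X in _ + (X + _)](eq_bigl (fun t => (1 < leaves t < c)%N)) => [|t]; last first.
  by case: (ltngtP (leaves t) c) => // _; rewrite ?andbF ?andbT.
rewrite below // add0r [X in _ + X]big1 ?addr0 => [|t /andP[/andP[_ ne]]].
  by apply: eq_bigl => t; case: eqP => [->|]; rewrite ?andbF ?c1.
by rewrite -leqNgt leq_eqVlt eq_sym (negbTE ne) => /high.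
Qed.

Section Main.
Variables (k : nat) (n : 'I_k -> int) (L : DGL) (R : homotopy_retract L).
Implicit Types (S A : {set 'I_k}) (xi : {set 'I_k} -> homology L).

Lemma picard_stable xi m S : xi set0 = 0 -> (#|S| <= m)%N ->
  picard n R xi m.+1 S = picard n R xi m S.
Proof.
move=> xi0; elim: m S => [|m IH] S Sm.
  by move: Sm; rewrite leqn0 cards_eq0 => /eqP ->; rewrite !picard_set0.
rewrite picardS [RHS]picardS; congr (_ + hr_K R _).
apply: quad_local => [||A /proper_card lA]; try exact: picard_set0.
by apply: IH; rewrite -ltnS; exact: leq_trans lA Sm.
Qed.

Definition tree_class xi S t : homology L :=
  2 ^- nodes t *: hr_q R (tree_family n R xi t S).

Lemma q_quad_picard xi m S : hr_q R (quad n (picard n R xi m) S)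
  = \sum_(t <- trees m.+1 | (1 < leaves t)%N) tree_class xi S t.
Proof.
rewrite quad_picard (lin_sum (hr_q_linear R)) /= big_cons /=.
rewrite [RHS]big_mkcond big_seq [RHS]big_seq; apply: eq_bigr => t ht.
have -> : (1 < leaves t)%N.
  have [[a b] /= [_ _ ->]] := elimT allpairsP ht.
  by rewrite (leq_add (leaves_gt0 a) (leaves_gt0 b)).
by rewrite /tree_class (lin_scale (hr_q_linear R)).
Qed.

Lemma tree_class_small xi S t : xi set0 = 0 -> (#|S| < leaves t)%N ->
  tree_class xi S t = 0.
Proof.
by move=> xi0 /(tree_family_small n R xi0)[e _]; rewrite /tree_class e hr_q0 scaler0.
Qed.

Lemma sum_tree_class xi S m j : \sum_(t <- trees m | leaves t == j) tree_class xi S t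
  = 2 ^- j.-1 *: \sum_(t <- trees m | leaves t == j) hr_q R (tree_family n R xi t S).
Proof.
rewrite scaler_sumr; apply: eq_bigr => t /eqP <-.
by rewrite /tree_class nodes_leaves.
Qed.

Lemma tree_family_singletons (xi : {set 'I_k} -> homology L) t S :
  (forall A, #|A| != 1%N -> xi A = 0) -> leaves t != #|S| ->
  tree_family n R xi t S = 0 /\ edge_family n R xi t S = 0.
Proof.
move=> xi1; elim: t S => [|a ha b hb] S.
  by rewrite eq_sym => /xi1 e; rewrite /edge_family /= e hr_i0.
move=> h; suff e : tree_family n R xi (Node a b) S = 0.
  by split=> //; rewrite /edge_family e hr_K0.
rewrite tree_familyE /conv big1 // => A _; rewrite big1 // => B /eqP AB.
case: (boolP [disjoint A & B]) => [dAB|/bracket_sign_disj ->]; last by rewrite scale0r.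
have cS : #|S| = (#|A| + #|B|)%N.
  by rewrite -AB cardsU disjoint_setI0 // cards0 subn0.
have [eA|/ha[_ ->]] := eqVneq (leaves a) #|A|; last by rewrite bracket0l scaler0.
have [eB|/hb[_ ->]] := eqVneq (leaves b) #|B|; last by rewrite bracket0r scaler0.
by rewrite cS -eA -eB /= eqxx in h.
Qed.

Variables (T : nat -> seq btree) (hT : forall j, planar_reps j (T j)).
Hypothesis hk : (3 <= k)%N.
Hypothesis hvanish : forall j, (1 <= j <= k - 2)%N ->
  forall (d : 'I_j -> int) (v : 'I_j -> homology L),
    (forall i, homog (d i) (v i)) -> transferred R T d v = 0.

(** The trees with at most [k - 2] leaves give lower brackets, which vanish, and
   [S] is too small for trees with [k] leaves or more. *)
Lemma q_quad_top xi m S : graded_classes n xi -> xi set0 = 0 ->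
  (k <= m)%N -> (#|S| < k)%N ->
  hr_q R (quad n (picard n R xi m) S)
  = \sum_(t <- trees m.+1 | leaves t == k.-1) tree_class xi S t.
Proof.
move=> hxi xi0 km Sk; rewrite q_quad_picard.
have k0 : (0 < k)%N by exact: leq_trans hk.
apply: sum_leaves_top.
- by rewrite -ltnS prednK.
- move=> j /andP[j1 jk].
  have jk2 : (j <= k - 2)%N.
    rewrite -ltnS; suff -> : (k - 2).+1 = k.-1 by [].
    by case: (k) hk => [|[|k']] //= _; rewrite !subSS subn0.
  rewrite sum_tree_class (sum_tree_family_vanish _ (hT j)) ?scaler0 //.
  + exact: leq_trans (leq_trans jk2 (leq_subr _ _)) (leqW km).
  + by apply: hvanish; rewrite (ltnW j1).
- move=> t lt; apply: tree_class_small => //; apply: leq_ltn_trans lt.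
  by rewrite -ltnS prednK.
Qed.


(** The family [y] serves only through its existence: once gauge fixed it is the
   Picard solution for its own classes, its obstruction is the homology class
   of a boundary, and at the size [k - 1] this obstruction depends only on the
   classes at singletons, which it shares with [xi]. *)
Lemma q_quad_singletons xi y m S : graded_classes n xi ->
  (forall A, #|A| != 1%N -> xi A = 0) ->
  partial_MC n k y -> (forall i, hr_q R (y [set i]) = xi [set i]) ->
  (k <= m)%N -> (#|S| < k)%N -> hr_q R (quad n (picard n R xi m) S) = 0.
Proof.
move=> hxi xi1 hy yx km Sk.
have k0 : (0 < k)%N by exact: leq_trans hk.
have xi0 : xi set0 = 0 by apply: xi1; rewrite cards0.
have [y' [[hy' y'0 mc] y'q fixed]] := gauge_fix R hy.
rewrite q_quad_top //.
have [Sk1|ne] := eqVneq #|S| k.-1; last first.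
  rewrite big1 // => t /eqP tk; apply: tree_class_small => //.
  by rewrite tk ltn_neqAle ne -ltnS prednK.
(* The classes of the gauge-fixed family, which agree with [xi] on
   singletons only. *)
pose zeta A := hr_q R (y' A).
have hzeta : graded_classes n zeta.
  by move=> A; have := hr_q_degree R (hy' A); rewrite !addr0.
have zeta0 : zeta set0 = 0 by rewrite /zeta y'0 hr_q0.
transitivity (\sum_(t <- trees m.+1 | leaves t == k.-1) tree_class zeta S t).
  apply: eq_bigr => t /eqP tk; rewrite /tree_class.
  have agree i : xi [set i] = zeta [set i] by rewrite /zeta y'q yx.
  by have [-> _] := tree_family_top n R xi0 zeta0 agree (etrans Sk1 (esym tk)).
rewrite -q_quad_top // -(@quad_local _ _ _ y') // => [||A /proper_card lA].
- by rewrite -mc // hr_q_chain.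
- exact: picard_set0.
apply: (@picard_unique _ _ _ _ _ _ k.-1) => //.
- move=> B /andP[B0 Bk]; apply: fixed; rewrite B0 /=.
  by apply: leq_ltn_trans Bk _; rewrite prednK.
- by rewrite -Sk1 ltnW.
- by apply: leq_trans (leq_trans (ltnW lA) (ltnW Sk)) km.
Qed.

(** If the equation holds below [S] then [quad z S] is a cycle, and the homotopy
   identity gives [diff (K (quad z S)) = quad z S - i (q (quad z S))]. *)
Lemma picard_MC xi m : graded_classes n xi -> xi set0 = 0 -> (k <= m)%N ->
  (forall S, (#|S| < k)%N -> hr_q R (quad n (picard n R xi m) S) = 0) ->
  forall S, (#|S| < k)%N -> MC n (picard n R xi m) S.
Proof.
move=> hxi xi0 km q0 S; move: {2}#|S|.+1 (ltnSn #|S|) => N.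
elim: N S => // N IH S SN Sk; rewrite ltnS in SN.
have z0 := @picard_set0 _ n _ R xi m xi0.
have cyc : diff (quad n (picard n R xi m) S) = 0.
  apply: quad_cycle => //; first exact: graded_picard.
  move=> A /proper_card lA; apply: IH; first exact: leq_trans lA SN.
  exact: ltn_trans lA Sk.
rewrite /MC -picard_stable ?(leq_trans (ltnW Sk)) // picardS diffD hr_i_chain add0r.
have := hr_homotopy R (quad n (picard n R xi m) S).
by rewrite q0 // hr_i0 subr0 cyc (lin_zero (hr_K_linear R)) addr0 => <-.
Qed.

End Main.

Theorem theorem1p2
  (L : DGL) (R : homotopy_retract L)
  (T : nat -> seq btree) (hT : forall j, planar_reps j (T j))
  (k : nat) (hk : (3 <= k)%N)
  (hvanish : forall j, (1 <= j <= k - 2)%N ->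
     forall (d : 'I_j -> int) (v : 'I_j -> homology L),
       (forall i, homog (d i) (v i)) -> transferred R T d v = 0)
  (d : 'I_k -> int) (x : 'I_k -> homology L)
  (hx : forall i, homog (d i) (x i))
  (hne : (whitehead d x !=set0)%classic) :
  whitehead d x
    ((-1) ^ (\sum_(i < k | (i.+1 < k)%N) (k - i.+1)%:Z * d i)
       *: transferred R T d x).
Proof.
(* The obstructions below the full set vanish because the bracket set contains
   the class of some morphism [phi]; apart from that, [phi] is discarded and the
   new morphism comes from the Picard solution [z]. *)
pose n (i : 'I_k) : int := d i + 1; pose xi := on_singletons x.
have hxi : graded_classes n xi by exact: graded_on_singletons.
have xi1 (A : {set 'I_k}) : #|A| != 1%N -> xi A = 0.
  rewrite /xi /on_singletons; case: pickP => // i /eqP ->.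
  by rewrite cards1.
have xi0 : xi set0 = 0 by exact: on_singletons0.
have km : (k <= k)%N by [].
case: hne => h0 [phi [hphi phix _]].
have MCphi : partial_MC n k (fun S => phi (u n S)).
  case: (hphi) => lie _; split.
  - exact: graded_morphism.
  - exact: morphism_set0.
  - by move=> S Sk; exact: morphism_MC.
have q0 (S : {set 'I_k}) : (#|S| < k)%N -> hr_q R (quad n (picard n R xi k) S) = 0.
  apply: (q_quad_singletons hT hk hvanish hxi xi1 MCphi) => // i.
  by rewrite (represents_q R (phix i)) /xi on_singletons1.
pose z := picard n R xi k.
have hz : graded n 0 z by exact: graded_picard.
have z0 : z set0 = 0 by exact: picard_set0.
have zMC (S : {set 'I_k}) : (#|S| < k)%N -> MC n z S by exact: picard_MC.
exists (@family_morphism k n L z); split.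
- exact: family_dLie_morphism.
- move=> j; rewrite family_morphism_u ?cards1 ?(leq_trans _ hk) //.
  have -> : z [set j] = hr_i R (x j).
    rewrite /z -picard_stable ?cards1 ?(leq_trans _ hk) // picardS.
    rewrite (@quad_local _ _ _ _ (fun=> 0)) //.
      by rewrite /quad conv0l scaler0 hr_K0 addr0 /xi on_singletons1.
    by move=> A; rewrite properEcard cards1 ltnS leqn0 cards_eq0 => /andP[_ /eqP ->].
  exact: hr_i_id.
have cyc : diff (quad n z [set: 'I_k]%SET) = 0.
  apply: quad_cycle => // A; rewrite properEcard cardsT card_ord => /andP[_]; exact: zMC.
rewrite family_morphism_boundary ?cardsT ?card_ord //.
have cycP : quad n z [set: 'I_k]%SET \in is_cycle (L := L) by rewrite unfold_in cyc.
exists (Cycle cycP); split=> //.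
have <- : hr_q R (quad n z [set: 'I_k]%SET) = hclass (Cycle cycP).
  by apply: represents_q; exists (Cycle cycP).
rewrite q_quad_picard.
have k1 : (1 < k)%N by exact: leq_trans hk.
rewrite (transferred_trees R (m := k.+1) (hT k)) //.
rewrite (sum_leaves_top (c := k)) //.
- rewrite sum_tree_class scalerA mulrC -scalerA; congr (_ *: _).
  rewrite -word_sign_singletons scaler_sumr; apply: eq_bigr => t /eqP tk.
  by rewrite tree_family_setT // (lin_scale (hr_q_linear R)).
- move=> j /andP[_ jk]; rewrite big1 // => t /eqP tj.
  have ne : leaves t != #|[set: 'I_k]%SET| by rewrite cardsT card_ord tj ltn_eqF.
  have [e _] := tree_family_singletons n R xi1 ne.
  by rewrite /tree_class e hr_q0 scaler0.
- by move=> t lt; apply: tree_class_small => //; rewrite cardsT card_ord.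
Qed.
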